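(* Let $\alpha,\beta,\gamma,\delta\in(0,1)$ with $\alpha+\beta+\gamma+\delta=2$, let $t>1$, and let $z_0$ be the unique solution in the upper half-plane of the equation $$\frac{\alpha}{z}+\frac{\beta}{z-1}+\frac{\gamma}{z-t}=\frac1{i\operatorname{Im}z}.$$ Put $$h(z)=\int_0^z\frac{x^\alpha(1-x)^\beta(1-x/t)^\gamma}{(1-x/z_0)^2(1-x/\overline{z}_0)^2}\,dx,\qquad f(z)=1-\frac{h(z)}{h(1)}$$ for $z$ in the upper half-plane, the branch of the integrand being the one taking positive values on $(0,1)$. Then $f$ maps the upper half-plane conformally onto the exterior (in the Riemann sphere) of the closed polygonal line $A_1A_2A_3A_4$, where $A_1=1$, $A_2=0$, $$A_3=-l_2e^{-\pi\beta i},\qquad A_4=A_3-l_3e^{-\pi(\beta+\gamma)i}=1+l_4e^{\pi\alpha i},$$ $$l_3=\frac{\sin\pi\alpha+l_2\sin[\pi(\alpha+\beta)]}{\sin\pi\delta},\qquad l_4=\frac{\sin[\pi(\beta+\gamma)]+l_2\sin\pi\gamma}{\sin\pi\delta},\qquad l_2=\frac{I}{h(1)},$$ with $$h(1)=B(1+\alpha,1+\beta)\,F_D^{(3)}\!\left(1+\alpha;-\gamma,2,2;2+\alpha+\beta;\tfrac1t,\tfrac1{z_0},\tfrac1{\overline{z}_0}\right),$$ $$I=\int_1^t\frac{x^\alpha(x-1)^\beta(1-x/t)^\gamma\,dx}{(1-x/z_0)^2(1-x/\overline{z}_0)^2}=\frac{(t-1)^{1+\beta+\gamma}|z_0|^4}{t^\gamma|z_0-1|^4}\,B(1+\beta,1+\gamma)\,F_D^{(3)}\!\left(1+\beta;-\alpha,2,2;2+\beta+\gamma;-(t-1),\tfrac{t-1}{z_0-1},\tfrac{t-1}{\overline{z}_0-1}\right).$$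 The lengths of the sides $A_1A_2$, $A_2A_3$, $A_3A_4$, $A_4A_1$ are $l_1=1$, $l_2$, $l_3$, $l_4$, respectively.
   Context: $B(\cdot,\cdot)$ is the Euler beta function. $F_D^{(n)}$ is the Lauricella hypergeometric function, given for $\operatorname{Re}c>\operatorname{Re}a>0$ (also outside the unit polydisk) by $$F_D^{(n)}(a;b_1,\dots,b_n;c;z_1,\dots,z_n)=\frac1{B(a,c-a)}\int_0^1u^{a-1}(1-u)^{c-a-1}\prod_{j=1}^n(1-uz_j)^{-b_j}\,du .$$ The equation for $z_0$ is equivalent to the vanishing of the residue at $z_0$ of the integrand of $h$, so $h$ (integrated along paths in the closed upper half-plane avoiding $z_0$) is a single-valued meromorphic function in the upper half-plane with a pole at $z_0$, and $f(z_0)=\infty$. The points $0,1,t,\infty$ of the real axis correspond under $f$ to $A_1,A_2,A_3,A_4$. Conformal maps take values in the Riemann sphere. *)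

(* Defs.v *)
From Stdlib Require Import Reals List.
From Coquelicot Require Import Coquelicot.
Open Scope C_scope.

Definition Cexp (z : C) : C := RtoC (exp (Re z)) * (cos (Im z), sin (Im z)).

(* Principal argument, with values in (-PI, PI] (irrelevant value at 0). *)
Definition Carg (z : C) : R :=
  if Rle_dec 0 (Im z) then acos (Re z / Cmod z) else Ropp (acos (Re z / Cmod z)).

Definition Clog (z : C) : C := (ln (Cmod z), Carg z).

(* Principal power w^a, set to 0 at w = 0.  For a > 0 it is continuous on the
   whole closed upper half-plane, because Carg is PI on the negative axis. *)
Definition Cpower (w a : C) : C :=
  if Ceq_dec w 0 then 0 else Cexp (a * Clog w).

(* The same power with the argument of w taken in [-PI, PI).  It agrees with
   Cpower off the negative axis; for a > 0 it is continuous on the whole closed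
   lower half-plane. *)
Definition Cpower_low (w a : C) : C := Cconj (Cpower (Cconj w) (Cconj a)).

Definition Cint (f : R -> C) (a b : R) : C :=
  RInt (V := C_R_CompleteNormedModule) f a b.

Definition Cint01 (f : R -> C) : C :=
  RInt_gen (V := C_R_CompleteNormedModule) f (at_right 0) (at_left 1).

Definition Beta (a b : C) : C :=
  Cint01 (fun u => Cpower u (a - 1) * Cpower (1 - u) (b - 1)).

(* F_D^(n)(a; b_1, ..., b_n; c; z_1, ..., z_n) for Re c > Re a > 0, with
   n = length bs = length zs. *)
Definition Lauricella_FD (a : C) (bs : list C) (c : C) (zs : list C) : C :=
  / Beta a (c - a) *
  Cint01 (fun u =>
    Cpower u (a - 1) * Cpower (1 - u) (c - a - 1) *
    fold_right Cmult 1
      (map (fun bz => Cpower (1 - u * snd bz) (- fst bz)) (combine bs zs))).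

Definition UHP (z : C) : Prop := (0 < Im z)%R.
Definition closed_UHP (z : C) : Prop := (0 <= Im z)%R.

Definition z0_equation (alpha beta gamma t : R) (z : C) : Prop :=
  alpha / z + beta / (z - 1) + gamma / (z - t) = 1 / (Ci * Im z).

(* On the closed upper half-plane x lies in the closed upper half-plane and
   1 - x, 1 - x/t in the closed lower one.  With these choices of the argument
   the function is holomorphic in the upper half-plane minus z0, continuous up
   to the real axis, and positive on (0, 1). *)
Definition integrand (alpha beta gamma t : R) (z0 x : C) : C :=
  Cpower x alpha * Cpower_low (1 - x) beta * Cpower_low (1 - x / t) gamma
  / ((1 - x / z0) ^ 2 * (1 - x / Cconj z0) ^ 2).

(* path_int D g a b l: l is the integral of g along some piecewise C^1 path
   from a to b inside D.  (A C^1 path on [0, 1] extends to a C^1 map on R, so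
   requiring two-sided derivatives at 0 and 1 is no restriction.) *)
Inductive path_int (D : C -> Prop) (g : C -> C) : C -> C -> C -> Prop :=
| path_int_C1 (p v : R -> C) (l : C) :
    (forall s : R, is_derive (V := C_R_NormedModule) p s (v s)) ->
    (forall s : R, continuous (U := C_UniformSpace) v s) ->
    (forall s : R, (0 <= s <= 1)%R -> D (p s)) ->
    is_RInt (V := C_R_NormedModule) (fun s => g (p s) * v s) 0 1 l ->
    path_int D g (p 0%R) (p 1%R) l
| path_int_cat (a b c l m : C) :
    path_int D g a b l -> path_int D g b c m -> path_int D g a c (l + m).

Definition h_value (alpha beta gamma t : R) (z0 z l : C) : Prop :=
  path_int (fun x => closed_UHP x /\ x <> z0)
    (integrand alpha beta gamma t z0) 0 z l.

Definition hfun (alpha beta gamma t : R) (z0 z : C) : C :=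
  iota (T := C_R_CompleteNormedModule) (h_value alpha beta gamma t z0 z).

Inductive sphere : Type := Fin (w : C) | Inf.

Definition chart_0 (w : sphere) : C :=
  match w with Fin x => x | Inf => 0 end.
Definition chart_inf (w : sphere) : C :=
  match w with Fin x => / x | Inf => 0 end.

Definition Cdiff_at (f : C -> C) (z : C) : Prop :=
  ex_derive (K := C_AbsRing) (V := C_NormedModule) f z.

Definition holomorphic_at (F : C -> sphere) (z : C) : Prop :=
  match F z with
  | Fin _ => locally (T := C_UniformSpace) z (fun x => F x <> Inf) /\
             Cdiff_at (fun x => chart_0 (F x)) z
  | Inf => locally (T := C_UniformSpace) z (fun x => F x <> Fin 0) /\
           Cdiff_at (fun x => chart_inf (F x)) z
  end.

Definition conformal_onto (D : C -> Prop) (F : C -> sphere)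
    (W : sphere -> Prop) : Prop :=
  (forall z, D z -> holomorphic_at F z) /\
  (forall z1 z2, D z1 -> D z2 -> F z1 = F z2 -> z1 = z2) /\
  (forall w, W w <-> exists z, D z /\ F z = w).

Definition segment (a b z : C) : Prop :=
  exists s : R, (0 <= s <= 1)%R /\ z = (1 - s) * a + s * b.

Definition closed_polyline4 (a b c d z : C) : Prop :=
  segment a b z \/ segment b c z \/ segment c d z \/ segment d a z.

(* The component containing infinity of the complement of P in the sphere, for
   a compact set P of the plane: w <> Inf belongs to it iff a path in the
   complement of P leads from w to infinity. *)
Definition exterior (P : C -> Prop) (w : sphere) : Prop :=
  match w with
  | Inf => True
  | Fin z => exists p : R -> C,
      p 0%R = z /\
      (forall s : R, continuous (U := C_UniformSpace) p s) /\
      (forall s : R, (0 <= s)%R -> ~ P (p s)) /\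
      filterlim (fun s => Cmod (p s))
        (Rbar_locally p_infty) (Rbar_locally p_infty)
  end.

Definition fval (alpha beta gamma t : R) (z0 z : C) : C :=
  1 - hfun alpha beta gamma t z0 z / hfun alpha beta gamma t z0 1.

Definition fmap (alpha beta gamma t : R) (z0 z : C) : sphere :=
  if Ceq_dec z z0 then Inf else Fin (fval alpha beta gamma t z0 z).

Definition Cnear_infinity (P : C -> Prop) : Prop :=
  exists M : R, forall z : C, (M < Cmod z)%R -> P z.

(* f(z) tends to A when z tends, inside the upper half-plane, to the boundary
   point whose neighbourhoods generate F. *)
Definition boundary_value (f : C -> C) (F : (C -> Prop) -> Prop) (A : C) : Prop :=
  filterlim f (within UHP F) (locally (T := C_UniformSpace) A).

(* Main.v *)
(* The pole z0 is the unique critical point of a proper, strictly convex function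
   on the hyperbolic plane.  Writing the integrand as Phi(x) / (x - z0)^2 up to a
   constant, Phi'(z0) = 0 by the choice of z0, so that
     d/dx (- Phi(x) / (x - z0)) + Phi'(x) / (x - z0)
   is the integrand with Phi'(x) / (x - z0) holomorphic in the whole half-plane:
   the integrand has a single-valued primitive H with a simple pole at z0.  The
   mean value inequality extends H to the real axis and to infinity.

   The argument of the integrand is constant on each of the four intervals of
   the real line, so f maps these monotonically to the sides of a polygon; its
   angles make it a convex quadrilateral Q, and the closing condition at
   infinity determines l3 and l4.

   Off the boundary of Q the number of preimages under f is locally constant,
   because f is a local homeomorphism which is proper there.  It is 1 near
   infinity (the simple pole), hence on the exterior of Q.  A value in Q would
   force all interior values to be taken, in particular values tending to the
   point f(1/2) of the first side.  Their preimages accumulate neither on (0, 1),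
   near which Im f < 0, nor at an interior point, since then exterior values near
   f(1/2) would be taken twice. *)
Require Import Defs.
From Stdlib Require Import Reals List Lra Psatz ClassicalEpsilon Classical.
From Coquelicot Require Import Coquelicot.
Import ListNotations.
Open Scope R_scope.

(** * Limits and complex derivatives *)

(** All exponents are positive, so the integrand is continuous up to the real axis, but it is not
    differentiable at 0, 1, t, and each principal power is continuous on one closed half-plane only.
    Limits and derivatives are therefore taken relative to a domain [D]. With [D] the closed
    half-plane, the primitive has a derivative at every real point, branch points included, and the
    fundamental theorem applies unchanged to paths that touch the axis. At infinity the integrand
    decays like |x|^(-2-delta); in the coordinate y = -1/x it becomes a derivative that is
    continuous at y = 0 with value 0. Star-shapedness takes the place of Cauchy's theorem: the
    primitive of the regular remainder is an integral along segments issuing from z0. Local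
    inversion is obtained by minimising |F - w| over a square. Compactness enters through statements
    [Q z d] that persist when the radius d shrinks: if they hold near each point for some d, they
    hold with one common d on a compact set, and the closed half-plane is made compact by a
    condition at infinity. *)

Definition clim {T : Type} (F : (T -> Prop) -> Prop) (f : T -> C) (l : C) : Prop :=
  forall e : R, 0 < e -> F (fun w => Cmod (f w - l) < e).

(** The point [z] need not lie in [D]: the open half-plane gives limits at real points from inside,
    the half-plane without z0 gives punctured limits at the pole. *)
Definition nb (D : C -> Prop) (z : C) (P : C -> Prop) : Prop :=
  exists d : R, 0 < d /\ forall w, D w -> Cmod (w - z) < d -> P w.

Global Instance nb_filter D z : Filter (nb D z).
Proof.
  split.
  - exists 1. split; [lra|auto].
  - intros P Q [d [Hd HP]] [e [He HQ]].
    exists (Rmin d e). split; [now apply Rmin_glb_lt|].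
    intros w Hw Hm. split.
    + apply HP; auto. eapply Rlt_le_trans; [exact Hm|apply Rmin_l].
    + apply HQ; auto. eapply Rlt_le_trans; [exact Hm|apply Rmin_r].
  - intros P Q H [d [Hd HP]]. exists d; split; auto.
Qed.

Lemma Copp_involutive z : (- - z)%C = z.
Proof. ring. Qed.

Lemma RtoC_neq_0 r : r <> 0 -> RtoC r <> RtoC 0.
Proof. intros H E. apply H. now apply RtoC_inj. Qed.

Lemma Cinv_neq_0 w : w <> RtoC 0 -> (/ w)%C <> RtoC 0.
Proof. intros Hw E. apply C1_nz. rewrite <- (Cinv_l _ Hw), E. ring. Qed.

Lemma Cconj_RtoC r : Cconj (RtoC r) = RtoC r.
Proof. unfold Cconj, RtoC. simpl. now rewrite Ropp_0. Qed.

Lemma Cconj_neq_0 z : z <> RtoC 0 -> Cconj z <> RtoC 0.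
Proof. intros Hw H. apply Hw. rewrite <- (Cconj_conj z), H. apply Cconj_RtoC. Qed.

Lemma Cmod_minus_sym a b : Cmod (a - b) = Cmod (b - a).
Proof. rewrite <- Cmod_opp. f_equal. ring. Qed.

Lemma Cmod_tri a b c : Cmod (a - c) <= Cmod (a - b) + Cmod (b - c).
Proof. replace (a - c)%C with ((a - b) + (b - c))%C by ring. apply Cmod_triangle. Qed.

Lemma Cmod_sub_le a b : Cmod (a - b) <= Cmod a + Cmod b.
Proof. rewrite <- (Cmod_opp b). apply Cmod_triangle. Qed.

Lemma Cmod_sub_ge a b : Cmod a - Cmod b <= Cmod (a - b).
Proof.
  generalize (Cmod_triangle (a - b) b). replace (a - b + b)%C with a by ring. lra.
Qed.

Lemma Cmod_pos z : z <> RtoC 0 -> 0 < Cmod z.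
Proof. apply Cmod_gt_0. Qed.

Lemma Cmod_minus_pos a b : a <> b -> 0 < Cmod (a - b).
Proof.
  intros H. apply Cmod_gt_0. intros E. apply H.
  replace a with (a - b + b)%C by ring. rewrite E. ring.
Qed.

Lemma Cmod_nonneg_R r : 0 <= r -> Cmod r = r.
Proof. intros; rewrite Cmod_R; now apply Rabs_pos_eq. Qed.

Lemma nb_mono (D D' : C -> Prop) z P : (forall w, D' w -> D w) -> nb D z P -> nb D' z P.
Proof. intros H [d [Hd HP]]; exists d; split; auto. Qed.

Lemma nb_domain D z : nb D z D.
Proof. exists 1; split; [lra|auto]. Qed.

Section Limits.
Context {T : Type} {F : (T -> Prop) -> Prop} {FF : Filter F}.

Lemma clim_const c : clim F (fun _ => c) c.
Proof.
  intros e He. apply filter_forall. intros _.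
  replace (c - c)%C with (RtoC 0) by ring. now rewrite Cmod_0.
Qed.

Lemma clim_ext f g l : F (fun w => f w = g w) -> clim F f l -> clim F g l.
Proof.
  intros E H e He. generalize (filter_and _ _ E (H e He)).
  apply filter_imp. intros x [<- Hx]; exact Hx.
Qed.

Lemma clim_plus f g a b : clim F f a -> clim F g b -> clim F (fun w => f w + g w)%C (a + b).
Proof.
  intros Hf Hg e He. assert (He2 : 0 < e / 2) by lra.
  generalize (filter_and _ _ (Hf _ He2) (Hg _ He2)).
  apply filter_imp. intros x [H1 H2].
  replace (f x + g x - (a + b))%C with ((f x - a) + (g x - b))%C by ring.
  eapply Rle_lt_trans; [apply Cmod_triangle|lra].
Qed.

Lemma clim_bounded f a : clim F f a -> F (fun w => Cmod (f w) < Cmod a + 1).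
Proof.
  intros Hf. generalize (Hf 1 Rlt_0_1). apply filter_imp. intros x H.
  generalize (Cmod_sub_ge (f x) a). lra.
Qed.

Lemma clim_mult f g a b : clim F f a -> clim F g b -> clim F (fun w => f w * g w)%C (a * b).
Proof.
  intros Hf Hg e He.
  set (K := Cmod a + Cmod b + 1).
  assert (HK : 0 < K) by (unfold K; generalize (Cmod_ge_0 a) (Cmod_ge_0 b); lra).
  assert (He' : 0 < e / (2 * K)) by (apply Rdiv_lt_0_compat; lra).
  generalize (filter_and _ _ (clim_bounded _ _ Hf)
    (filter_and _ _ (Hf _ He') (Hg _ He'))).
  apply filter_imp. intros x [H0 [H1 H2]].
  replace (f x * g x - a * b)%C with (f x * (g x - b) + (f x - a) * b)%C by ring.
  eapply Rle_lt_trans; [apply Cmod_triangle|]. rewrite !Cmod_mult.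
  assert (E : K * (e / (2 * K)) = e / 2) by (field; lra).
  assert (Cmod (f x) * Cmod (g x - b) <= (Cmod a + 1) * (e / (2 * K))).
  { apply Rmult_le_compat; try apply Cmod_ge_0; lra. }
  assert (Cmod (f x - a) * Cmod b <= (e / (2 * K)) * Cmod b).
  { apply Rmult_le_compat_r; [apply Cmod_ge_0|lra]. }
  assert ((Cmod a + 1) * (e / (2 * K)) + (e / (2 * K)) * Cmod b = e / 2).
  { rewrite <- E. unfold K. ring. }
  lra.
Qed.

Lemma clim_opp f a : clim F f a -> clim F (fun w => - f w)%C (- a).
Proof.
  intros H e He. generalize (H e He). apply filter_imp. intros x Hx.
  replace (- f x - - a)%C with (- (f x - a))%C by ring. now rewrite Cmod_opp.
Qed.

Lemma clim_minus f g a b : clim F f a -> clim F g b -> clim F (fun w => f w - g w)%C (a - b).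
Proof. intros Hf Hg. apply clim_plus; auto. now apply clim_opp. Qed.

Lemma clim_away f a : a <> RtoC 0 -> clim F f a -> F (fun w => Cmod a / 2 < Cmod (f w)).
Proof.
  intros Ha Hf. generalize (Cmod_pos _ Ha); intros Hp.
  assert (Hp2 : 0 < Cmod a / 2) by lra.
  generalize (Hf _ Hp2). apply filter_imp. intros x H.
  rewrite Cmod_minus_sym in H. generalize (Cmod_sub_ge a (f x)). lra.
Qed.

Lemma clim_inv f a : a <> RtoC 0 -> clim F f a -> clim F (fun w => / f w)%C (/ a).
Proof.
  intros Ha Hf e He. generalize (Cmod_pos _ Ha); intros Hp.
  assert (H1 : 0 < e * (Cmod a * Cmod a / 2)).
  { apply Rmult_lt_0_compat; [exact He|]. assert (0 < Cmod a * Cmod a) by now apply Rmult_lt_0_compat. lra. }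
  generalize (filter_and _ _ (clim_away _ _ Ha Hf) (Hf _ H1)).
  apply filter_imp. intros x [H2 H3].
  assert (Hx : f x <> RtoC 0) by (intros E; rewrite E, Cmod_0 in H2; lra).
  replace (/ f x - / a)%C with (- (f x - a) / (f x * a))%C by (now field).
  rewrite Cmod_div by (now apply Cmult_neq_0).
  rewrite Cmod_opp, Cmod_mult.
  apply Rmult_lt_reg_r with (Cmod (f x) * Cmod a); [nra|].
  unfold Rdiv. rewrite Rmult_assoc, Rinv_l by nra. nra.
Qed.

Lemma clim_div f g a b : b <> RtoC 0 -> clim F f a -> clim F g b ->
  clim F (fun w => f w / g w)%C (a / b).
Proof. intros; apply clim_mult; auto. now apply clim_inv. Qed.

Lemma clim_neq_0 f a : a <> RtoC 0 -> clim F f a -> F (fun w => f w <> RtoC 0).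
Proof.
  intros Ha Hf. generalize (clim_away _ _ Ha Hf). apply filter_imp.
  intros x H E. rewrite E, Cmod_0 in H. generalize (Cmod_ge_0 a). lra.
Qed.

Lemma clim_conj f a : clim F f a -> clim F (fun w => Cconj (f w)) (Cconj a).
Proof.
  intros H e He. generalize (H e He). apply filter_imp. intros x Hx.
  replace (Cconj (f x) - Cconj a)%C with (Cconj (f x - a))%C.
  now rewrite Cmod_conj. now rewrite Cminus_conj.
Qed.

Lemma clim_Cmod f a : clim F f a -> clim F (fun w => RtoC (Cmod (f w))) (Cmod a).
Proof.
  intros H e He. generalize (H e He). apply filter_imp. intros x Hx.
  rewrite <- RtoC_minus, Cmod_R. apply Rabs_def1.
  generalize (Cmod_sub_ge (f x) a); lra.
  rewrite Cmod_minus_sym in Hx. generalize (Cmod_sub_ge a (f x)); lra.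
Qed.

Lemma clim_bound_le f a c M {PF : ProperFilter F} :
  clim F f a -> F (fun w => Cmod (f w - c) <= M) -> Cmod (a - c) <= M.
Proof.
  intros H HM. apply Rnot_lt_le. intros Hlt.
  assert (Hp : 0 < Cmod (a - c) - M) by lra.
  generalize (filter_and _ _ HM (H _ Hp)). intros HF. destruct (filter_ex _ HF) as [x [H1 H2]].
  rewrite Cmod_minus_sym in H2.
  generalize (Cmod_tri a (f x) c). lra.
Qed.

Lemma clim_unique f a b {PF : ProperFilter F} : clim F f a -> clim F f b -> a = b.
Proof.
  intros Ha Hb. apply NNPP. intros N. generalize (Cmod_minus_pos _ _ N). intros Hp.
  assert (Cmod (a - b) <= Cmod (a - b) / 2); [|lra].
  apply (clim_bound_le f); auto.
  assert (Hp2 : 0 < Cmod (a - b) / 2) by lra.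
  generalize (Hb _ Hp2). apply filter_imp; intros; lra.
Qed.
End Limits.

Lemma clim_comp {T} (F : (T -> Prop) -> Prop) {FF : Filter F} (f : T -> C) (g : C -> C) D a l :
  clim F f a -> F (fun w => D (f w)) -> clim (nb D a) g l -> clim F (fun w => g (f w)) l.
Proof.
  intros Hf HD Hg e He. destruct (Hg e He) as [d [Hd H]].
  generalize (filter_and _ _ HD (Hf d Hd)). apply filter_imp. intros x [H1 H2]. now apply H.
Qed.

Lemma clim_mono {T} (F G : (T -> Prop) -> Prop) f l :
  (forall P, F P -> G P) -> clim F f l -> clim G f l.
Proof. intros H Hf e He. apply H, Hf, He. Qed.

Lemma clim_id D z : clim (nb D z) (fun w => w) z.
Proof. intros e He. exists e; auto. Qed.

(* Caratheodory's form of (relative) complex differentiability: the product,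
   inverse and chain rules become algebra plus continuity of the slope [q]. *)
Definition cder (D : C -> Prop) (f : C -> C) (z l : C) : Prop :=
  exists q : C -> C, nb D z (fun w => f w = (f z + q w * (w - z))%C) /\ clim (nb D z) q l.

Lemma cder_cont D f z l : cder D f z l -> clim (nb D z) f (f z).
Proof.
  intros [q [H1 H2]].
  apply (clim_ext (fun w => f z + q w * (w - z))%C).
  - revert H1. apply filter_imp. now intros.
  - assert (E : (f z + l * (z - z))%C = f z) by ring.
    enough (H : clim (nb D z) (fun w => f z + q w * (w - z))%C (f z + l * (z - z)))
      by (now rewrite E in H).
    apply clim_plus; [apply clim_const|]. apply clim_mult; auto.
    apply clim_minus; [apply clim_id|apply clim_const].
Qed.

Lemma cder_eps D f z l : cder D f z l <->
  forall e, 0 < e -> nb D z (fun w => Cmod (f w - f z - l * (w - z)) <= e * Cmod (w - z)).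
Proof.
  split.
  - intros [q [H1 H2]] e He. generalize (filter_and _ _ H1 (H2 e He)).
    apply filter_imp. intros w [E H]. rewrite E.
    replace (f z + q w * (w - z) - f z - l * (w - z))%C with ((q w - l) * (w - z))%C by ring.
    rewrite Cmod_mult. apply Rmult_le_compat_r; [apply Cmod_ge_0|lra].
  (* The slope is the difference quotient, completed by [l] at [z]. *)
  - intros H. exists (fun w => if Ceq_dec w z then l else ((f w - f z) / (w - z))%C). split.
    + apply filter_forall. intros w. destruct (Ceq_dec w z) as [->|N]; [ring|].
      field. intros E. apply N. replace w with (w - z + z)%C by ring. rewrite E; ring.
    + intros e He. assert (He2 : 0 < e / 2) by lra.
      generalize (H _ He2). apply filter_imp. intros w Hw.
      destruct (Ceq_dec w z) as [->|N].
      * replace (l - l)%C with (RtoC 0) by ring. now rewrite Cmod_0.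
      * assert (N' : (w - z)%C <> RtoC 0).
        { intros E. apply N. replace w with (w - z + z)%C by ring. rewrite E; ring. }
        generalize (Cmod_pos _ N'); intros Hp.
        replace ((f w - f z) / (w - z) - l)%C with ((f w - f z - l * (w - z)) / (w - z))%C
          by (now field).
        rewrite Cmod_div by auto.
        apply Rle_lt_trans with (e / 2); [|lra].
        apply Rmult_le_reg_r with (Cmod (w - z)); auto.
        unfold Rdiv at 1. rewrite Rmult_assoc, Rinv_l; lra.
Qed.

Lemma cder_mono (D D' : C -> Prop) f z l : (forall w, D' w -> D w) -> cder D f z l -> cder D' f z l.
Proof.
  intros H [q [H1 H2]]. exists q. split.
  - now apply (nb_mono D).
  - intros e He. apply (nb_mono D); auto.
Qed.

Lemma cder_const D c z : cder D (fun _ => c) z 0.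
Proof.
  exists (fun _ => RtoC 0). split; [apply filter_forall; intros; ring|apply clim_const].
Qed.

Lemma cder_id D z : cder D (fun w => w) z 1.
Proof.
  exists (fun _ => RtoC 1). split; [apply filter_forall; intros; ring|apply clim_const].
Qed.

Lemma cder_ext D f g z l : f z = g z -> nb D z (fun w => f w = g w) -> cder D f z l -> cder D g z l.
Proof.
  intros Ez E [q [H1 H2]]. exists q; split; auto.
  generalize (filter_and _ _ E H1). apply filter_imp. intros w [<- ->]. now rewrite Ez.
Qed.

Lemma cder_plus D f g z a b : cder D f z a -> cder D g z b ->
  cder D (fun w => f w + g w)%C z (a + b).
Proof.
  intros [q [H1 H2]] [r [H3 H4]]. exists (fun w => q w + r w)%C. split.
  - generalize (filter_and _ _ H1 H3). apply filter_imp. intros w [-> ->]. ring.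
  - now apply clim_plus.
Qed.

Lemma cder_mult D f g z a b : cder D f z a -> cder D g z b ->
  cder D (fun w => f w * g w)%C z (a * g z + f z * b).
Proof.
  intros Hf Hg. generalize (cder_cont _ _ _ _ Hf); intros Cf.
  destruct Hf as [q [H1 H2]], Hg as [r [H3 H4]].
  exists (fun w => q w * g z + f w * r w)%C. split.
  - generalize (filter_and _ _ H1 H3). apply filter_imp. intros w [-> ->]. ring.
  - apply clim_plus; apply clim_mult; auto; apply clim_const.
Qed.

Lemma cder_scal D f z a c : cder D f z a -> cder D (fun w => c * f w)%C z (c * a).
Proof.
  intros H. generalize (cder_mult D (fun _ => c) f z _ _ (cder_const D c z) H).
  now replace (0 * f z + c * a)%C with (c * a)%C by ring.
Qed.

Lemma cder_opp D f z a : cder D f z a -> cder D (fun w => - f w)%C z (- a).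
Proof.
  intros [q [H1 H2]]. exists (fun w => - q w)%C. split.
  - revert H1. apply filter_imp. intros w ->. ring.
  - now apply clim_opp.
Qed.

Lemma cder_minus D f g z a b : cder D f z a -> cder D g z b ->
  cder D (fun w => f w - g w)%C z (a - b).
Proof. intros; apply cder_plus; auto. now apply cder_opp. Qed.

Lemma cder_inv D f z a : f z <> RtoC 0 -> cder D f z a ->
  cder D (fun w => / f w)%C z (- a / (f z * f z)).
Proof.
  intros N Hf. generalize (cder_cont _ _ _ _ Hf); intros Cf.
  destruct Hf as [q [H1 H2]].
  exists (fun w => - q w / (f w * f z))%C. split.
  - generalize (filter_and _ _ H1 (clim_neq_0 _ _ N Cf)). apply filter_imp.
    intros w [E Hw].
    replace (- q w / (f w * f z) * (w - z))%C with (- (q w * (w - z)) / (f w * f z))%C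
      by (now field).
    replace (q w * (w - z))%C with (f w - f z)%C by (rewrite E; ring). now field.
  - apply clim_div; [now apply Cmult_neq_0|now apply clim_opp|].
    apply clim_mult; auto; apply clim_const.
Qed.

Lemma cder_comp D D' f g z a b : cder D f z a -> cder D' g (f z) b ->
  nb D z (fun w => D' (f w)) -> cder D (fun w => g (f w)) z (b * a).
Proof.
  intros Hf Hg HD. generalize (cder_cont _ _ _ _ Hf); intros Cf.
  destruct Hf as [q [H1 H2]], Hg as [r [H3 H4]].
  exists (fun w => r (f w) * q w)%C. split.
  - destruct H3 as [d [Hd H3]].
    generalize (filter_and _ _ H1 (filter_and _ _ HD (Cf d Hd))). apply filter_imp.
    intros w [E [Hw1 Hw2]]. rewrite (H3 (f w)) by auto.
    rewrite E at 2. ring.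
  - apply clim_mult; auto. now apply (clim_comp _ f r D' (f z)).
Qed.

Lemma cder_unique_val D f z a b : a = b -> cder D f z a -> cder D f z b.
Proof. now intros ->. Qed.

Definition everywhere (z : C) : Prop := True.

Lemma cder_open (D : C -> Prop) f z l :
  nb everywhere z D -> cder D f z l -> cder everywhere f z l.
Proof.
  intros [d [Hd HD]] H. rewrite cder_eps in H |- *. intros e He.
  destruct (H e He) as [d' [Hd' H']].
  exists (Rmin d d'). split; [now apply Rmin_glb_lt|]. intros w _ Hw.
  apply H'; [apply HD; [exact I|]|]; (eapply Rlt_le_trans; [exact Hw|]);
    [apply Rmin_l|apply Rmin_r].
Qed.

Lemma locally_nb (z : C) (P : C -> Prop) : locally (T := C_UniformSpace) z P <-> nb everywhere z P.
Proof.
  split; intros H.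
  - apply locally_C in H. destruct H as [d H]. exists d. split; [apply cond_pos|].
    intros w _ Hw. apply H. exact Hw.
  - apply locally_C. destruct H as [d [Hd H]]. exists (mkposreal d Hd).
    intros w Hw. apply H; [exact I|exact Hw].
Qed.

Lemma within_nb (D : C -> Prop) (z : C) (P : C -> Prop) : within D (locally (T := C_UniformSpace) z) P <-> nb D z P.
Proof.
  unfold within. rewrite locally_nb. unfold nb. split; intros [d [Hd H]]; exists d; split; auto.
  intros w Dw Hw. now apply H.
Qed.

Lemma clim_filterlim {T} (F : (T -> Prop) -> Prop) {FF : Filter F} f l :
  clim F f l <-> filterlim f F (locally (T := C_UniformSpace) l).
Proof.
  split.
  - intros H P HP. apply locally_nb in HP. destruct HP as [d [Hd HP]].
    generalize (H d Hd). unfold filtermap. apply filter_imp. intros x Hx. now apply HP.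
  - intros H e He. apply (H (fun w => Cmod (w - l) < e)).
    apply locally_nb. exists e. split; auto.
Qed.

Lemma cder_is_derive f z l : cder everywhere f z l ->
  is_derive (K := C_AbsRing) (V := C_NormedModule) f z l.
Proof.
  intros H. rewrite cder_eps in H. split.
  - apply is_linear_scal_l.
  - intros x Hx.
    apply (is_filter_lim_locally_unique (K := C_AbsRing) (V := AbsRing_NormedModule C_AbsRing))
      in Hx. subst x. intros eps.
    destruct (H eps (cond_pos eps)) as [d [Hd Hn]].
    exists (mkposreal d Hd). intros w Hw. generalize (Hn w I Hw).
    intros HH. change (norm (minus (minus (f w) (f z)) (scal (minus w z) l))) with
      (Cmod (f w - f z - (w - z) * l)).
    change (norm (minus w z)) with (Cmod (w - z)).
    now rewrite (Cmult_comm (w - z) l).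
Qed.

(** * Exponential, logarithm and powers *)

Lemma C_ext (a b : C) : Re a = Re b -> Im a = Im b -> a = b.
Proof. destruct a, b; simpl; now intros -> ->. Qed.

Lemma Cmod_le_abs (z : C) : Cmod z <= Rabs (Re z) + Rabs (Im z).
Proof.
  replace z with (RtoC (Re z) + Ci * RtoC (Im z))%C at 1.
  - eapply Rle_trans; [apply Cmod_triangle|].
    rewrite Cmod_mult, Cmod_Ci, !Cmod_R. lra.
  - destruct z as [x y]; apply C_ext; simpl; ring.
Qed.

Lemma im_le_Cmod (z : C) : Rabs (Im z) <= Cmod z.
Proof.
  generalize (Rmax_Cmod z). intros H. eapply Rle_trans; [|exact H]. apply Rmax_r.
Qed.

Lemma Cmod_sqr (z : C) : Cmod z * Cmod z = Re z * Re z + Im z * Im z.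
Proof. generalize (Cmod2_alt z). simpl. lra. Qed.

Lemma derivable_pt_lim_eps f x l : derivable_pt_lim f x l ->
  forall e, 0 < e -> exists d, 0 < d /\
    forall h, Rabs h < d -> Rabs (f (x + h) - f x - l * h) <= e * Rabs h.
Proof.
  intros H e He. destruct (H e He) as [d Hd]. exists d; split; [apply cond_pos|].
  intros h Hh. destruct (Req_dec h 0) as [->|N].
  - rewrite Rplus_0_r, Rmult_0_r, Rminus_0_r, Rminus_diag, Rabs_R0. lra.
  - specialize (Hd h N Hh).
    replace (f (x + h) - f x - l * h) with (((f (x + h) - f x) / h - l) * h) by (now field).
    rewrite Rabs_mult. apply Rmult_le_compat_r; [apply Rabs_pos|lra].
Qed.

Lemma Cexp_plus a b : Cexp (a + b) = (Cexp a * Cexp b)%C.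
Proof.
  destruct a as [x y], b as [u v]. unfold Cexp; apply C_ext; simpl;
    rewrite exp_plus, ?cos_plus, ?sin_plus; ring.
Qed.

Lemma Cexp_0 : Cexp 0 = 1%C.
Proof. unfold Cexp; apply C_ext; simpl; rewrite exp_0, ?cos_0, ?sin_0; ring. Qed.

Lemma Cmod_Cexp z : Cmod (Cexp z) = exp (Re z).
Proof.
  unfold Cexp. rewrite Cmod_mult, Cmod_R, Rabs_pos_eq by (left; apply exp_pos).
  replace (Cmod (cos (Im z), sin (Im z))) with 1; [ring|].
  unfold Cmod; simpl.
  replace (cos (Im z) * (cos (Im z) * 1) + sin (Im z) * (sin (Im z) * 1)) with 1.
  now rewrite sqrt_1.
  generalize (sin2_cos2 (Im z)). unfold Rsqr. lra.
Qed.

Lemma Cexp_neq_0 z : Cexp z <> RtoC 0.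
Proof. intros E. generalize (Cmod_Cexp z) (exp_pos (Re z)). rewrite E, Cmod_0. lra. Qed.

Lemma Cexp_opp z : Cexp (- z) = (/ Cexp z)%C.
Proof.
  generalize (Cexp_plus z (- z)). replace (z + - z)%C with (RtoC 0) by ring.
  rewrite Cexp_0. intros E. generalize (Cexp_neq_0 z); intros N.
  replace (Cexp (- z)) with (/ Cexp z * (Cexp z * Cexp (- z)))%C by (now field).
  rewrite <- E. ring.
Qed.

Lemma Cexp_R x : Cexp (RtoC x) = RtoC (exp x).
Proof. unfold Cexp; apply C_ext; simpl; rewrite ?cos_0, ?sin_0; ring. Qed.

Lemma cder_Cexp_0 D : cder D Cexp 0 1.
Proof.
  rewrite cder_eps. intros e He.
  (* The four error terms below add up to at most 6 e' |w|, hence the 9. The bound e' <= 1/2 keeps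
     exp x below 2, and |x| < e' / 2 gives |exp x - 1| <= e'. *)
  set (e' := Rmin (1/2) (e / 9)).
  assert (He' : 0 < e') by (apply Rmin_glb_lt; lra).
  assert (Hle1 : e' <= 1 / 2) by apply Rmin_l.
  assert (Hle2 : e' <= e / 9) by apply Rmin_r.
  destruct (derivable_pt_lim_eps _ _ _ (derivable_pt_lim_exp 0) e' He') as [d1 [Hd1 H1]].
  destruct (derivable_pt_lim_eps _ _ _ (derivable_pt_lim_cos 0) e' He') as [d2 [Hd2 H2]].
  destruct (derivable_pt_lim_eps _ _ _ (derivable_pt_lim_sin 0) e' He') as [d3 [Hd3 H3]].
  exists (Rmin (Rmin d1 d2) (Rmin d3 (e' / 2))).
  split; [repeat apply Rmin_glb_lt; lra|].
  intros w _ Hw. destruct w as [x y].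
  assert (Hx : Rabs x <= Cmod ((x, y) - 0)).
  { generalize (re_le_Cmod ((x, y) - 0)). simpl. now rewrite Ropp_0, Rplus_0_r. }
  assert (Hy : Rabs y <= Cmod ((x, y) - 0)).
  { generalize (im_le_Cmod ((x, y) - 0)). simpl. now rewrite Ropp_0, Rplus_0_r. }
  set (r := Cmod ((x, y) - 0)) in *.
  assert (r < d1 /\ r < d2 /\ r < d3 /\ r < e' / 2).
  { repeat split; (eapply Rlt_le_trans; [exact Hw|]).
    - eapply Rle_trans; apply Rmin_l.
    - eapply Rle_trans; [apply Rmin_l|apply Rmin_r].
    - eapply Rle_trans; [apply Rmin_r|apply Rmin_l].
    - eapply Rle_trans; apply Rmin_r. }
  specialize (H1 x). specialize (H2 y). specialize (H3 y).
  rewrite exp_0, Rplus_0_l in H1. rewrite Rplus_0_l, cos_0, sin_0 in H2, H3.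
  assert (A1 : Rabs (exp x - 1 - 1 * x) <= e' * Rabs x) by (apply H1; lra).
  assert (A2 : Rabs (cos y - 1 - - 0 * y) <= e' * Rabs y) by (apply H2; lra).
  assert (A3 : Rabs (sin y - 0 - 1 * y) <= e' * Rabs y) by (apply H3; lra).
  clear H1 H2 H3 Hw.
  replace (cos y - 1 - - 0 * y) with (cos y - 1) in A2 by ring.
  replace (sin y - 0 - 1 * y) with (sin y - y) in A3 by ring.
  replace (exp x - 1 - 1 * x) with (exp x - 1 - x) in A1 by ring.
  rewrite Cexp_0.
  eapply Rle_trans; [apply Cmod_le_abs|]. simpl.
  replace (exp x * cos y - 0 * sin y + - (1) +
    - (1 * (x + - 0) - 0 * (y + - 0))) with ((exp x - 1 - x) + exp x * (cos y - 1)) by ring.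
  replace (exp x * sin y + 0 * cos y + - 0 + - (1 * (y + - 0) + 0 * (x + - 0)))
    with (exp x * (sin y - y) + (exp x - 1) * y) by ring.
  assert (B : Rabs (exp x - 1) <= e').
  { replace (exp x - 1) with ((exp x - 1 - x) + x) by ring.
    eapply Rle_trans; [apply Rabs_triang|].
    assert (e' * Rabs x <= 1 * Rabs x) by (apply Rmult_le_compat_r; [apply Rabs_pos|lra]).
    lra. }
  assert (B' : Rabs (exp x) <= 2).
  { replace (exp x) with ((exp x - 1) + 1) by ring.
    eapply Rle_trans; [apply Rabs_triang|]. rewrite Rabs_R1. lra. }
  assert (K : e' * Rabs x <= e' * r /\ e' * Rabs y <= e' * r).
  { split; apply Rmult_le_compat_l; lra. }
  generalize (Rabs_triang (exp x - 1 - x) (exp x * (cos y - 1))).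
  generalize (Rabs_triang (exp x * (sin y - y)) ((exp x - 1) * y)).
  rewrite !Rabs_mult.
  assert (Rabs (exp x) * Rabs (cos y - 1) <= 2 * (e' * r)).
  { apply Rmult_le_compat; try apply Rabs_pos; lra. }
  assert (Rabs (exp x) * Rabs (sin y - y) <= 2 * (e' * r)).
  { apply Rmult_le_compat; try apply Rabs_pos; lra. }
  assert (Rabs (exp x - 1) * Rabs y <= e' * r).
  { apply Rmult_le_compat; try apply Rabs_pos; lra. }
  assert (e' * r <= e / 9 * r).
  { apply Rmult_le_compat_r; [apply Cmod_ge_0|lra]. }
  assert (0 <= e * r) by (apply Rmult_le_pos; [lra|apply Cmod_ge_0]).
  lra.
Qed.

(** The addition formula moves the question to the origin. *)
Lemma cder_Cexp D z : cder D Cexp z (Cexp z).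
Proof.
  apply (cder_mono everywhere); [intros; exact I|].
  apply cder_ext with (f := fun w => (Cexp z * Cexp (w - z))%C).
  - rewrite <- Cexp_plus. f_equal. ring.
  - apply filter_forall. intros w. rewrite <- Cexp_plus. f_equal. ring.
  - apply cder_unique_val with (Cexp z * (1 * (1 - 0)))%C; [ring|].
    apply cder_scal. apply (cder_comp _ everywhere (fun w => w - z)%C).
    + apply cder_minus; [apply cder_id|apply cder_const].
    + replace (z - z)%C with (RtoC 0) by ring. apply cder_Cexp_0.
    + apply filter_forall. intros; exact I.
Qed.

Lemma Cmod_Re_ratio z : z <> RtoC 0 -> -1 <= Re z / Cmod z <= 1.
Proof.
  intros N. generalize (Cmod_pos _ N) (re_le_Cmod z); intros Hp H.
  apply Rabs_le_between in H. split.
  - apply Rmult_le_reg_r with (Cmod z); auto. unfold Rdiv.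
    rewrite Rmult_assoc, Rinv_l; lra.
  - apply Rmult_le_reg_r with (Cmod z); auto. unfold Rdiv.
    rewrite Rmult_assoc, Rinv_l; lra.
Qed.

Lemma Cexp_Clog z : z <> RtoC 0 -> Cexp (Clog z) = z.
Proof.
  intros N. generalize (Cmod_pos _ N) (Cmod_Re_ratio z N); intros Hp Hr.
  assert (Hc : cos (Carg z) = Re z / Cmod z).
  { unfold Carg. destruct (Rle_dec 0 (Im z)); rewrite ?cos_neg; now apply cos_acos. }
  assert (Hs0 : sqrt (1 - (Re z / Cmod z)²) = Rabs (Im z) / Cmod z).
  { replace (1 - (Re z / Cmod z)²) with (Rsqr (Rabs (Im z) / Cmod z)).
    - apply sqrt_Rsqr. apply Rmult_le_pos; [apply Rabs_pos|].
      left; now apply Rinv_0_lt_compat.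
    - rewrite !Rsqr_div', <- Rsqr_abs. unfold Rsqr.
      generalize (Cmod_sqr z); intros E.
      replace (Im z * Im z) with (Cmod z * Cmod z - Re z * Re z) by lra.
      field. lra. }
  assert (Hs : sin (Carg z) = Im z / Cmod z).
  { unfold Carg. destruct (Rle_dec 0 (Im z)).
    - rewrite sin_acos, Hs0, Rabs_pos_eq; auto.
    - rewrite sin_neg, sin_acos, Hs0 by auto. rewrite Rabs_left by lra. field. lra. }
  unfold Cexp, Clog. cbn [Re Im fst snd].
  apply C_ext; simpl; rewrite exp_ln by auto.
  - change (fst z) with (Re z). rewrite Hc. field. lra.
  - change (snd z) with (Im z). rewrite Hc, Hs. field. lra.
Qed.

(** Monotonicity of the cosine is used instead of a derivative because the end points -1 and 1 must
    be included: they are the values of Re z / |z| on the real axis. *)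
Lemma acos_cont u0 : -1 <= u0 <= 1 -> forall e, 0 < e -> exists d, 0 < d /\
  forall u, -1 <= u <= 1 -> Rabs (u - u0) < d -> Rabs (acos u - acos u0) < e.
Proof.
  intros H0 e He. set (a0 := acos u0).
  assert (Ha0 : 0 <= a0 <= PI) by apply acos_bound.
  assert (Hc0 : cos a0 = u0) by now apply cos_acos.
  assert (U : exists d, 0 < d /\ forall u, -1 <= u <= 1 -> Rabs (u - u0) < d -> acos u < a0 + e).
  { destruct (Rlt_dec PI (a0 + e)) as [L|L].
    - exists 1; split; [lra|]. intros u _ _. generalize (acos_bound u). lra.
    - exists (u0 - cos (a0 + e)). split.
      + rewrite <- Hc0. generalize (cos_decreasing_1 a0 (a0 + e)). lra.
      + intros u Hu H. apply Rnot_le_lt. intros L'.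
        assert (u <= cos (a0 + e)).
        { rewrite <- (cos_acos u Hu). generalize (acos_bound u). intros B.
          destruct L' as [L'|<-]; [|lra]. left. apply cos_decreasing_1; lra. }
        apply Rabs_def2 in H. lra. }
  assert (V : exists d, 0 < d /\ forall u, -1 <= u <= 1 -> Rabs (u - u0) < d -> a0 - e < acos u).
  { destruct (Rlt_dec (a0 - e) 0) as [L|L].
    - exists 1; split; [lra|]. intros u _ _. generalize (acos_bound u). lra.
    - exists (cos (a0 - e) - u0). split.
      + rewrite <- Hc0. generalize (cos_decreasing_1 (a0 - e) a0). lra.
      + intros u Hu H. apply Rnot_le_lt. intros L'.
        assert (cos (a0 - e) <= u).
        { rewrite <- (cos_acos u Hu). generalize (acos_bound u). intros B.
          destruct L' as [L'|<-]; [|lra]. left. apply cos_decreasing_1; lra. }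
        apply Rabs_def2 in H. lra. }
  destruct U as [d1 [Hd1 U]], V as [d2 [Hd2 V]].
  exists (Rmin d1 d2). split; [now apply Rmin_glb_lt|].
  intros u Hu H.
  assert (Rabs (u - u0) < d1) by (eapply Rlt_le_trans; [exact H|apply Rmin_l]).
  assert (Rabs (u - u0) < d2) by (eapply Rlt_le_trans; [exact H|apply Rmin_r]).
  generalize (U u Hu H1) (V u Hu H2). intros. apply Rabs_def1; lra.
Qed.

Lemma clim_RtoC_comp {T} (F : (T -> Prop) -> Prop) {FF : Filter F} (f : T -> R) (g : R -> R) a
  (P : R -> Prop) :
  clim F (fun w => RtoC (f w)) (RtoC a) -> F (fun w => P (f w)) ->
  (forall e, 0 < e -> exists d, 0 < d /\ forall u, P u -> Rabs (u - a) < d -> Rabs (g u - g a) < e) ->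
  clim F (fun w => RtoC (g (f w))) (RtoC (g a)).
Proof.
  intros Hf HP Hg e He. destruct (Hg e He) as [d [Hd H]].
  generalize (filter_and _ _ HP (Hf d Hd)). apply filter_imp. intros x [H1 H2].
  rewrite <- RtoC_minus, Cmod_R in H2 |- *. now apply H.
Qed.

Lemma ln_cont_eps a : 0 < a ->
  forall e, 0 < e -> exists d, 0 < d /\ forall u, True -> Rabs (u - a) < d -> Rabs (ln u - ln a) < e.
Proof.
  intros Ha e He.
  assert (C : continuity_pt ln a).
  { apply derivable_continuous_pt. exists (/ a). now apply derivable_pt_lim_ln. }
  rewrite continuity_pt_locally in C. destruct (C (mkposreal e He)) as [d H].
  exists d; split; [apply cond_pos|]. intros u _ Hu. apply H. exact Hu.
Qed.

Lemma clim_Re {T} (F : (T -> Prop) -> Prop) {FF : Filter F} f a :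
  clim F f a -> clim F (fun w => RtoC (Re (f w))) (RtoC (Re a)).
Proof.
  intros H e He. generalize (H e He). apply filter_imp. intros x Hx.
  rewrite <- RtoC_minus, Cmod_R.
  eapply Rle_lt_trans; [|exact Hx]. generalize (re_le_Cmod (f x - a)).
  destruct (f x), a; simpl; auto.
Qed.

Lemma clim_Im {T} (F : (T -> Prop) -> Prop) {FF : Filter F} f a :
  clim F f a -> clim F (fun w => RtoC (Im (f w))) (RtoC (Im a)).
Proof.
  intros H e He. generalize (H e He). apply filter_imp. intros x Hx.
  rewrite <- RtoC_minus, Cmod_R.
  eapply Rle_lt_trans; [|exact Hx]. generalize (im_le_Cmod (f x - a)).
  destruct (f x), a; simpl; auto.
Qed.

Lemma Clog_eq z : Clog z = (RtoC (ln (Cmod z)) + Ci * RtoC (Carg z))%C.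
Proof. unfold Clog. apply C_ext; simpl; ring. Qed.

(** On the closed upper half-plane [Carg] is an arc cosine without case distinction, so the negative
    axis, approached from above only, causes no jump. *)
Lemma clim_Clog z : closed_UHP z -> z <> RtoC 0 -> clim (nb closed_UHP z) Clog (Clog z).
Proof.
  intros Hz N. rewrite Clog_eq.
  apply (clim_ext (fun w => RtoC (ln (Cmod w)) + Ci * RtoC (Carg w))%C).
  { apply filter_forall. intros w. now rewrite Clog_eq. }
  generalize (clim_id closed_UHP z); intros Ci0.
  generalize (clim_Cmod _ _ Ci0) (clim_Re _ _ _ Ci0) (clim_neq_0 _ _ N Ci0). intros Cm Cr Cn.
  apply clim_plus; [|apply clim_mult; [apply clim_const|]].
  - apply (clim_RtoC_comp _ Cmod ln (Cmod z) (fun _ => True)); auto.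
    + now apply filter_forall.
    + apply ln_cont_eps. now apply Cmod_pos.
  - replace (RtoC (Carg z)) with (RtoC (acos (Re z / Cmod z))).
    2: { unfold Carg. destruct (Rle_dec 0 (Im z)); [reflexivity|contradiction]. }
    apply (clim_ext (fun w => RtoC (acos (Re w / Cmod w)))).
    { apply filter_imp with (P := closed_UHP); [|apply nb_domain].
      intros w Hw. unfold Carg. destruct (Rle_dec 0 (Im w)); [reflexivity|contradiction]. }
    apply (clim_RtoC_comp _ (fun w => Re w / Cmod w) acos _ (fun u => -1 <= u <= 1)).
    + generalize (Cmod_pos _ N). intros Hp.
      apply (clim_ext (fun w => RtoC (Re w) / RtoC (Cmod w))%C).
      { revert Cn. apply filter_imp. intros w Hw. rewrite RtoC_div; [reflexivity|].
        apply Rgt_not_eq, Rlt_gt, Cmod_pos, Hw. }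
      rewrite RtoC_div by lra. apply clim_div; auto.
      intros E. apply RtoC_inj in E. lra.
    + revert Cn. apply filter_imp. intros w Hw. now apply Cmod_Re_ratio.
    + apply acos_cont. now apply Cmod_Re_ratio.
Qed.

(** A continuous right inverse of the exponential: if [q] is the slope of [Cexp] at [Clog z], then 1
    / q(Clog w) is the slope of [Clog] at [z]. *)
Lemma cder_Clog z : closed_UHP z -> z <> RtoC 0 -> cder closed_UHP Clog z (/ z).
Proof.
  intros Hz N.
  generalize (clim_Clog z Hz N) (clim_id closed_UHP z); intros CL Ci0.
  generalize (clim_neq_0 _ _ N Ci0); intros Cn.
  destruct (cder_Cexp everywhere (Clog z)) as [q [[d [Hd H1]] H2]].
  rewrite Cexp_Clog in H1, H2 by auto.
  assert (Hq : clim (nb closed_UHP z) (fun w => q (Clog w)) z).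
  { apply (clim_comp _ Clog q everywhere (Clog z)); auto. apply filter_forall; intros; exact I. }
  exists (fun w => / q (Clog w))%C. split; [|now apply clim_inv].
  generalize (filter_and _ _ Cn (filter_and _ _ (CL d Hd) (clim_neq_0 _ _ N Hq))).
  apply filter_imp. intros w [Hw [Hd' Hqw]].
  generalize (H1 (Clog w) I Hd'). rewrite Cexp_Clog by auto. intros E.
  rewrite E at 3. field. exact Hqw.
Qed.

Lemma Cpower_0 a : Cpower 0 a = 0%C.
Proof. unfold Cpower. destruct (Ceq_dec 0 0); congruence. Qed.

Lemma Cpower_exp z a : z <> RtoC 0 -> Cpower z a = Cexp (a * Clog z).
Proof. intros N. unfold Cpower. destruct (Ceq_dec z 0); congruence. Qed.

Lemma Cpower_neq_0 z a : z <> RtoC 0 -> Cpower z a <> RtoC 0.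
Proof. intros N. rewrite Cpower_exp by auto. apply Cexp_neq_0. Qed.

Lemma Cpower_low_neq_0 z a : z <> RtoC 0 -> Cpower_low z a <> RtoC 0.
Proof. intros N. now apply Cconj_neq_0, Cpower_neq_0, Cconj_neq_0. Qed.

Lemma Cmod_Cpower z (a : R) : z <> RtoC 0 -> Cmod (Cpower z a) = Rpower (Cmod z) a.
Proof.
  intros N. rewrite Cpower_exp, Cmod_Cexp by auto. unfold Rpower. f_equal.
  unfold Clog; simpl. ring.
Qed.

Lemma cder_Cpower z (a : R) : closed_UHP z -> z <> RtoC 0 ->
  cder closed_UHP (fun w => Cpower w a) z (a * Cpower z a / z).
Proof.
  intros Hz N.
  apply cder_ext with (f := fun w => Cexp (a * Clog w)).
  - now rewrite Cpower_exp.
  - generalize (clim_neq_0 _ _ N (clim_id closed_UHP z)). apply filter_imp.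
    intros w Hw. now rewrite Cpower_exp.
  - apply cder_unique_val with (Cexp (a * Clog z) * (a * / z))%C.
    { rewrite Cpower_exp by auto. field. exact N. }
    apply (cder_comp _ everywhere (fun w => a * Clog w)%C).
    + apply cder_scal. now apply cder_Clog.
    + apply cder_Cexp.
    + apply filter_forall; intros; exact I.
Qed.

Lemma Rpower_small (a e : R) : 0 < a -> 0 < e -> exists d, 0 < d /\
  forall x, 0 < x < d -> Rpower x a < e.
Proof.
  intros Ha He. exists (Rpower e (/ a)). split; [apply exp_pos|].
  intros x [Hx0 Hx].
  replace e with (Rpower (Rpower e (/ a)) a).
  - apply Rlt_Rpower_l; lra.
  - rewrite Rpower_mult, Rinv_l by lra. now apply Rpower_1.
Qed.

(** At 0 the modulus |w|^a tends to 0 because a > 0; elsewhere the power is differentiable. *)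
Lemma clim_Cpower z (a : R) : 0 < a -> closed_UHP z ->
  clim (nb closed_UHP z) (fun w => Cpower w a) (Cpower z a).
Proof.
  intros Ha Hz. destruct (Ceq_dec z 0) as [->|N].
  - rewrite Cpower_0. intros e He. destruct (Rpower_small a e Ha He) as [d [Hd H]].
    exists d. split; auto. intros w _ Hw.
    replace (Cpower w a - 0)%C with (Cpower w a) by ring.
    replace (w - 0)%C with w in Hw by ring.
    destruct (Ceq_dec w 0) as [->|N]; [rewrite Cpower_0, Cmod_0; lra|].
    rewrite Cmod_Cpower by auto. apply H. split; auto. now apply Cmod_pos.
  - apply (cder_cont _ (fun w => Cpower w a) _ _ (cder_Cpower z a Hz N)).
Qed.

(** Reflection in the real axis; it transports the results on powers from the closed upper to the
    closed lower half-plane. *)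
Lemma cder_conj (D : C -> Prop) f z l :
  cder D f z l ->
  cder (fun w => D (Cconj w)) (fun w => Cconj (f (Cconj w))) (Cconj z) (Cconj l).
Proof.
  rewrite !cder_eps. intros H e He. destruct (H e He) as [d [Hd H']].
  exists d; split; auto. intros w Dw Hw.
  specialize (H' (Cconj w) Dw).
  rewrite <- Cmod_conj in Hw. rewrite Cminus_conj, Cconj_conj in Hw.
  specialize (H' Hw).
  rewrite <- (Cmod_conj (w - Cconj z)), <- (Cmod_conj (_ - _ - _)).
  rewrite !Cminus_conj, !Cmult_conj, !Cminus_conj, !Cconj_conj. exact H'.
Qed.

Definition closed_LHP (z : C) : Prop := Im z <= 0.

Lemma closed_LHP_conj z : closed_LHP z -> closed_UHP (Cconj z).
Proof. unfold closed_LHP, closed_UHP. destruct z; simpl; lra. Qed.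

Lemma clim_Cpower_low z (a : R) : 0 < a -> closed_LHP z ->
  clim (nb closed_LHP z) (fun w => Cpower_low w a) (Cpower_low z a).
Proof.
  intros Ha Hz. unfold Cpower_low. rewrite Cconj_RtoC. apply clim_conj.
  apply (clim_comp _ Cconj (fun w => Cpower w a) closed_UHP (Cconj z)).
  - apply clim_conj, clim_id.
  - generalize (nb_domain closed_LHP z). apply filter_imp. apply closed_LHP_conj.
  - apply clim_Cpower; auto. now apply closed_LHP_conj.
Qed.

Lemma cder_Cpower_low z (a : R) : closed_LHP z -> z <> RtoC 0 ->
  cder closed_LHP (fun w => Cpower_low w a) z (a * Cpower_low z a / z).
Proof.
  intros Hz N.
  assert (N' := Cconj_neq_0 _ N).
  generalize (cder_conj _ _ _ _ (cder_Cpower (Cconj z) a (closed_LHP_conj _ Hz) N')).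
  rewrite Cconj_conj. intros H.
  apply (cder_mono _ closed_LHP) in H; [|apply closed_LHP_conj].
  unfold Cpower_low. rewrite Cconj_RtoC.
  replace (a * Cconj (Cpower (Cconj z) a) / z)%C
    with (Cconj (a * Cpower (Cconj z) a / Cconj z)); auto.
  rewrite Cdiv_conj, Cmult_conj, Cconj_conj, Cconj_RtoC; auto.
Qed.

Lemma Cmod_Cpower_low z (a : R) : z <> RtoC 0 -> Cmod (Cpower_low z a) = Rpower (Cmod z) a.
Proof.
  intros N. unfold Cpower_low. rewrite Cmod_conj, Cconj_RtoC, Cmod_Cpower, Cmod_conj; auto.
  now apply Cconj_neq_0.
Qed.

(** * Compactness, mean value inequality and primitives *)

(** A Lebesgue number argument: a statement that survives shrinking of [d] and holds locally with
    some [d] holds on the whole interval with one [d]. *)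
Lemma gauge_interval (Q : R -> R -> Prop) (a b : R) :
  (forall s d d', 0 < d' <= d -> Q s d -> Q s d') ->
  (forall s, a <= s <= b -> exists d, 0 < d /\ forall s', a <= s' <= b -> Rabs (s' - s) < d -> Q s' d) ->
  exists d, 0 < d /\ forall s, a <= s <= b -> Q s d.
Proof.
  intros Hm H.
  assert (X : forall s, {d : posreal | a <= s <= b ->
    forall s', a <= s' <= b -> Rabs (s' - s) < d -> Q s' d}).
  { intros s. apply constructive_indefinite_description.
    destruct (classic (a <= s <= b)) as [L|L].
    - destruct (H s L) as [d [Hd H']]. exists (mkposreal d Hd). now intros _.
    - exists (mkposreal 1 Rlt_0_1). tauto. }
  destruct (compactness_value_1d a b (fun s => proj1_sig (X s))) as [d Hd].
  exists d; split; [apply cond_pos|]. intros s Hs. apply NNPP; intros N.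
  apply (Hd s Hs). intros [u [Hu [H1 H2]]]. apply N.
  apply (Hm _ (proj1_sig (X u))); [split; [apply cond_pos|exact H2]|].
  apply (proj2_sig (X u)); auto.
Qed.

(** The centres [p] run over the whole closed box, the conclusion only over points of [D]. Boundary
    points of [D] thus enter the covering without belonging to [D]. *)
Lemma gauge_box (Q : C -> R -> Prop) (D : C -> Prop) (a b a' b' : R) :
  (forall z d d', 0 < d' <= d -> Q z d -> Q z d') ->
  (forall p : C, a <= Re p <= b -> a' <= Im p <= b' ->
    exists d, 0 < d /\ forall z, D z -> Cmod (z - p) < d -> Q z d) ->
  exists d, 0 < d /\ forall z : C, a <= Re z <= b -> a' <= Im z <= b' -> D z -> Q z d.
Proof.
  intros Hm H.
  (* The factor 2 is there because a square of half-side d lies in the disc of radius 2 d. *)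
  assert (X : forall p : C, {d : posreal | a <= Re p <= b -> a' <= Im p <= b' ->
    forall z, D z -> Cmod (z - p) < 2 * d -> Q z d}).
  { intros p. apply constructive_indefinite_description.
    destruct (classic (a <= Re p <= b /\ a' <= Im p <= b')) as [[L1 L2]|L].
    - destruct (H p L1 L2) as [d [Hd H']].
      assert (Hd2 : 0 < d / 2) by lra.
      exists (mkposreal (d / 2) Hd2). simpl. intros _ _ z Dz Hz.
      apply (Hm _ d); [lra|]. apply H'; auto. lra.
    - exists (mkposreal 1 Rlt_0_1). tauto. }
  destruct (compactness_value_2d a b a' b' (fun x y => proj1_sig (X (x, y)))) as [d Hd].
  exists d; split; [apply cond_pos|]. intros z H1 H2 Dz. apply NNPP; intros N.
  apply (Hd (Re z) (Im z) H1 H2). intros [u [v [Hu [Hv [E1 [E2 E3]]]]]]. apply N.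
  set (e := proj1_sig (X (u, v))) in *.
  apply (Hm _ e); [split; [apply cond_pos|exact E3]|].
  apply (proj2_sig (X (u, v))); auto. fold e.
  eapply Rle_lt_trans; [apply Cmod_le_abs|]. destruct z as [x y]; simpl in *.
  unfold Rminus in *. lra.
Qed.

Lemma cder_real (f : C -> C) (s : R) l : cder everywhere f s l ->
  is_derive (fun t : R => Re (f t)) s (Re l).
Proof.
  intros H. apply is_derive_Reals. intros e He.
  rewrite cder_eps in H. assert (He2 : 0 < e / 2) by lra.
  destruct (H _ He2) as [d [Hd H']]. exists (mkposreal d Hd). simpl.
  intros h N Hh.
  assert (E : (RtoC (s + h) - s)%C = RtoC h) by (rewrite RtoC_plus; ring).
  specialize (H' (RtoC (s + h)) I). rewrite E, Cmod_R in H'. specialize (H' Hh).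
  generalize (re_le_Cmod (f (s + h)%R - f s - l * h)); intros L.
  replace (Re (f (s + h)%R - f s - l * h)) with
    ((((Re (f (s + h)%R) - Re (f s)) / h) - Re l) * h) in L.
  - rewrite Rabs_mult in L. generalize (Rabs_pos_lt h N). intros P.
    apply Rle_lt_trans with (e / 2); [|lra]. apply Rmult_le_reg_r with (Rabs h); auto. lra.
  - destruct (f (s + h)%R), (f s), l. simpl. field. exact N.
Qed.

Lemma cder_line (f : C -> C) (a v : C) (s : R) l :
  cder everywhere f (a + s * v) l ->
  cder everywhere (fun w => f (a + w * v))%C s (l * v).
Proof.
  intros H. apply (cder_comp _ everywhere (fun w => a + w * v)%C); auto.
  - apply cder_unique_val with (0 + (1 * v + s * 0))%C; [ring|].
    apply cder_plus; [apply cder_const|].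
    apply (cder_mult everywhere (fun w => w) (fun _ => v)); [apply cder_id|apply cder_const].
  - apply filter_forall; intros; exact I.
Qed.

(** The real mean value theorem is applied to Re (conj D (F(z) - c z)) along the segment, where D is
    the deviation to be bounded: the increment of this function is exactly |D|^2. *)
Lemma mean_value_ineq (F G : C -> C) (a b c : C) (M : R) :
  (forall s : R, 0 <= s <= 1 -> cder everywhere F (a + s * (b - a)) (G (a + s * (b - a))%C)) ->
  (forall s : R, 0 <= s <= 1 -> Cmod (G (a + s * (b - a))%C - c) <= M) ->
  Cmod (F b - F a - c * (b - a)) <= M * Cmod (b - a).
Proof.
  intros HF HM. set (D := (F b - F a - c * (b - a))%C).
  set (f := fun w : C => (Cconj D * (F (a + w * (b - a)) - c * (a + w * (b - a))))%C).
  assert (Hf : forall s : R, 0 <= s <= 1 ->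
    cder everywhere f s (Cconj D * (G (a + s * (b - a)) * (b - a) - c * (b - a)))%C).
  { intros s Hs. unfold f. apply cder_scal. apply cder_minus.
    - now apply cder_line, HF.
    - apply cder_scal. apply cder_unique_val with (1 * (b - a))%C; [ring|].
      apply (cder_line (fun w => w)), cder_id. }
  destruct (MVT_gen (fun t : R => Re (f t)) 0 1
    (fun s => Re (Cconj D * (G (a + s * (b - a)) * (b - a) - c * (b - a)))%C)) as [s [Hs E]].
  - rewrite Rmin_left, Rmax_right by lra. intros x Hx. apply cder_real, Hf. lra.
  - rewrite Rmin_left, Rmax_right by lra. intros x Hx.
    apply derivable_continuous_pt. exists (Re (Cconj D * (G (a + x * (b - a)) * (b - a) - c * (b - a)))%C).
    apply is_derive_Reals, cder_real, Hf. lra.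
  - rewrite Rmin_left, Rmax_right in Hs by lra.
    assert (E1 : Re (f (RtoC 1)) - Re (f (RtoC 0)) = Cmod D * Cmod D).
    { transitivity (Re (Cconj D * D)%C).
      - unfold f. transitivity (Re (Cconj D * (F (a + RtoC 1 * (b - a)) - c * (a + RtoC 1 * (b - a))) -
          Cconj D * (F (a + RtoC 0 * (b - a)) - c * (a + RtoC 0 * (b - a))))%C); [reflexivity|].
        replace (a + 1 * (b - a))%C with b by ring. replace (a + 0 * (b - a))%C with a by ring.
        f_equal. transitivity (Cconj D * (F b - F a - c * (b - a)))%C; [ring|reflexivity].
      - rewrite Cmod_sqr. destruct D; simpl; ring. }
    rewrite E1 in E.
    assert (L : Cmod D * Cmod D <= Cmod D * (M * Cmod (b - a))).
    { rewrite E. rewrite Rminus_0_r, Rmult_1_r.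
      eapply Rle_trans; [apply Rle_abs|]. eapply Rle_trans; [apply re_le_Cmod|].
      rewrite Cmod_mult, Cmod_conj. apply Rmult_le_compat_l; [apply Cmod_ge_0|].
      replace (G (a + s * (b - a)) * (b - a) - c * (b - a))%C
        with ((G (a + s * (b - a)) - c) * (b - a))%C by ring.
      rewrite Cmod_mult. apply Rmult_le_compat_r; [apply Cmod_ge_0|]. now apply HM. }
    destruct (Rle_lt_or_eq_dec 0 (Cmod D) (Cmod_ge_0 D)) as [P|P].
    + now apply Rmult_le_reg_l with (Cmod D).
    + rewrite <- P. apply Rmult_le_pos; [|apply Cmod_ge_0].
      eapply Rle_trans; [apply Cmod_ge_0|]. apply (HM 0). lra.
Qed.

(** * Derivatives and integrals of complex functions on a closed interval *)

Definition rder (a b : R) (f : R -> C) (s : R) (l : C) : Prop :=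
  forall e, 0 < e -> exists d, 0 < d /\ forall s', a <= s' <= b -> Rabs (s' - s) < d ->
    Cmod (f s' - f s - l * RtoC (s' - s)) <= e * Rabs (s' - s).

Definition rnb (a b s : R) (P : R -> Prop) : Prop :=
  exists d, 0 < d /\ forall s', a <= s' <= b -> Rabs (s' - s) < d -> P s'.

Global Instance rnb_filter a b s : Filter (rnb a b s).
Proof.
  split.
  - exists 1. split; [lra|auto].
  - intros P Q [d [Hd HP]] [e [He HQ]].
    exists (Rmin d e). split; [now apply Rmin_glb_lt|].
    intros w Hw Hm. split.
    + apply HP; auto. eapply Rlt_le_trans; [exact Hm|apply Rmin_l].
    + apply HQ; auto. eapply Rlt_le_trans; [exact Hm|apply Rmin_r].
  - intros P Q H [d [Hd HP]]. exists d; split; auto.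
Qed.

Definition clamp (a b s : R) : R := Rmax a (Rmin b s).

Lemma clamp_in a b s : a <= b -> a <= clamp a b s <= b.
Proof. intros. unfold clamp, Rmax, Rmin. repeat destruct Rle_dec; lra. Qed.

Lemma clamp_id a b s : a <= s <= b -> clamp a b s = s.
Proof. intros. unfold clamp, Rmax, Rmin. repeat destruct Rle_dec; lra. Qed.

Lemma clamp_lip a b s s' : Rabs (clamp a b s' - clamp a b s) <= Rabs (s' - s).
Proof.
  unfold clamp, Rmax, Rmin. repeat destruct Rle_dec; unfold Rabs; repeat destruct Rcase_abs; lra.
Qed.

Lemma clim_continuous (f : R -> C) (s : R) :
  (forall e, 0 < e -> exists d, 0 < d /\ forall s', Rabs (s' - s) < d -> Cmod (f s' - f s) < e) ->
  continuous (U := C_UniformSpace) f s.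
Proof.
  intros H P HP. apply locally_nb in HP. destruct HP as [e [He HP]].
  destruct (H e He) as [d [Hd H']]. exists (mkposreal d Hd). intros s' Hs'.
  apply HP; [exact I|]. apply H', Hs'.
Qed.

Lemma continuous_clim (f : R -> C) (s : R) :
  continuous (U := C_UniformSpace) f s ->
  forall e, 0 < e -> exists d, 0 < d /\ forall s', Rabs (s' - s) < d -> Cmod (f s' - f s) < e.
Proof.
  intros H e He.
  destruct (H (fun w => Cmod (w - f s) < e)) as [d Hd].
  { apply locally_nb. exists e; auto. }
  exists d; split; [apply cond_pos|]. intros s' Hs'. apply Hd, Hs'.
Qed.

Lemma norm_minus_scal (x y l : C) (r : R) :
  norm (V := C_R_NormedModule) (minus (minus x y) (scal (V := C_R_NormedModule) r l)) =
  Cmod (x - y - l * RtoC r).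
Proof.
  rewrite Cmod_norm. destruct x, y, l. f_equal. apply C_ext; simpl.
  - unfold minus, plus, opp, scal; simpl. unfold mult; simpl. ring.
  - unfold minus, plus, opp, scal; simpl. unfold mult; simpl. ring.
Qed.

Lemma is_derive_path (f : R -> C) (s : R) (l : C) :
  (forall e, 0 < e -> exists d, 0 < d /\ forall s', Rabs (s' - s) < d ->
    Cmod (f s' - f s - l * RtoC (s' - s)) <= e * Rabs (s' - s)) ->
  is_derive (V := C_R_NormedModule) f s l.
Proof.
  intros H. split; [apply is_linear_scal_l|].
  intros x Hx. apply (is_filter_lim_locally_unique (K := R_AbsRing) (V := R_NormedModule)) in Hx.
  subst x. intros eps. destruct (H eps (cond_pos eps)) as [d [Hd H']].
  exists (mkposreal d Hd). intros s' Hs'. specialize (H' s' Hs').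
  eapply Rle_trans; [right; apply norm_minus_scal|exact H'].
Qed.

Lemma is_derive_path_eps (f : R -> C) (s : R) (l : C) :
  is_derive (V := C_R_NormedModule) f s l ->
  forall e, 0 < e -> exists d, 0 < d /\ forall s', Rabs (s' - s) < d ->
    Cmod (f s' - f s - l * RtoC (s' - s)) <= e * Rabs (s' - s).
Proof.
  intros [_ H] e He.
  destruct (H s (fun P HP => HP) (mkposreal e He)) as [d Hd].
  exists d; split; [apply cond_pos|]. intros s' Hs'. specialize (Hd s' Hs').
  eapply Rle_trans; [right; symmetry; apply norm_minus_scal|exact Hd].
Qed.

(** The function is known on [a, b] only, with one-sided derivatives at the ends. Continued beyond
    the ends by its tangent lines it is continuously differentiable on both sides, and the
    fundamental theorem applies. *)
Lemma is_RInt_rder (f df : R -> C) (a b : R) : a <= b ->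
  (forall s, a <= s <= b -> rder a b f s (df s)) ->
  (forall s, a <= s <= b -> clim (rnb a b s) df (df s)) ->
  is_RInt (V := C_R_NormedModule) df a b (f b - f a)%C.
Proof.
  intros Hab Hd Hc.
  set (F := fun s : R => (f (clamp a b s) + df (clamp a b s) * RtoC (s - clamp a b s))%C).
  assert (EF : forall s, a <= s <= b -> F s = f s).
  { intros s Hs. unfold F. rewrite clamp_id, Rminus_diag by auto. ring. }
  apply (is_RInt_ext (fun s => df (clamp a b s))).
  { rewrite Rmin_left, Rmax_right by auto. intros x Hx. rewrite clamp_id; auto. lra. }
  rewrite <- (EF a), <- (EF b) by lra.
  apply (is_RInt_derive (V := C_R_CompleteNormedModule) F).
  - rewrite Rmin_left, Rmax_right by auto. intros s Hs. rewrite clamp_id by auto.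
    apply is_derive_path. intros e He. destruct (Hd s Hs e He) as [d [Hd0 Hd1]].
    set (d' := Rmin d (Rmin (if Req_EM_T a s then 1 else s - a) (if Req_EM_T s b then 1 else b - s))).
    assert (B1 : d' <= d) by apply Rmin_l.
    assert (B2 : d' <= if Req_EM_T a s then 1 else s - a).
    { unfold d'. eapply Rle_trans; [apply Rmin_r|apply Rmin_l]. }
    assert (B3 : d' <= if Req_EM_T s b then 1 else b - s).
    { unfold d'. eapply Rle_trans; [apply Rmin_r|apply Rmin_r]. }
    exists d'. split.
    { unfold d'. repeat apply Rmin_glb_lt; auto.
      destruct (Req_EM_T a s); lra. destruct (Req_EM_T s b); lra. }
    intros s' Hs'. rewrite (EF s) by auto.
    destruct (Rlt_dec s' a) as [L|L].
    { destruct (Req_EM_T a s) as [<-|N].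
      2: { apply Rabs_def2 in Hs'. lra. }
      unfold F. replace (clamp a b s') with a.
      2: { unfold clamp, Rmax, Rmin. repeat destruct Rle_dec; lra. }
      replace (f a + df a * RtoC (s' - a) - f a - df a * RtoC (s' - a))%C with (RtoC 0) by ring.
      rewrite Cmod_0. apply Rmult_le_pos; [lra|apply Rabs_pos]. }
    destruct (Rlt_dec b s') as [L'|L'].
    { destruct (Req_EM_T s b) as [->|N].
      2: { apply Rabs_def2 in Hs'. lra. }
      unfold F. replace (clamp a b s') with b.
      2: { unfold clamp, Rmax, Rmin. repeat destruct Rle_dec; lra. }
      replace (f b + df b * RtoC (s' - b) - f b - df b * RtoC (s' - b))%C with (RtoC 0) by ring.
      rewrite Cmod_0. apply Rmult_le_pos; [lra|apply Rabs_pos]. }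
    rewrite (EF s') by lra. apply Hd1; lra.
  - intros s _. apply clim_continuous. intros e He.
    destruct (Hc (clamp a b s) (clamp_in a b s Hab) e He) as [d [Hd0 Hd1]].
    exists d; split; auto. intros s' Hs'. apply Hd1.
    + now apply clamp_in.
    + eapply Rle_lt_trans; [apply clamp_lip|exact Hs'].
Qed.

Lemma clim_rnb_RtoC a b s : clim (rnb a b s) (fun s' => RtoC s') (RtoC s).
Proof.
  intros e He. exists e. split; auto. intros s' _ H. now rewrite <- RtoC_minus, Cmod_R.
Qed.

Lemma rder_comp D (f : C -> C) (p : R -> C) a b (s : R) l v :
  (forall s' : R, a <= s' <= b -> D (p s')) ->
  rder a b p s v -> cder D f (p s) l -> rder a b (fun s => f (p s)) s (l * v).
Proof.
  intros HD Hp H e He. rewrite cder_eps in H.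
  set (m := Cmod v + 1). assert (Hm : 0 < m) by (unfold m; generalize (Cmod_ge_0 v); lra).
  set (n := Cmod l + 1). assert (Hn : 0 < n) by (unfold n; generalize (Cmod_ge_0 l); lra).
  set (e1 := e / 2 / m). set (e2 := Rmin 1 (e / 2 / n)).
  assert (He1 : 0 < e1) by (repeat apply Rdiv_lt_0_compat; lra).
  assert (He2 : 0 < e2) by (apply Rmin_glb_lt; [lra|repeat apply Rdiv_lt_0_compat; lra]).
  destruct (H _ He1) as [d [Hd H']], (Hp _ He2) as [d' [Hd' Hp']].
  exists (Rmin d' (d / m)).
  split; [apply Rmin_glb_lt; auto; apply Rdiv_lt_0_compat; lra|]. intros s' Hs' Hlt.
  assert (L1 : Rabs (s' - s) < d') by (eapply Rlt_le_trans; [exact Hlt|apply Rmin_l]).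
  assert (L2 : Rabs (s' - s) < d / m) by (eapply Rlt_le_trans; [exact Hlt|apply Rmin_r]).
  specialize (Hp' s' Hs' L1).
  assert (P : Cmod (p s' - p s) <= m * Rabs (s' - s)).
  { replace (p s' - p s)%C with ((p s' - p s - v * RtoC (s' - s)) + v * RtoC (s' - s))%C by ring.
    eapply Rle_trans; [apply Cmod_triangle|]. rewrite Cmod_mult, Cmod_R.
    assert (e2 * Rabs (s' - s) <= 1 * Rabs (s' - s)).
    { apply Rmult_le_compat_r; [apply Rabs_pos|apply Rmin_l]. }
    unfold m. lra. }
  assert (Q : Cmod (p s' - p s) < d).
  { eapply Rle_lt_trans; [exact P|]. replace d with (m * (d / m)) by (field; lra).
    now apply Rmult_lt_compat_l. }
  specialize (H' (p s') (HD s' Hs') Q).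
  replace (f (p s') - f (p s) - l * v * RtoC (s' - s))%C with
    ((f (p s') - f (p s) - l * (p s' - p s)) + l * (p s' - p s - v * RtoC (s' - s)))%C by ring.
  eapply Rle_trans; [apply Cmod_triangle|]. rewrite Cmod_mult.
  assert (A : e1 * Cmod (p s' - p s) <= e / 2 * Rabs (s' - s)).
  { apply Rle_trans with (e1 * (m * Rabs (s' - s))); [apply Rmult_le_compat_l; lra|].
    right. unfold e1. field. lra. }
  assert (B : Cmod l * Cmod (p s' - p s - v * RtoC (s' - s)) <= e / 2 * Rabs (s' - s)).
  { apply Rle_trans with (n * (e / 2 / n * Rabs (s' - s))).
    - apply Rmult_le_compat; try apply Cmod_ge_0; [unfold n; lra|].
      eapply Rle_trans; [exact Hp'|]. apply Rmult_le_compat_r; [apply Rabs_pos|apply Rmin_r].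
    - right. field. lra. }
  lra.
Qed.

Lemma is_RInt_line D (f g : C -> C) (p v : C) a b : a <= b ->
  (forall s : R, a <= s <= b -> D (p + s * v)%C) ->
  (forall s : R, a <= s <= b -> cder D f (p + s * v) (g (p + s * v)%C)) ->
  (forall s : R, a <= s <= b -> clim (nb D (p + s * v)%C) g (g (p + s * v)%C)) ->
  is_RInt (V := C_R_NormedModule) (fun s => g (p + s * v) * v)%C a b
    (f (p + b * v) - f (p + a * v))%C.
Proof.
  intros Hab HD Hf Hg.
  apply (is_RInt_rder (fun s => f (p + s * v)%C)); auto.
  - intros s Hs. apply (rder_comp D f (fun s => p + s * v)%C); auto.
    intros e He. exists 1. split; [lra|]. intros s' _ _.
    replace (p + s' * v - (p + s * v) - v * RtoC (s' - s))%C with (RtoC 0)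
      by (rewrite RtoC_minus; ring).
    rewrite Cmod_0. apply Rmult_le_pos; [lra|apply Rabs_pos].
  - intros s Hs. apply clim_mult; [|apply clim_const].
    apply (clim_comp _ (fun s' : R => p + s' * v)%C g D (p + s * v)%C); auto.
    + apply clim_plus; [apply clim_const|]. apply clim_mult; [apply clim_rnb_RtoC|apply clim_const].
    + exists 1; split; [lra|]. intros; auto.
Qed.

(** The integral is linear over the reals; a complex factor is handled through real and imaginary
    parts. *)
Lemma is_RInt_Cscal (f : R -> C) a b l k :
  is_RInt (V := C_R_NormedModule) f a b l ->
  is_RInt (V := C_R_NormedModule) (fun s => k * f s)%C a b (k * l)%C.
Proof.
  intros J. apply is_RInt_fct_extend_pair.
  - generalize (is_RInt_minus _ _ _ _ _ _
      (is_RInt_scal _ _ _ (Re k) _ (is_RInt_fct_extend_fst _ _ _ _ J))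
      (is_RInt_scal _ _ _ (Im k) _ (is_RInt_fct_extend_snd _ _ _ _ J))).
    intros JJ. eapply is_RInt_ext; [|evar_last; [exact JJ|]].
    + intros s _. unfold minus, plus, opp, scal; simpl; unfold mult; simpl; unfold Re, Im; simpl; ring.
    + unfold minus, plus, opp, scal; simpl; unfold mult; simpl; unfold Re, Im; simpl; ring.
  - generalize (is_RInt_plus _ _ _ _ _ _
      (is_RInt_scal _ _ _ (Im k) _ (is_RInt_fct_extend_fst _ _ _ _ J))
      (is_RInt_scal _ _ _ (Re k) _ (is_RInt_fct_extend_snd _ _ _ _ J))).
    intros JJ. eapply is_RInt_ext; [|evar_last; [exact JJ|]].
    + intros s _. unfold minus, plus, opp, scal; simpl; unfold mult; simpl; unfold Re, Im; simpl; ring.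
    + unfold minus, plus, opp, scal; simpl; unfold mult; simpl; unfold Re, Im; simpl; ring.
Qed.

(** * Primitives in the upper half-plane and their boundary values *)

Lemma UHP_open z : UHP z -> nb everywhere z UHP.
Proof.
  intros Hz. exists (Im z). split; [exact Hz|]. intros w _ Hw.
  generalize (im_le_Cmod (w - z)). intros H. assert (H' : Rabs (Im (w - z)) < Im z) by lra.
  apply Rabs_def2 in H'. unfold UHP. destruct w, z; simpl in *. lra.
Qed.

Lemma UHP_segment a b (s : R) : UHP a -> UHP b -> 0 <= s <= 1 -> UHP (a + s * (b - a)).
Proof.
  unfold UHP. destruct a as [x y], b as [u v]; simpl. intros.
  replace (y + (s * (v + - y) + 0 * (u + - x))) with ((1 - s) * y + s * v) by ring.
  destruct (Req_dec s 0) as [->|N]; [lra|].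
  assert (0 < s * v) by (apply Rmult_lt_0_compat; lra).
  assert (0 <= (1 - s) * y) by (apply Rmult_le_pos; lra). lra.
Qed.

Definition pnb (s : R) (z : C) (P : R * C -> Prop) : Prop :=
  exists d, 0 < d /\ forall s' w, Rabs (s' - s) < d -> Cmod (w - z) < d -> P (s', w).

Global Instance pnb_filter s z : Filter (pnb s z).
Proof.
  split.
  - exists 1. split; [lra|auto].
  - intros P Q [d [Hd HP]] [e [He HQ]].
    exists (Rmin d e). split; [now apply Rmin_glb_lt|].
    intros s' w H1 H2. generalize (Rmin_l d e) (Rmin_r d e). intros. split.
    + apply HP; lra.
    + apply HQ; lra.
  - intros P Q H [d [Hd HP]]. exists d; split; auto.
Qed.

(** The primitive is the integral of k along the segment from b to z. The z-derivative [chi] of the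
    integrand [psi] is also the s-derivative of s k(b + s (z - b)), so its integral over [0, 1] is
    k(z). *)
Lemma star_primitive (k k' : C -> C) (b : C) : UHP b ->
  (forall z, UHP z -> cder everywhere k z (k' z)) ->
  (forall z, UHP z -> clim (nb everywhere z) k' (k' z)) ->
  exists K, forall z, UHP z -> cder everywhere K z (k z).
Proof.
  intros Hb Hk Hk'.
  set (psi := fun (s : R) (z : C) => ((z - b) * k (b + s * (z - b)))%C).
  set (chi := fun (s : R) (z : C) =>
    (k (b + s * (z - b)) + (z - b) * (s * k' (b + s * (z - b))))%C).
  assert (Ipsi : forall z, UHP z -> exists l, is_RInt (V := C_R_NormedModule) (fun s => psi s z) 0 1 l).
  { intros z Hz. apply (ex_RInt_continuous (V := C_R_CompleteNormedModule)).
    rewrite Rmin_left, Rmax_right by lra. intros s Hs. apply clim_continuous.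
    assert (P : UHP (b + s * (z - b))) by now apply UHP_segment.
    intros e He.
    assert (Q : clim (nb everywhere s) (fun w => (z - b) * k (b + w * (z - b)))%C (psi s z)).
    { unfold psi. apply clim_mult; [apply clim_const|].
      apply (cder_cont everywhere (fun w => k (b + w * (z - b)))%C s _
        (cder_line _ _ _ _ _ (Hk _ P))). }
    destruct (Q e He) as [d [Hd Q']]. exists d; split; auto. intros s' Hs'.
    apply Q'; [exact I|]. now rewrite <- RtoC_minus, Cmod_R. }
  assert (Ichi : forall z, UHP z -> is_RInt (V := C_R_NormedModule) (fun s => chi s z) 0 1 (k z)).
  { intros z Hz.
    replace (k z) with (RtoC 1 * k (b + RtoC 1 * (z - b)) - RtoC 0 * k (b + RtoC 0 * (z - b)))%C.
    2: { replace (b + 1 * (z - b))%C with z by ring. ring. }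
    assert (P : forall s : R, 0 <= s <= 1 -> UHP (b + s * (z - b))).
    { intros; now apply UHP_segment. }
    set (h := fun w : C => (w * k (b + w * (z - b)))%C).
    set (h' := fun w : C => (k (b + w * (z - b)) + (z - b) * (w * k' (b + w * (z - b))))%C).
    change (is_RInt (V := C_R_NormedModule) (fun s : R => h' s) 0 1 (h (RtoC 1) - h (RtoC 0))%C).
    generalize (is_RInt_line everywhere h h' 0 1 0 1). intros L.
    apply (is_RInt_ext (fun s : R => (h' (0 + s * 1) * 1)%C)).
    { intros s _. rewrite Cplus_0_l, !Cmult_1_r. reflexivity. }
    assert (E : forall w : C, (0 + w * 1)%C = w) by (intros; ring).
    rewrite !E in L. apply L; [lra|intros; exact I| |].
    - intros s Hs. rewrite !E. unfold h, h'.
      apply cder_unique_val with (1 * k (b + s * (z - b)) + s * (k' (b + s * (z - b)) * (z - b)))%C; [ring|].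
      apply (cder_mult everywhere (fun w => w) (fun w => k (b + w * (z - b)))%C); [apply cder_id|].
      apply cder_line, Hk. now apply P.
    - intros s Hs. rewrite !E. unfold h'.
      assert (A : clim (nb everywhere s) (fun w => b + w * (z - b))%C (b + s * (z - b))%C).
      { apply clim_plus; [apply clim_const|]. apply clim_mult; [apply clim_id|apply clim_const]. }
      apply clim_plus; [|apply clim_mult; [apply clim_const|apply clim_mult; [apply clim_id|]]].
      + apply (clim_comp _ _ k everywhere (b + s * (z - b))%C); auto.
        * apply filter_forall; intros; exact I.
        * apply (cder_cont _ _ _ _ (Hk _ (P s Hs))).
      + apply (clim_comp _ _ k' everywhere (b + s * (z - b))%C); auto.
        apply filter_forall; intros; exact I. }
  exists (fun z => Cint (fun s => psi s z) 0 1).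
  intros z Hz. rewrite cder_eps. intros e He.
  destruct (UHP_open z Hz) as [d0 [Hd0 HU]].
  (* The derivative [chi s] has to be close to its value at [z] uniformly in [s]; joint continuity
     and compactness of [0, 1] give this. *)
  destruct (gauge_interval (fun s d => forall w, Cmod (w - z) < d -> Cmod (chi s w - chi s z) <= e) 0 1)
    as [d [Hd Hchi]].
  { intros s d d' Hd H w Hw. apply H. lra. }
  { intros s Hs.
    assert (P : UHP (b + s * (z - b))) by now apply UHP_segment.
    assert (X : clim (pnb s z) (fun q => chi (fst q) (snd q)) (chi s z)).
    { assert (A1 : clim (pnb s z) (fun q => RtoC (fst q)) (RtoC s)).
      { intros e' He'. exists e'; split; auto. intros s' w H _. simpl.
        now rewrite <- RtoC_minus, Cmod_R. }
      assert (A2 : clim (pnb s z) (fun q => snd q) z).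
      { intros e' He'. exists e'; split; auto. }
      assert (A3 : clim (pnb s z) (fun q => b + fst q * (snd q - b))%C (b + s * (z - b))%C).
      { apply clim_plus; [apply clim_const|]. apply clim_mult; auto.
        apply clim_minus; auto. apply clim_const. }
      unfold chi. apply clim_plus; [|apply clim_mult; [apply clim_minus; [auto|apply clim_const]|apply clim_mult; auto]].
      + apply (clim_comp _ _ k everywhere (b + s * (z - b))%C); auto.
        * apply filter_forall; intros; exact I.
        * apply (cder_cont _ _ _ _ (Hk _ P)).
      + apply (clim_comp _ _ k' everywhere (b + s * (z - b))%C); auto.
        apply filter_forall; intros; exact I. }
    assert (He2 : 0 < e / 2) by lra.
    destruct (X _ He2) as [d [Hd H]]. exists d; split; auto.
    intros s' _ Hs' w Hw.
    generalize (H s' w Hs' Hw). assert (Hz0 : Cmod (z - z) < d).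
    { replace (z - z)%C with (RtoC 0) by ring. now rewrite Cmod_0. }
    generalize (H s' z Hs' Hz0). simpl. intros H1 H2. rewrite Cmod_minus_sym in H1.
    generalize (Cmod_tri (chi s' w) (chi s z) (chi s' z)). lra. }
  exists (Rmin d d0). split; [now apply Rmin_glb_lt|]. intros w _ Hw.
  assert (Hwd : Cmod (w - z) < d) by (eapply Rlt_le_trans; [exact Hw|apply Rmin_l]).
  assert (Uw : UHP w).
  { apply HU; [exact I|]. eapply Rlt_le_trans; [exact Hw|apply Rmin_r]. }
  destruct (Ipsi w Uw) as [lw Iw], (Ipsi z Hz) as [lz Iz].
  unfold Cint.
  rewrite (is_RInt_unique (V := C_R_CompleteNormedModule) _ _ _ _ Iw),
    (is_RInt_unique (V := C_R_CompleteNormedModule) _ _ _ _ Iz).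
  assert (I3 : is_RInt (V := C_R_NormedModule) (fun s => chi s z * (w - z))%C 0 1 (k z * (w - z))%C).
  { rewrite Cmult_comm. apply (is_RInt_ext (fun s => (w - z) * chi s z)%C).
    - intros s _. apply Cmult_comm.
    - apply is_RInt_Cscal. now apply Ichi. }
  (* The error of the linear approximation is the integral over [s] of the errors of [psi s], each
     at most e |w - z| by the mean value inequality. *)
  generalize (is_RInt_minus _ _ _ _ _ _ (is_RInt_minus _ _ _ _ _ _ Iw Iz) I3). intros J.
  change (is_RInt (V := C_R_NormedModule) (fun s => psi s w - psi s z - chi s z * (w - z))%C 0 1
    (lw - lz - k z * (w - z))%C) in J.
  rewrite Cmod_norm.
  replace (e * Cmod (w - z)) with ((1 - 0) * (e * Cmod (w - z))) by ring.
  apply (norm_RInt_le_const (V := C_R_NormedModule)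
    (fun s => psi s w - psi s z - chi s z * (w - z))%C 0 1); [lra| |exact J].
  intros s Hs. rewrite <- Cmod_norm.
  apply (mean_value_ineq (psi s) (chi s)).
  - intros r Hr. set (y := (z + r * (w - z))%C).
    assert (Uy : UHP y) by now apply UHP_segment.
    assert (P : UHP (b + s * (y - b))) by now apply UHP_segment.
    unfold psi, chi.
    apply cder_unique_val with ((1 - 0) * k (b + s * (y - b)) +
      (y - b) * (k' (b + s * (y - b)) * (s * (1 - 0))))%C; [ring|].
    apply (cder_mult everywhere (fun z => z - b)%C (fun z => k (b + s * (z - b)))%C).
    + apply cder_minus; [apply cder_id|apply cder_const].
    + apply (cder_comp _ everywhere (fun z => b + s * (z - b))%C k).
      * apply cder_unique_val with (0 + s * (1 - 0))%C; [ring|].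
        apply cder_plus; [apply cder_const|]. apply cder_scal.
        apply cder_minus; [apply cder_id|apply cder_const].
      * now apply Hk.
      * apply filter_forall; intros; exact I.
  - intros r Hr. apply Hchi; auto.
    replace (z + r * (w - z) - z)%C with (r * (w - z))%C by ring.
    rewrite Cmod_mult, Cmod_R, Rabs_pos_eq by lra.
    eapply Rle_lt_trans; [|exact Hwd]. rewrite <- (Rmult_1_l (Cmod (w - z))) at 2.
    apply Rmult_le_compat_r; [apply Cmod_ge_0|lra].
Qed.

(** The filter of h tending to 0 from above, along which a boundary point is approached vertically
    by p + i h. *)
Definition rpos (P : R -> Prop) : Prop := exists d, 0 < d /\ forall h, 0 < h < d -> P h.

Global Instance rpos_filter : ProperFilter rpos.
Proof.
  split.
  - intros P [d [Hd H]]. exists (d / 2). apply H. lra.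
  - split.
    + exists 1. split; [lra|auto].
    + intros P Q [d [Hd HP]] [e [He HQ]].
      exists (Rmin d e). split; [now apply Rmin_glb_lt|].
      intros h Hh. generalize (Rmin_l d e) (Rmin_r d e). intros.
      split; [apply HP|apply HQ]; lra.
    + intros P Q H [d [Hd HP]]. exists d; split; auto.
Qed.

Lemma UHP_shift p h : closed_UHP p -> 0 < h -> UHP (p + Ci * RtoC h).
Proof. unfold closed_UHP, UHP. destruct p; simpl. lra. Qed.

Lemma rpos_shift p P : closed_UHP p -> nb UHP p P -> rpos (fun h => P (p + Ci * RtoC h)%C).
Proof.
  intros Hp [d [Hd H]]. exists d; split; auto. intros h Hh. apply H.
  - apply UHP_shift; [auto|lra].
  - replace (p + Ci * RtoC h - p)%C with (Ci * RtoC h)%C by ring.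
    rewrite Cmod_mult, Cmod_Ci, Cmod_R, Rabs_pos_eq; lra.
Qed.

Lemma clim_shift p f l : closed_UHP p -> clim (nb UHP p) f l ->
  clim rpos (fun h => f (p + Ci * RtoC h)%C) l.
Proof. intros Hp H e He. apply (rpos_shift p (fun w => Cmod (f w - l) < e)); auto. Qed.

Lemma nb_UHP_proper p : closed_UHP p -> ProperFilter (nb UHP p).
Proof.
  intros Hp. split; [|apply nb_filter].
  intros P H. destruct (filter_ex _ (rpos_shift p P Hp H)) as [h Hh]. eauto.
Qed.

Lemma UHP_closed z : UHP z -> closed_UHP z.
Proof. unfold UHP, closed_UHP; lra. Qed.

Lemma Cmod_segment a b p d (s : R) : Cmod (a - p) < d -> Cmod (b - p) < d -> 0 <= s <= 1 ->
  Cmod (a + s * (b - a) - p) < d.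
Proof.
  intros Ha Hb Hs.
  replace (a + s * (b - a) - p)%C with (RtoC (1 - s) * (a - p) + RtoC s * (b - p))%C
    by (rewrite RtoC_minus; ring).
  eapply Rle_lt_trans; [apply Cmod_triangle|].
  rewrite !Cmod_mult, !Cmod_R, !Rabs_pos_eq by lra.
  destruct (Req_dec s 0) as [->|N]; [lra|].
  assert ((1 - s) * Cmod (a - p) <= (1 - s) * d) by (apply Rmult_le_compat_l; lra).
  assert (s * Cmod (b - p) < s * d) by (apply Rmult_lt_compat_l; lra). lra.
Qed.

(* At a boundary point where the derivative has a limit, the primitive is
   Lipschitz on a half disk, hence Cauchy. *)
Lemma boundary_extension (U : C -> Prop) (F G : C -> C) :
  (forall z, UHP z -> U z -> cder everywhere F z (G z)) ->
  (forall p, closed_UHP p -> U p -> nb closed_UHP p U) ->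
  (forall p, closed_UHP p -> U p -> clim (nb UHP p) G (G p)) ->
  exists H : C -> C,
    (forall p, closed_UHP p -> U p -> cder closed_UHP H p (G p)) /\
    (forall p, closed_UHP p -> U p -> clim (nb UHP p) F (H p)) /\
    (forall z, UHP z -> U z -> H z = F z).
Proof.
  intros HF HU HG.
  (* Half discs are convex, so the mean value inequality holds between any two of their interior
     points. *)
  assert (Loc : forall p, closed_UHP p -> U p -> forall e, 0 < e -> exists d, 0 < d /\
    forall a b, UHP a -> UHP b -> Cmod (a - p) < d -> Cmod (b - p) < d ->
    Cmod (F b - F a - G p * (b - a)) <= e * Cmod (b - a)).
  { intros p Hp Up e He.
    destruct (HU p Hp Up) as [d1 [Hd1 H1]], (HG p Hp Up e He) as [d2 [Hd2 H2]].
    exists (Rmin d1 d2). split; [now apply Rmin_glb_lt|].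
    intros a b Ua Ub Ha Hb.
    assert (Hs : forall s : R, 0 <= s <= 1 -> UHP (a + s * (b - a)) /\
      Cmod (a + s * (b - a) - p) < Rmin d1 d2).
    { intros s Hs. split; [now apply UHP_segment|now apply Cmod_segment]. }
    generalize (Rmin_l d1 d2) (Rmin_r d1 d2). intros L1 L2.
    apply (mean_value_ineq F G); intros s Hs'; destruct (Hs s Hs') as [U1 M1].
    - apply HF; auto. apply H1; [now apply UHP_closed|lra].
    - left. apply H2; auto. lra. }
  assert (Lim : forall p, closed_UHP p -> U p -> exists l, clim (nb UHP p) F l).
  { intros p Hp Up. generalize (nb_UHP_proper p Hp); intros PF.
    assert (X : exists l : C_R_CompleteNormedModule, filterlim F (nb UHP p) (locally l)).
    { apply (filterlim_locally_cauchy (U := C_R_CompleteNormedModule)).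
      intros eps. destruct (Loc p Hp Up 1 Rlt_0_1) as [d [Hd H]].
      set (K := 1 + Cmod (G p)). assert (HK : 0 < K) by (unfold K; generalize (Cmod_ge_0 (G p)); lra).
      set (r := Rmin d (eps / (2 * K))).
      assert (Hr : 0 < r).
      { apply Rmin_glb_lt; auto. apply Rdiv_lt_0_compat; [apply cond_pos|lra]. }
      exists (fun w => UHP w /\ Cmod (w - p) < r). split.
      { exists r. split; auto. }
      intros u v [Uu Hu] [Uv Hv].
      apply C_NormedModule_mixin_compat1. change (minus (F v) (F u)) with (F v - F u)%C.
      assert (Hru : Cmod (u - p) < d) by (eapply Rlt_le_trans; [exact Hu|apply Rmin_l]).
      assert (Hrv : Cmod (v - p) < d) by (eapply Rlt_le_trans; [exact Hv|apply Rmin_l]).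
      specialize (H u v Uu Uv Hru Hrv).
      replace (F v - F u)%C with ((F v - F u - G p * (v - u)) + G p * (v - u))%C by ring.
      eapply Rle_lt_trans; [apply Cmod_triangle|]. rewrite Cmod_mult.
      apply Rle_lt_trans with (K * Cmod (v - u)); [unfold K; lra|].
      assert (Cmod (v - u) < eps / K).
      { eapply Rle_lt_trans; [apply (Cmod_tri v p u)|].
        rewrite (Cmod_minus_sym p u).
        assert (r <= eps / (2 * K)) by apply Rmin_r.
        replace (eps / K) with (eps / (2 * K) + eps / (2 * K)) by (field; lra). lra. }
      replace (pos eps) with (K * (eps / K)) by (field; lra).
      now apply Rmult_lt_compat_l. }
    destruct X as [l Hl]. exists l. apply (clim_filterlim (nb UHP p) F l). exact Hl. }
  assert (Sel : forall p, {l | closed_UHP p -> U p -> clim (nb UHP p) F l}).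
  { intros p. apply constructive_indefinite_description.
    destruct (classic (closed_UHP p /\ U p)) as [[H1 H2]|N].
    - destruct (Lim p H1 H2) as [l Hl]. exists l; auto.
    - exists (RtoC 0). tauto. }
  exists (fun p => proj1_sig (Sel p)).
  assert (HH : forall p, closed_UHP p -> U p -> clim (nb UHP p) F (proj1_sig (Sel p))).
  { intros p. apply (proj2_sig (Sel p)). }
  split; [|split; [exact HH|]].
  - intros p Hp Up. rewrite cder_eps. intros e He.
    destruct (Loc p Hp Up e He) as [d [Hd H]].
    destruct (HU p Hp Up) as [d1 [Hd1 H1]].
    exists (Rmin d d1). split; [now apply Rmin_glb_lt|]. intros w Hw Hwp.
    assert (Hwd : Cmod (w - p) < d) by (eapply Rlt_le_trans; [exact Hwp|apply Rmin_l]).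
    assert (Uw : U w).
    { apply H1; auto. eapply Rlt_le_trans; [exact Hwp|apply Rmin_r]. }
    (* Both points are lifted by the same i h. This keeps w - p fixed, so the interior estimate
       passes to the limit h -> 0 and holds between boundary points. *)
    generalize (clim_shift p F _ Hp (HH p Hp Up)) (clim_shift w F _ Hw (HH w Hw Uw)).
    intros L1 L2.
    refine (clim_bound_le (F := rpos) _ _ _ _ (clim_minus _ _ _ _ L2 L1) _).
    exists (d - Cmod (w - p)). split; [lra|]. intros h Hh.
    assert (E : (w + Ci * h - (p + Ci * h))%C = (w - p)%C) by ring.
    rewrite <- E.
    apply H; try (apply UHP_shift; [auto|lra]).
    + replace (p + Ci * RtoC h - p)%C with (Ci * RtoC h)%C by ring.
      rewrite Cmod_mult, Cmod_Ci, Cmod_R, Rabs_pos_eq by lra.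
      generalize (Cmod_ge_0 (w - p)). lra.
    + replace (w + Ci * RtoC h - p)%C with ((w - p) + Ci * RtoC h)%C by ring.
      eapply Rle_lt_trans; [apply Cmod_triangle|].
      rewrite Cmod_mult, Cmod_Ci, Cmod_R, Rabs_pos_eq; lra.
  - intros z Hz Uz. generalize (nb_UHP_proper z (UHP_closed z Hz)). intros PF.
    refine (clim_unique (F := nb UHP z) F _ _ (HH z (UHP_closed z Hz) Uz) _).
    apply (clim_mono (nb everywhere z)).
    + intros P. apply nb_mono. intros; exact I.
    + apply (cder_cont _ _ _ _ (HF z Hz Uz)).
Qed.

(** * The pole *)

(** The hypothesis is lower semicontinuity only. *)
Lemma min_box (f : C -> R) (a b a' b' : R) : a <= b -> a' <= b' ->
  (forall p : C, a <= Re p <= b -> a' <= Im p <= b' -> forall e, 0 < e ->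
    nb everywhere p (fun z => f p - e < f z)) ->
  exists p : C, a <= Re p <= b /\ a' <= Im p <= b' /\
    forall z : C, a <= Re z <= b -> a' <= Im z <= b' -> f p <= f z.
Proof.
  intros Hab Hab' Hf.
  set (B := fun z : C => a <= Re z <= b /\ a' <= Im z <= b').
  (* The lower bound is written -1/d so that it weakens as d decreases. *)
  destruct (gauge_box (fun z d => - / d <= f z) everywhere a b a' b') as [d [Hd Hlow]].
  { intros z d d' Hd H. apply Rle_trans with (- / d); auto. apply Ropp_le_contravar.
    apply Rinv_le_contravar; lra. }
  { intros p H1 H2. destruct (Hf p H1 H2 1 Rlt_0_1) as [d [Hd H]].
    set (k := / (Rabs (f p) + 1)).
    assert (Hk : 0 < k) by (apply Rinv_0_lt_compat; generalize (Rabs_pos (f p)); lra).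
    exists (Rmin d k). split; [now apply Rmin_glb_lt|]. intros z _ Hz.
    assert (f p - 1 < f z) by (apply H; [exact I|]; eapply Rlt_le_trans; [exact Hz|apply Rmin_l]).
    assert (/ k <= / Rmin d k).
    { apply Rinv_le_contravar; [now apply Rmin_glb_lt|apply Rmin_r]. }
    unfold k in H3 at 1. rewrite Rinv_inv in H3.
    generalize (Rle_abs (- f p)). rewrite Rabs_Ropp. lra. }
  destruct (completeness (fun r => exists z, B z /\ r = - f z)) as [m [Hm1 Hm2]].
  { exists (/ d). intros r [z [[H1 H2] ->]]. specialize (Hlow z H1 H2 I). lra. }
  { exists (- f (a, a')), (a, a'). split; [|reflexivity]. unfold B; simpl; lra. }
  apply NNPP. intros N.
  (* If the infimum -m were not attained, [f] would exceed it near each point by a fixed amount,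
     hence everywhere by a common amount d', against the choice of m. *)
  destruct (gauge_box (fun z d => - m + d <= f z) everywhere a b a' b') as [d' [Hd' Hlow']].
  { intros z e e' He H. lra. }
  { intros p H1 H2.
    assert (Hp : - m < f p).
    { destruct (Rlt_dec (- m) (f p)) as [L|L]; auto. exfalso. apply N. exists p.
      split; [|split]; auto. intros z H3 H4.
      assert (- f z <= m) by (apply Hm1; exists z; split; [split|]; auto). lra. }
    assert (He : 0 < (f p + m) / 2) by lra.
    destruct (Hf p H1 H2 _ He) as [d1 [Hd1 H]].
    exists (Rmin d1 ((f p + m) / 2)). split; [now apply Rmin_glb_lt|]. intros z _ Hz.
    generalize (Rmin_l d1 ((f p + m) / 2)) (Rmin_r d1 ((f p + m) / 2)); intros L1 L2.
    assert (f p - (f p + m) / 2 < f z) by (apply H; [exact I|lra]). lra. }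
  assert (m <= m - d'); [|lra].
  apply Hm2. intros r [z [[H1 H2] ->]]. specialize (Hlow' z H1 H2 I). lra.
Qed.

Lemma UHP_minus_R z (a : R) : UHP z -> UHP (z - a).
Proof. unfold UHP; destruct z; simpl. lra. Qed.

Lemma UHP_neq_0 z : UHP z -> z <> RtoC 0.
Proof. unfold UHP. intros H ->. simpl in H. lra. Qed.

Lemma cder_UHP D f z l : UHP z -> (forall w, UHP w -> D w) -> cder D f z l -> cder everywhere f z l.
Proof.
  intros Hz HD H. apply (cder_open UHP); [now apply UHP_open|]. now apply (cder_mono D).
Qed.

Lemma cder_Clog_shift z (a : R) : UHP z -> cder everywhere (fun w => Clog (w - a)) z (/ (z - a)).
Proof.
  intros Hz. apply (cder_UHP UHP); auto.
  apply cder_unique_val with (/ (z - a) * (1 - 0))%C; [ring|].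
  apply (cder_comp _ closed_UHP (fun w => w - a)%C).
  - apply cder_minus; [apply cder_id|apply cder_const].
  - apply cder_Clog; [now apply UHP_closed, UHP_minus_R|now apply UHP_neq_0, UHP_minus_R].
  - generalize (nb_domain UHP z). apply filter_imp. intros w Hw. now apply UHP_closed, UHP_minus_R.
Qed.

Section PoleLocation.
Variables alpha beta gamma delta t : R.
Hypotheses (ha : 0 < alpha < 1) (hb : 0 < beta < 1) (hg : 0 < gamma < 1)
  (hd : 0 < delta < 1) (hsum : alpha + beta + gamma + delta = 2) (ht : 1 < t).

(* The equation for z0 says that z0 is a critical point of this function, which
   up to constants is a positive combination of the Busemann functions of the
   hyperbolic plane at 0, 1, t and infinity; hence it is convex. *)
Definition potential (z : C) : R :=
  alpha * ln (Cmod (z - 0)) + beta * ln (Cmod (z - 1)) + gamma * ln (Cmod (z - t)) - ln (Im z).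

Lemma Im_le_Cmod_shift z (a : R) : UHP z -> Im z <= Cmod (z - a).
Proof.
  intros Hz. generalize (im_le_Cmod (z - a)) (Rle_abs (Im (z - a))). destruct z; simpl. lra.
Qed.

(** For large |z| the logarithms combine to (alpha + beta + gamma - 1) ln |z|, and this coefficient
    1 - delta is positive. *)
Lemma potential_far z : UHP z -> 2 * t <= Cmod z ->
  (1 - delta) * ln (Cmod z) - 2 * ln 2 <= potential z.
Proof.
  intros Hz Hm. unfold potential.
  assert (A : forall a : R, 0 <= a <= t -> ln (Cmod z) - ln 2 <= ln (Cmod (z - a))).
  { intros a Hta. rewrite <- ln_div by lra. apply ln_le; [lra|].
    generalize (Cmod_sub_ge z a). rewrite Cmod_nonneg_R by lra. lra. }
  assert (A0 : ln (Cmod (z - 0)) = ln (Cmod z)) by (do 2 f_equal; ring).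
  assert (A3 : ln (Im z) <= ln (Cmod z)).
  { apply ln_le; [exact Hz|]. generalize (Im_le_Cmod_shift z 0 Hz).
    now replace (z - 0)%C with z by ring. }
  assert (A1 := A 1 ltac:(lra)). assert (A2 := A t ltac:(lra)).
  rewrite A0. assert (L2 : 0 < ln 2) by (rewrite <- ln_1; apply ln_increasing; lra).
  assert (beta * (ln (Cmod z) - ln 2) <= beta * ln (Cmod (z - 1))) by (apply Rmult_le_compat_l; lra).
  assert (gamma * (ln (Cmod z) - ln 2) <= gamma * ln (Cmod (z - t))) by (apply Rmult_le_compat_l; lra).
  assert ((1 - delta) * ln (Cmod z) = alpha * ln (Cmod z) + beta * ln (Cmod z) + gamma * ln (Cmod z) - ln (Cmod z)).
  { replace delta with (2 - alpha - beta - gamma) by lra. ring. }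
  assert (beta * ln 2 <= 1 * ln 2) by (apply Rmult_le_compat_r; lra).
  assert (gamma * ln 2 <= 1 * ln 2) by (apply Rmult_le_compat_r; lra).
  lra.
Qed.

(** At most one of 0, 1, t is closer than m to z. The two distant logarithms are at least ln m < 0,
    with weights below 1. The third, of weight w < 1, is at least ln (Im z), which leaves (1 - w) (-
    ln (Im z)). *)
Lemma potential_low z : UHP z -> Im z < 1 ->
  2 * ln (Rmin 1 (t - 1) / 2) + Rmin (1 - alpha) (Rmin (1 - beta) (1 - gamma)) * - ln (Im z)
  <= potential z.
Proof.
  intros Hz Hy. unfold potential. set (m := Rmin 1 (t - 1) / 2).
  set (k := Rmin (1 - alpha) (Rmin (1 - beta) (1 - gamma))).
  assert (Hm : 0 < m) by (unfold m; assert (0 < Rmin 1 (t - 1)) by (apply Rmin_glb_lt; lra); lra).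
  assert (Hm1 : 2 * m <= 1) by (unfold m; generalize (Rmin_l 1 (t - 1)); lra).
  assert (Hm2 : 2 * m <= t - 1) by (unfold m; generalize (Rmin_r 1 (t - 1)); lra).
  assert (K1 : k <= 1 - alpha) by apply Rmin_l.
  assert (K2 : k <= 1 - beta) by (eapply Rle_trans; [apply Rmin_r|apply Rmin_l]).
  assert (K3 : k <= 1 - gamma) by (eapply Rle_trans; [apply Rmin_r|apply Rmin_r]).
  assert (Lm : ln m < 0) by (rewrite <- ln_1; apply ln_increasing; lra).
  assert (Ly : ln (Im z) < 0) by (rewrite <- ln_1; apply ln_increasing; auto).
  assert (low : forall a : R, ln (Im z) <= ln (Cmod (z - a))).
  { intros a. apply ln_le; [exact Hz|]. now apply Im_le_Cmod_shift. }
  assert (sep : forall a b : R, 2 * m <= b - a -> m <= Cmod (z - a) \/ m <= Cmod (z - b)).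
  { intros a b Hab. destruct (Rle_dec m (Cmod (z - a))) as [L|L]; [now left|right].
    generalize (Cmod_tri b z a). rewrite (Cmod_minus_sym b z), <- RtoC_minus, Cmod_nonneg_R; lra. }
  assert (lm : forall a : R, m <= Cmod (z - a) -> ln m <= ln (Cmod (z - a))).
  { intros a. now apply ln_le. }
  assert (S1 := sep 0 1 ltac:(lra)). assert (S2 := sep 1 t ltac:(lra)). assert (S3 := sep 0 t ltac:(lra)).
  assert (gen : forall c x v, 0 < c < 1 -> v <= x -> c * v <= c * x).
  { intros; apply Rmult_le_compat_l; lra. }
  assert (X : forall c, 0 < c < 1 -> ln m <= c * ln m).
  { intros c Hc. assert (0 <= (1 - c) * - ln m) by (apply Rmult_le_pos; lra). lra. }
  assert (Y : forall c, k <= 1 - c -> k * - ln (Im z) <= c * ln (Im z) - ln (Im z)).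
  { intros c Hc. assert (0 <= (1 - c - k) * - ln (Im z)) by (apply Rmult_le_pos; lra). lra. }
  (* Here [a] and [b] are two distant points, [c] is the third one, and x, y, w are their
     weights. *)
  assert (Q : forall a b : R, m <= Cmod (z - a) -> m <= Cmod (z - b) -> forall c x y w,
    0 < x < 1 -> 0 < y < 1 -> 0 < w < 1 -> k <= 1 - w ->
    2 * ln m + k * - ln (Im z) <=
    x * ln (Cmod (z - a)) + y * ln (Cmod (z - b)) + w * ln (Cmod (z - RtoC c)) - ln (Im z)).
  { intros a b Ha Hb c x y w Hx Hy' Hw Hk.
    generalize (gen x _ _ Hx (lm a Ha)) (gen y _ _ Hy' (lm b Hb)) (gen w _ _ Hw (low c))
      (X x Hx) (X y Hy') (Y w Hk). lra. }
  destruct S1 as [S1|S1], S2 as [S2|S2], S3 as [S3|S3];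
    first [ generalize (Q 0 1 ltac:(assumption) ltac:(assumption) t alpha beta gamma ha hb hg K3); lra
          | generalize (Q 0 t ltac:(assumption) ltac:(assumption) 1 alpha gamma beta ha hg hb K2); lra
          | generalize (Q 1 t ltac:(assumption) ltac:(assumption) 0 beta gamma alpha hb hg ha K1); lra ].
Qed.

(** A holomorphic function whose real part is the potential without its term - ln (Im z);
    directional derivatives of the potential are read off from its complex derivative. *)
Definition Wpot (z : C) : C :=
  (alpha * Clog (z - RtoC 0) + beta * Clog (z - RtoC 1) + gamma * Clog (z - t))%C.

Lemma potential_Wpot z : potential z = Re (Wpot z) - ln (Im z).
Proof. unfold potential, Wpot, Clog. simpl. ring. Qed.

Lemma cder_Wpot z : UHP z ->
  cder everywhere Wpot z (alpha / (z - RtoC 0) + beta / (z - RtoC 1) + gamma / (z - t))%C.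
Proof.
  intros Hz. unfold Wpot. repeat apply cder_plus; apply cder_scal; now apply cder_Clog_shift.
Qed.

Lemma potential_cont z : UHP z -> forall e, 0 < e -> nb everywhere z (fun w => potential z - e < potential w).
Proof.
  intros Hz e He.
  generalize (clim_Re _ _ _ (cder_cont _ _ _ _ (cder_Wpot z Hz))). intros C1.
  assert (C2 : clim (nb everywhere z) (fun w => RtoC (ln (Im w))) (RtoC (ln (Im z)))).
  { apply (clim_RtoC_comp _ Im ln (Im z) (fun _ => True)).
    - apply (clim_Im (nb everywhere z) (fun w => w)), clim_id.
    - now apply filter_forall.
    - now apply ln_cont_eps. }
  generalize (clim_minus _ _ _ _ C1 C2 e He). apply filter_imp. intros w.
  rewrite <- !RtoC_minus, Cmod_R, <- !potential_Wpot. intros H.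
  apply Rabs_def2 in H. lra.
Qed.

Lemma z0_exists : exists z, UHP z /\ z0_equation alpha beta gamma t z.
Proof.
  set (u0 := potential Ci).
  (* M and eta are obtained by solving the two lower bounds for the level u0: a point with potential
     at most u0 satisfies |z| <= M and Im z >= eta. *)
  set (M := Rmax (2 * t) (exp ((u0 + 2 * ln 2) / (1 - delta)))).
  set (k := Rmin (1 - alpha) (Rmin (1 - beta) (1 - gamma))).
  assert (Hk : 0 < k) by (repeat apply Rmin_glb_lt; lra).
  set (m := Rmin 1 (t - 1) / 2).
  set (eta := Rmin 1 (exp (- ((u0 - 2 * ln m) / k)))).
  assert (Heta : 0 < eta) by (apply Rmin_glb_lt; [lra|apply exp_pos]).
  assert (Heta1 : eta <= 1) by apply Rmin_l.
  assert (HM : 2 * t <= M) by apply Rmax_l.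
  assert (bd : forall z, UHP z -> potential z <= u0 -> Cmod z <= M /\ eta <= Im z).
  { intros z Hz Hu. split.
    - apply Rnot_lt_le. intros L. generalize (potential_far z Hz ltac:(lra)). intros F.
      assert (ln (Cmod z) <= (u0 + 2 * ln 2) / (1 - delta)).
      { apply Rmult_le_reg_r with (1 - delta); [lra|]. unfold Rdiv.
        rewrite Rmult_assoc, Rinv_l by lra. lra. }
      assert (Hz0 : 0 < Cmod z) by lra.
      assert (Cmod z <= exp ((u0 + 2 * ln 2) / (1 - delta))).
      { rewrite <- (exp_ln (Cmod z)) by auto. destruct H as [H|H].
        - left. now apply exp_increasing.
        - right. now rewrite H. }
      assert (exp ((u0 + 2 * ln 2) / (1 - delta)) <= M) by apply Rmax_r. lra.
    - destruct (Rlt_dec (Im z) 1) as [L|L]; [|lra].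
      generalize (potential_low z Hz L). fold m k. intros F.
      assert (- ((u0 - 2 * ln m) / k) <= ln (Im z)).
      { apply Rmult_le_reg_r with k; [lra|]. unfold Rdiv.
        replace (- ((u0 - 2 * ln m) * / k) * k) with (- ((u0 - 2 * ln m) * (/ k * k))) by ring.
        rewrite Rinv_l by lra. lra. }
      apply Rle_trans with (exp (- ((u0 - 2 * ln m) / k))); [apply Rmin_r|].
      rewrite <- (exp_ln (Im z)) by exact Hz. destruct H as [H|H].
      + left. now apply exp_increasing.
      + right. now rewrite H. }
  (* The box has a margin of 1 at the sides and on top and of eta / 2 below. It contains i, so the
     minimum is at most u0 and is attained at distance at least eta / 2 from the edges. *)
  destruct (min_box potential (- (M + 1)) (M + 1) (eta / 2) (M + 1)) as [p [P1 [P2 P3]]]; try lra.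
  { intros p H1 H2. apply potential_cont. unfold UHP. lra. }
  assert (Hp : UHP p) by (unfold UHP; lra).
  assert (Hpu : potential p <= u0) by (apply P3; simpl; lra).
  destruct (bd p Hp Hpu) as [B1 B2].
  exists p. split; auto.
  set (E := (alpha / (p - RtoC 0) + beta / (p - RtoC 1) + gamma / (p - t))%C).
  assert (crit : forall v : C, Cmod v = 1 -> Re (E * v) = Im v / Im p).
  { intros v Hv.
    set (r := fun s : R => potential (p + s * v)).
    assert (D : derivable_pt_lim r 0 (Re (E * v) - Im v / Im p)).
    { apply is_derive_Reals. unfold r.
      apply (is_derive_ext (fun s : R => Re (Wpot (p + s * v)) - ln (Im p + s * Im v))).
      { intros s. rewrite potential_Wpot. do 2 f_equal. destruct p, v; simpl. ring. }
      apply (is_derive_minus (V := R_NormedModule)).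
      - apply (cder_real (fun w => Wpot (p + w * v))%C). apply cder_line.
        replace (p + 0 * v)%C with p by ring. now apply cder_Wpot.
      - replace (Im v / Im p) with (Im v * / (Im p + 0 * Im v)) by (field; lra).
        auto_derive; [lra|ring]. }
    assert (pr : derivable_pt r 0) by (exists (Re (E * v) - Im v / Im p); exact D).
    generalize (deriv_minimum r (- (eta / 2)) (eta / 2) 0 pr). intros DM.
    rewrite (derive_pt_eq_0 _ _ _ pr D) in DM.
    enough (Re (E * v) - Im v / Im p = 0) by lra.
    apply DM; try lra. intros s Hs1 Hs2. unfold r.
    replace (p + 0 * v)%C with p by ring.
    assert (Cmod (s * v) < eta / 2).
    { rewrite Cmod_mult, Hv, Rmult_1_r, Cmod_R. apply Rabs_def1; lra. }
    generalize (re_le_Cmod (s * v)) (im_le_Cmod (s * v)). intros R1 R2.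
    assert (R3 : Rabs (Re (s * v)) < eta / 2) by lra.
    assert (R4 : Rabs (Im (s * v)) < eta / 2) by lra.
    apply Rabs_def2 in R3. apply Rabs_def2 in R4.
    generalize (re_le_Cmod p) (im_le_Cmod p). intros R5 R6.
    assert (R7 : Rabs (Re p) <= M) by lra. assert (R8 : Rabs (Im p) <= M) by lra.
    apply Rabs_le_between in R7. apply Rabs_le_between in R8.
    apply P3; destruct p, v; simpl in *; lra. }
  (* The directions 1 and i give Re E = 0 and Im E = -1 / Im p, that is E = 1 / (i Im p). *)
  assert (C1 := crit 1%C Cmod_1). assert (C2 := crit Ci Cmod_Ci).
  unfold z0_equation.
  replace (alpha / p)%C with (alpha / (p - RtoC 0))%C by (unfold Cminus; f_equal; f_equal; ring).
  fold E. apply UHP_neq_0 in Hp as Np.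
  replace (1 / (Ci * Im p))%C with (- (Ci * RtoC (/ Im p)))%C.
  - apply C_ext; destruct E; simpl in *; lra.
  - assert (RtoC (Im p) <> RtoC 0) by (apply RtoC_neq_0; lra).
    rewrite RtoC_inv by lra.
    assert (Nci := Ci_nz).
    assert (CC : (Ci * Ci)%C = (- RtoC 1)%C) by (apply C_ext; simpl; ring).
    replace (1 / (Ci * Im p))%C with (- (- RtoC 1) / (Ci * Im p))%C by (field; auto).
    rewrite <- CC. field. auto.
Qed.

(** The Cayley transform x -> (x - z) / (x - conj z) sends z to 0 and the boundary points 0, 1, t,
    infinity to the unit circle, infinity to 1. The equation becomes the vanishing of their weighted
    barycentre. *)
Lemma cayley_zero z : UHP z -> z0_equation alpha beta gamma t z ->
  (alpha * ((RtoC 0 - z) / (RtoC 0 - Cconj z)) + beta * ((RtoC 1 - z) / (RtoC 1 - Cconj z)) +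
   gamma * ((t - z) / (t - Cconj z)) + delta = 0)%C.
Proof.
  intros Hz E.
  assert (E' : Cconj (alpha / z + beta / (z - 1) + gamma / (z - t)) = Cconj (1 / (Ci * Im z)))
    by (f_equal; exact E).
  assert (N : forall a : R, (z - a)%C <> RtoC 0) by (intros; now apply UHP_neq_0, UHP_minus_R).
  assert (N0 : z <> RtoC 0) by now apply UHP_neq_0.
  assert (N2 : forall a : R, (Cconj z - a)%C <> RtoC 0).
  { intros a. generalize (Cconj_neq_0 _ (N a)). rewrite Cminus_conj, Cconj_RtoC. auto. }
  assert (NI : RtoC (Im z) <> RtoC 0) by (apply RtoC_neq_0; unfold UHP in Hz; lra).
  assert (Nci := Ci_nz).
  rewrite !Cplus_conj, !Cdiv_conj, !Cminus_conj, !Cmult_conj, !Cconj_RtoC in E';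
    auto; try (apply N); try (now apply Cmult_neq_0).
  assert (CI : Cconj Ci = (- Ci)%C) by (apply C_ext; simpl; ring).
  rewrite CI in E'.
  assert (Z : z = (Cconj z + 2 * Ci * Im z)%C) by (destruct z; apply C_ext; simpl; ring).
  set (Zc := Cconj z) in *. set (y := RtoC (Im z)) in *.
  assert (S : (alpha + beta + gamma + delta)%C = RtoC 2) by (rewrite <- !RtoC_plus; now f_equal).
  assert (N3 : forall a : R, (a - Zc)%C <> RtoC 0).
  { intros a H. apply (N2 a). replace (Zc - a)%C with (- (a - Zc))%C by ring. rewrite H. ring. }
  (* Each Cayley image is 1 + 2 i y / (conj z - a). The constants add up to 2, and the conjugated
     equation turns the rest into -2. *)
  assert (T : forall a c : R, (c * ((a - z) / (a - Zc)))%C = (c + 2 * Ci * y * (c / (Zc - a)))%C).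
  { intros a c. rewrite Z. field. auto. }
  rewrite !T.
  replace (Zc - 0)%C with Zc by ring.
  transitivity (RtoC 2 + 2 * Ci * y * (alpha / Zc + beta / (Zc - 1) + gamma / (Zc - t)))%C.
  - rewrite <- S. ring.
  - rewrite E'. field. auto.
Qed.

(* Re zeta - Re ((zeta - r^2) / (1 - zeta)) = 2 (Im zeta)^2 / |1 - zeta|^2 for |zeta| = r:
   the squared-gradient term expressing convexity of a Busemann function. *)
Lemma busemann_convex (zeta : C) (r2 : R) :
  Re zeta * Re zeta + Im zeta * Im zeta = r2 -> r2 < 1 ->
  exists k, 0 < k /\ Re zeta - Re ((zeta - r2) / (1 - zeta)) = k * (Im zeta * Im zeta).
Proof.
  intros H1 H2. destruct zeta as [p q]. simpl in H1.
  assert (Hd : 0 < (1 - p) * (1 - p) + q * q).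
  { destruct (Req_dec p 1) as [->|N]; [generalize (Rle_0_sqr q); unfold Rsqr; lra|].
    assert (0 < (1 - p) * (1 - p)) by (apply Rsqr_pos_lt; lra).
    generalize (Rle_0_sqr q). unfold Rsqr. lra. }
  exists (2 / ((1 - p) * (1 - p) + q * q)). split; [apply Rdiv_lt_0_compat; lra|].
  simpl. rewrite <- H1. field.
  replace ((1 + - p) * ((1 + - p) * 1) + (0 + - q) * ((0 + - q) * 1)) with ((1 - p) * (1 - p) + q * q) by ring.
  lra.
Qed.

(* In the disk model centred at z the second solution w becomes c, and the two
   equations say that the boundary points have weighted mean 0 seen from 0 and
   from c; along the geodesic from 0 to c the gradient of the potential would
   strictly increase. *)
Lemma z0_unique z w : UHP z -> UHP w ->
  z0_equation alpha beta gamma t z -> z0_equation alpha beta gamma t w -> z = w.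
Proof.
  intros Hz Hw Ez Ew.
  generalize (cayley_zero z Hz Ez) (cayley_zero w Hw Ew). intros Sz Sw. clear Ez Ew.
  assert (NR : forall v (a : R), UHP v -> (a - v)%C <> RtoC 0).
  { intros v a Hv H. apply (UHP_neq_0 _ (UHP_minus_R v a Hv)).
    replace (v - a)%C with (- (a - v))%C by ring. rewrite H. ring. }
  assert (NR' : forall v (a : R), UHP v -> (a - Cconj v)%C <> RtoC 0).
  { intros v a Hv. generalize (Cconj_neq_0 _ (NR v a Hv)). now rewrite Cminus_conj, Cconj_RtoC. }
  assert (D1 : (w - Cconj z)%C <> RtoC 0).
  { apply UHP_neq_0. unfold UHP in *. destruct z, w; simpl in *; lra. }
  assert (D2 : (Cconj w - z)%C <> RtoC 0).
  { generalize (Cconj_neq_0 _ D1). now rewrite Cminus_conj, Cconj_conj. }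
  set (c := ((w - z) / (w - Cconj z))%C).
  assert (Ec : Cconj c = ((Cconj w - Cconj z) / (Cconj w - z))%C).
  { unfold c. rewrite Cdiv_conj, !Cminus_conj, Cconj_conj; auto. }
  set (cb := Cconj c) in *.
  set (r2 := Re c * Re c + Im c * Im c).
  assert (Hr2 : RtoC r2 = (c * cb)%C).
  { unfold r2, cb. destruct c; apply C_ext; simpl; ring. }
  assert (Hr21 : r2 < 1).
  { assert (L : Cmod (w - z) * Cmod (w - z) < Cmod (w - Cconj z) * Cmod (w - Cconj z)).
    { rewrite !Cmod_sqr. unfold UHP in *. destruct z, w; simpl in *. nra. }
    unfold r2. rewrite <- Cmod_sqr. unfold c. rewrite Cmod_div by auto.
    generalize (Cmod_pos _ D1). intros P.
    apply Rmult_lt_reg_r with (Cmod (w - Cconj z) * Cmod (w - Cconj z)); [nra|].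
    unfold Rdiv.
    replace (Cmod (w - z) * / Cmod (w - Cconj z) * (Cmod (w - z) * / Cmod (w - Cconj z)) *
      (Cmod (w - Cconj z) * Cmod (w - Cconj z))) with (Cmod (w - z) * Cmod (w - z)).
    - lra.
    - field. lra. }
  assert (Dz : (z - Cconj z)%C <> RtoC 0).
  { apply UHP_neq_0. unfold UHP in *. destruct z; simpl in *; lra. }
  assert (Dw : (w - Cconj w)%C <> RtoC 0).
  { apply UHP_neq_0. unfold UHP in *. destruct w; simpl in *; lra. }
  (* Multiplication by conj c turns the geodesic from 0 to c into the real direction. The point at
     infinity, sent to 1, contributes [cb] itself. *)
  set (ze := fun a : R => (cb * ((a - z) / (a - Cconj z)))%C).
  assert (Mze : forall a, Re (ze a) * Re (ze a) + Im (ze a) * Im (ze a) = r2).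
  { intros a. rewrite <- Cmod_sqr. unfold ze, cb. rewrite Cmod_mult, Cmod_conj, Cmod_div by auto.
    replace (Cmod (a - Cconj z)) with (Cmod (a - z)).
    - unfold r2. rewrite <- Cmod_sqr. field. apply Rgt_not_eq, Cmod_pos; auto.
    - rewrite <- Cmod_conj, Cminus_conj, Cconj_RtoC. reflexivity. }
  assert (Mcb : Re cb * Re cb + Im cb * Im cb = r2).
  { unfold r2, cb. destruct c; simpl; ring. }
  set (mu := (cb * ((1 - c) / (1 - cb)))%C).
  assert (D1cb : (1 - cb)%C <> RtoC 0).
  { rewrite Ec. intros H. apply Dz.
    replace (z - Cconj z)%C with (- ((1 - (Cconj w - Cconj z) / (Cconj w - z)) * (Cconj w - z)))%C.
    rewrite H. ring. field. auto. }
  (* For zeta = cb b the left side is cb times (b - c) / (1 - cb b), the disc automorphism that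
     moves c to 0. It differs from the Cayley transform at w by a constant factor, read off at a =
     infinity, where b = 1. *)
  assert (T : forall a : R, ((ze a - r2) / (1 - ze a))%C = (mu * ((a - w) / (a - Cconj w)))%C).
  { intros a.
    assert (D : (1 - ze a)%C <> RtoC 0).
    { intros H. generalize (Mze a). replace (ze a) with (RtoC 1 - (1 - ze a))%C by ring.
      rewrite H. simpl. lra. }
    rewrite Hr2. unfold mu. unfold ze in *. rewrite Ec in *. unfold c in *.
    generalize (NR z a Hz) (NR w a Hw) (NR' z a Hz) (NR' w a Hw).
    clear - D D1 D2 Dz Dw D1cb.
    set (Z := Cconj z) in *. set (W := Cconj w) in *. intros.
    assert (DD : ((W - z) * (a - Z) - (W - Z) * (a - z))%C <> RtoC 0).
    { intros E. apply D.
      replace (1 - (W - Z) / (W - z) * ((a - z) / (a - Z)))%C with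
       (((W - z) * (a - Z) - (W - Z) * (a - z)) / ((W - z) * (a - Z)))%C by (field; auto).
      rewrite E. field; auto. }
    assert (DE : (W - z - (W - Z))%C <> RtoC 0).
    { intros E. apply Dz. replace (z - Z)%C with (- (W - z - (W - Z)))%C by ring. rewrite E; ring. }
    field. repeat split; auto. }
  assert (S1 : (alpha * ze 0 + beta * ze 1%R + gamma * ze t + delta * cb)%C = RtoC 0).
  { unfold ze. match type of Sz with ?L = _ => transitivity (cb * L)%C end; [ring|].
    rewrite Sz. ring. }
  assert (S2 : (alpha * ((ze 0%R - r2) / (1 - ze 0%R)) + beta * ((ze 1%R - r2) / (1 - ze 1%R)) +
    gamma * ((ze t - r2) / (1 - ze t)) + delta * ((cb - r2) / (1 - cb)))%C = RtoC 0).
  { rewrite !T. match type of Sw with ?L = _ => transitivity (mu * L)%C end; [|rewrite Sw; ring].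
    replace ((cb - r2) / (1 - cb))%C with mu; [ring|].
    rewrite Hr2. unfold mu. field. auto. }
  destruct (busemann_convex (ze 0%R) r2 (Mze _) Hr21) as [k0 [K0 B0]].
  destruct (busemann_convex (ze 1%R) r2 (Mze _) Hr21) as [k1 [K1 B1]].
  destruct (busemann_convex (ze t) r2 (Mze _) Hr21) as [k2 [K2 B2]].
  destruct (busemann_convex cb r2 Mcb Hr21) as [k3 [K3 B3]].
  apply (f_equal Re) in S1. apply (f_equal Re) in S2.
  assert (ReP : forall a b, Re (a + b)%C = Re a + Re b) by (intros [] []; reflexivity).
  assert (ReM : forall (x : R) (v : C), Re (x * v)%C = x * Re v) by (intros x []; simpl; ring).
  rewrite !ReP, !ReM in S1, S2. change (Re (RtoC 0)) with 0 in S1, S2.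
  (* The difference of the two real parts is a positively weighted sum of squares equal to 0, so
     every zeta is real. *)
  assert (Z0 : alpha * (k0 * (Im (ze 0) * Im (ze 0))) + beta * (k1 * (Im (ze 1) * Im (ze 1))) +
    gamma * (k2 * (Im (ze t) * Im (ze t))) + delta * (k3 * (Im cb * Im cb)) = 0).
  { rewrite <- B0, <- B1, <- B2, <- B3. lra. }
  assert (pos : forall x k q, 0 < x < 1 -> 0 < k -> 0 <= x * (k * (q * q))).
  { intros. apply Rmult_le_pos; [lra|]. apply Rmult_le_pos; [lra|]. apply Rle_0_sqr. }
  assert (zero : forall x k q, 0 < x < 1 -> 0 < k -> x * (k * (q * q)) = 0 -> q = 0).
  { intros x k q Hx Hk H. apply Rmult_integral in H. destruct H as [H|H]; [lra|].
    apply Rmult_integral in H. destruct H as [H|H]; [lra|]. apply Rsqr_eq_0. exact H. }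
  generalize (pos _ _ (Im (ze 0)) ha K0) (pos _ _ (Im (ze 1)) hb K1)
    (pos _ _ (Im (ze t)) hg K2) (pos _ _ (Im cb) hd K3). intros P0 P1 P2 P3.
  assert (I0 : Im (ze 0) = 0) by (apply (zero alpha k0); auto; lra).
  assert (I1 : Im (ze 1) = 0) by (apply (zero beta k1); auto; lra).
  assert (I3 : Im cb = 0) by (apply (zero delta k3); auto; lra).
  (* Since cb is real, a real zeta means cb = 0 or a real Cayley image, and for finite a the latter
     is -1, attained at a = Re z. The points 0 and 1 cannot both equal Re z. *)
  assert (Q : forall a : R, Im (ze a) = 0 -> Re cb = 0 \/ Re z = a).
  { intros a Ha. unfold ze in Ha.
    assert (Hn : 0 < (a - Re z) * (a - Re z) + Im z * Im z).
    { unfold UHP in Hz. generalize (Rle_0_sqr (a - Re z)). unfold Rsqr. nra. }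
    assert (E : Im (cb * ((a - z) / (a - Cconj z))) =
      - 2 * Re cb * ((a - Re z) * Im z) / ((a - Re z) * (a - Re z) + Im z * Im z)).
    { destruct cb as [c1 c2], z as [x y]. simpl in I3, Hn |- *. rewrite I3. field.
      replace ((a + - x) * ((a + - x) * 1) + (0 + - - y) * ((0 + - - y) * 1)) with
        ((a - x) * (a - x) + y * y) by ring.
      lra. }
    rewrite E in Ha. apply Rmult_integral in Ha. destruct Ha as [Ha|Ha].
    - apply Rmult_integral in Ha. destruct Ha as [Ha|Ha]; [left; lra|].
      apply Rmult_integral in Ha. unfold UHP in Hz. right. lra.
    - exfalso. generalize (Rinv_neq_0_compat _ (Rgt_not_eq _ _ Hn)). lra. }
  assert (Rc : Re cb = 0) by (destruct (Q 0 I0), (Q 1 I1); lra).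
  assert (cb0 : cb = RtoC 0) by (apply C_ext; simpl; auto).
  assert (c0 : c = RtoC 0).
  { rewrite <- (Cconj_conj c). fold cb. rewrite cb0. apply Cconj_RtoC. }
  unfold c in c0. assert (X : (w - z)%C = RtoC 0).
  { replace (w - z)%C with ((w - z) / (w - Cconj z) * (w - Cconj z))%C by (field; auto).
    rewrite c0. ring. }
  replace w with (w - z + z)%C by ring. rewrite X. ring.
Qed.
End PoleLocation.

(** * The integrand and its primitive *)

Definition rec (a z : C) : C := / (z - a).

Lemma cder_rec D a z : z <> a -> cder D (rec a) z (- (rec a z * rec a z)).
Proof.
  intros N. unfold rec. assert (Hz : (z - a)%C <> RtoC 0) by now apply Cminus_eq_contra.
  apply cder_unique_val with (- (1 - 0) / ((z - a) * (z - a)))%C; [field; auto|].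
  apply (cder_inv D (fun w => w - a)%C); auto. apply cder_minus; [apply cder_id|apply cder_const].
Qed.

Lemma UHP_neq_R z (a : R) : UHP z -> z <> RtoC a.
Proof. unfold UHP. intros H ->. simpl in H. lra. Qed.

Lemma closed_UHP_neq_conj z w : closed_UHP z -> UHP w -> z <> Cconj w.
Proof. unfold UHP, closed_UHP. intros H1 H2 ->. destruct w; simpl in *. lra. Qed.

Section Integrand.
Variables alpha beta gamma delta t : R.
Hypotheses (ha : 0 < alpha < 1) (hb : 0 < beta < 1) (hg : 0 < gamma < 1)
  (hd : 0 < delta < 1) (hsum : alpha + beta + gamma + delta = 2) (ht : 1 < t).
Variable z0 : C.
Hypotheses (hz0 : UHP z0) (hE : z0_equation alpha beta gamma t z0).

Let g := integrand alpha beta gamma t z0.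

Definition numer (x : C) : C :=
  (Cpower x alpha * Cpower_low (1 - x) beta * Cpower_low (1 - x / t) gamma)%C.

(** The function Phi: the double pole at z0 is split off, while the one at conj z0, outside the
    closed upper half-plane, stays inside. *)
Definition regular_part (x : C) : C :=
  (numer x * (Cconj z0 * Cconj z0 * (rec (Cconj z0) x * rec (Cconj z0) x)))%C.

Lemma t_neq_0 : RtoC t <> RtoC 0.
Proof. apply RtoC_neq_0; lra. Qed.

Lemma integrand_eq x : x <> z0 -> x <> Cconj z0 ->
  integrand alpha beta gamma t z0 x = (regular_part x * (z0 * z0 * (rec z0 x * rec z0 x)))%C.
Proof.
  intros N1 N2. unfold integrand, regular_part, rec. fold (numer x).
  assert (A := UHP_neq_0 _ hz0). assert (B := Cconj_neq_0 _ A).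
  assert (D1 := Cminus_eq_contra _ _ N1). assert (D2 := Cminus_eq_contra _ _ N2).
  assert (E1 : (1 - x / z0)%C = (- ((x - z0) / z0))%C) by (field; auto).
  assert (E2 : (1 - x / Cconj z0)%C = (- ((x - Cconj z0) / Cconj z0))%C) by (field; auto).
  rewrite E1, E2. simpl. field. auto.
Qed.

Lemma LHP_shift x (c : R) : 0 < c -> closed_UHP x -> closed_LHP (1 - x / c).
Proof.
  unfold closed_UHP, closed_LHP. intros Hc Hx.
  replace (x / c)%C with (RtoC (/ c) * x)%C.
  - destruct x as [u v]; simpl in *.
    assert (0 <= / c * v) by (apply Rmult_le_pos; auto; left; now apply Rinv_0_lt_compat). lra.
  - rewrite RtoC_inv by lra. unfold Cdiv. ring.
Qed.

Lemma one_minus_LHP x : closed_UHP x -> closed_LHP (1 - x).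
Proof. unfold closed_UHP, closed_LHP. destruct x; simpl. lra. Qed.

Lemma clim_numer p : closed_UHP p -> clim (nb closed_UHP p) numer (numer p).
Proof.
  intros Hp. unfold numer. repeat apply clim_mult.
  - apply clim_Cpower; auto. lra.
  - apply (clim_comp _ (fun x => 1 - x)%C (fun w => Cpower_low w beta) closed_LHP (1 - p)%C).
    + apply clim_minus; [apply clim_const|apply clim_id].
    + generalize (nb_domain closed_UHP p). apply filter_imp. apply one_minus_LHP.
    + apply clim_Cpower_low; [lra|now apply one_minus_LHP].
  - apply (clim_comp _ (fun x => 1 - x / t)%C (fun w => Cpower_low w gamma) closed_LHP (1 - p / t)%C).
    + apply clim_minus; [apply clim_const|]. apply clim_mult; [apply clim_id|apply clim_const].
    + generalize (nb_domain closed_UHP p). apply filter_imp. intros w. apply LHP_shift. lra.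
    + apply clim_Cpower_low; [lra|apply LHP_shift; auto; lra].
Qed.

Lemma cder_numer z : UHP z ->
  cder everywhere numer z (numer z * (alpha * rec 0 z + beta * rec 1 z + gamma * rec t z)).
Proof.
  intros Hz. apply (cder_UHP UHP); auto. unfold numer.
  assert (Hc := UHP_closed _ Hz).
  assert (N0 := UHP_neq_R _ 0 Hz). assert (N1 := UHP_neq_R _ 1 Hz). assert (Nt := UHP_neq_R _ t Hz).
  assert (N1' : (1 - z)%C <> RtoC 0) by (apply Cminus_eq_contra; congruence).
  assert (Ntz : (t - z)%C <> RtoC 0) by (apply Cminus_eq_contra; congruence).
  assert (T := t_neq_0).
  assert (Nt' : (1 - z / t)%C <> RtoC 0).
  { replace (1 - z / t)%C with ((t - z) / t)%C by (field; auto).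
    intros E. apply Ntz. replace (t - z)%C with ((t - z) / t * t)%C by (field; auto).
    rewrite E. ring. }
  eapply cder_unique_val; [|apply cder_mult; [apply cder_mult|]].
  2: { apply (cder_mono closed_UHP); [apply UHP_closed|]. now apply cder_Cpower. }
  2: { apply (cder_comp _ closed_LHP (fun x => 1 - x)%C (fun w => Cpower_low w beta)).
       - apply cder_minus; [apply cder_const|apply cder_id].
       - apply cder_Cpower_low; auto. now apply one_minus_LHP.
       - generalize (nb_domain UHP z). apply filter_imp. intros w Hw. now apply one_minus_LHP, UHP_closed. }
  2: { apply (cder_comp _ closed_LHP (fun x => 1 - x / t)%C (fun w => Cpower_low w gamma)).
       - apply cder_minus; [apply cder_const|].
         apply (cder_mult UHP (fun x => x) (fun _ => / t)%C); [apply cder_id|apply cder_const].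
       - apply cder_Cpower_low; auto. apply LHP_shift; auto; lra.
       - generalize (nb_domain UHP z). apply filter_imp. intros w Hw.
         apply LHP_shift; [lra|now apply UHP_closed]. }
  unfold rec. field.
  assert (Z1 := Cminus_eq_contra _ _ N1). assert (Zt := Cminus_eq_contra _ _ Nt).
  assert (Z0 : (z - 0)%C <> RtoC 0) by now apply Cminus_eq_contra.
  repeat split; auto.
Qed.

Definition logder (x : C) : C :=
  (alpha * rec 0 x + beta * rec 1 x + gamma * rec t x - 2 * rec (Cconj z0) x)%C.

(** The quotient of [logder] by x - z0, divided out term by term with 1/(x - a) - 1/(z0 - a) = -(x -
    z0) / ((x - a)(z0 - a)), so that it is holomorphic at z0 by inspection. *)
Definition logder_slope (x : C) : C :=
  (alpha * rec 0 z0 * - rec 0 x + beta * rec 1 z0 * - rec 1 x + gamma * rec t z0 * - rec t x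
   + 2 * rec (Cconj z0) z0 * rec (Cconj z0) x)%C.

Definition logder_slope' (x : C) : C :=
  (alpha * rec 0 z0 * - - (rec 0 x * rec 0 x) + beta * rec 1 z0 * - - (rec 1 x * rec 1 x)
   + gamma * rec t z0 * - - (rec t x * rec t x)
   + 2 * rec (Cconj z0) z0 * - (rec (Cconj z0) x * rec (Cconj z0) x))%C.

Lemma UHP_neq_conj z : UHP z -> z <> Cconj z0.
Proof. intros H. apply closed_UHP_neq_conj; auto. now apply UHP_closed. Qed.

Lemma cder_regular_part z : UHP z -> cder everywhere regular_part z (regular_part z * logder z).
Proof.
  intros Hz. unfold regular_part.
  eapply cder_unique_val; [|apply cder_mult; [now apply cder_numer|]].
  2: { apply cder_scal. apply cder_mult; apply cder_rec; now apply UHP_neq_conj. }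
  unfold logder. ring.
Qed.

(* The equation for z0 says that the logarithmic derivative of the regular
   part vanishes at z0, so the 1/(x - z0) term of the integrand is absent. *)
Lemma logder_z0 : logder z0 = 0%C.
Proof.
  unfold logder, rec. unfold z0_equation in hE.
  replace (z0 - 0)%C with z0 by ring.
  replace (alpha * / z0 + beta * / (z0 - 1) + gamma * / (z0 - t))%C
    with (alpha / z0 + beta / (z0 - 1) + gamma / (z0 - t))%C by reflexivity.
  rewrite hE.
  assert (Z : (z0 - Cconj z0)%C = (2 * Ci * Im z0)%C) by (destruct z0; apply C_ext; simpl; ring).
  rewrite Z.
  assert (RtoC (Im z0) <> RtoC 0) by (apply RtoC_neq_0; unfold UHP in hz0; lra).
  assert (Nci := Ci_nz).
  field. split; auto.
Qed.

Lemma logder_factor x : UHP x -> logder x = ((x - z0) * logder_slope x)%C.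
Proof.
  intros Hx. rewrite <- (Cplus_0_r (logder x)).
  replace (RtoC 0) with (- logder z0)%C by (rewrite logder_z0; ring).
  unfold logder, logder_slope, rec.
  assert (A0 := Cminus_eq_contra _ _ (UHP_neq_R _ 0 Hx)). assert (A1 := Cminus_eq_contra _ _ (UHP_neq_R _ 1 Hx)).
  assert (At := Cminus_eq_contra _ _ (UHP_neq_R _ t Hx)).
  assert (B0 := Cminus_eq_contra _ _ (UHP_neq_R _ 0 hz0)). assert (B1 := Cminus_eq_contra _ _ (UHP_neq_R _ 1 hz0)).
  assert (Bt := Cminus_eq_contra _ _ (UHP_neq_R _ t hz0)).
  assert (Ac := Cminus_eq_contra _ _ (UHP_neq_conj _ Hx)). assert (Bc := Cminus_eq_contra _ _ (UHP_neq_conj _ hz0)).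
  field. repeat split; auto; now apply UHP_neq_0.
Qed.

Lemma cder_logder_slope x : UHP x -> cder everywhere logder_slope x (logder_slope' x).
Proof.
  intros Hx. unfold logder_slope, logder_slope'.
  repeat apply cder_plus; apply cder_scal; try apply cder_opp; apply cder_rec;
    try (now apply UHP_neq_R); now apply UHP_neq_conj.
Qed.

Lemma clim_rec D a x : x <> a -> clim (nb D x) (rec a) (rec a x).
Proof. intros N. apply (cder_cont _ _ _ _ (cder_rec D a x N)). Qed.

(** The derivative prescribed here is Phi'(z) / (z - z0) with the division carried out. *)
Lemma correction_exists : exists K, forall z, UHP z ->
  cder everywhere K z (regular_part z * logder_slope z).
Proof.
  apply (star_primitive (fun z => regular_part z * logder_slope z)%C
    (fun z => regular_part z * logder z * logder_slope z + regular_part z * logder_slope' z)%C z0); auto.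
  - intros z Hz. apply cder_mult; [now apply cder_regular_part|now apply cder_logder_slope].
  - intros z Hz.
    assert (R0 := clim_rec everywhere _ _ (UHP_neq_R _ 0 Hz)).
    assert (R1 := clim_rec everywhere _ _ (UHP_neq_R _ 1 Hz)).
    assert (Rt := clim_rec everywhere _ _ (UHP_neq_R _ t Hz)).
    assert (Rc := clim_rec everywhere _ _ (UHP_neq_conj _ Hz)).
    assert (P := cder_cont _ _ _ _ (cder_regular_part z Hz)).
    assert (S := cder_cont _ _ _ _ (cder_logder_slope z Hz)).
    apply clim_plus; apply clim_mult; auto; [apply clim_mult; auto|].
    + unfold logder.
      repeat (first [apply clim_minus|apply clim_plus]); apply clim_mult; auto; apply clim_const.
    + unfold logder_slope'. repeat apply clim_plus; (apply clim_mult; [apply clim_const|]);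
        repeat apply clim_opp; apply clim_mult; auto.
Qed.

Lemma clim_integrand p : closed_UHP p -> p <> z0 -> clim (nb closed_UHP p) g (g p).
Proof.
  intros Hp N.
  assert (Np : p <> Cconj z0) by now apply closed_UHP_neq_conj.
  unfold g. rewrite integrand_eq by auto.
  apply (clim_ext (fun x => regular_part x * (z0 * z0 * (rec z0 x * rec z0 x)))%C).
  - generalize (nb_domain closed_UHP p) (clim_id closed_UHP p _ (Cmod_minus_pos _ _ N)).
    intros H1 H2. generalize (filter_and _ _ H1 H2). apply filter_imp. intros w [Hw1 Hw2].
    rewrite integrand_eq; auto.
    + intros ->. rewrite Cmod_minus_sym in Hw2. lra.
    + now apply closed_UHP_neq_conj.
  - unfold regular_part. apply clim_mult; [apply clim_mult; [now apply clim_numer|]|];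
      repeat apply clim_mult; try apply clim_const; now apply clim_rec.
Qed.

Lemma neq_open (a : C) D p : p <> a -> nb D p (fun z => z <> a).
Proof.
  intros N. generalize (clim_id D p _ (Cmod_minus_pos _ _ N)). apply filter_imp.
  intros w Hw ->. rewrite Cmod_minus_sym in Hw. lra.
Qed.

Lemma numer_neq_0 z : UHP z -> numer z <> 0%C.
Proof.
  intros Hz. unfold numer.
  assert (N0 := UHP_neq_0 _ Hz).
  assert (N1 : (1 - z)%C <> RtoC 0) by (apply Cminus_eq_contra, not_eq_sym; now apply UHP_neq_R).
  assert (Nt : (1 - z / t)%C <> RtoC 0).
  { assert (T := t_neq_0). intros E. apply (UHP_neq_R _ t Hz).
    replace z with (t - t * (1 - z / t))%C by (field; auto). rewrite E. ring. }
  repeat apply Cmult_neq_0; try apply Cpower_low_neq_0; auto. now apply Cpower_neq_0.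
Qed.

Lemma rec_neq_0 a z : z <> a -> rec a z <> RtoC 0.
Proof. intros N. apply Cinv_neq_0. now apply Cminus_eq_contra. Qed.

Lemma regular_part_neq_0 z : UHP z -> regular_part z <> 0%C.
Proof.
  intros Hz. assert (B := Cconj_neq_0 _ (UHP_neq_0 _ hz0)).
  assert (I := rec_neq_0 _ _ (UHP_neq_conj _ Hz)).
  assert (N := numer_neq_0 _ Hz).
  unfold regular_part. apply Cmult_neq_0; [auto|]. repeat apply Cmult_neq_0; auto.
Qed.

Lemma integrand_neq_0 z : UHP z -> z <> z0 -> g z <> 0%C.
Proof.
  intros Hz N. unfold g. rewrite integrand_eq; [|auto|now apply UHP_neq_conj].
  assert (N0 := UHP_neq_0 _ hz0). assert (R := regular_part_neq_0 _ Hz). assert (I := rec_neq_0 _ _ N).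
  apply Cmult_neq_0; [auto|]. repeat apply Cmult_neq_0; auto.
Qed.

Lemma primitive_UHP : exists F, (forall z, UHP z -> z <> z0 -> cder everywhere F z (g z)) /\
  clim (nb (fun z => UHP z /\ z <> z0) z0) (fun z => (z - z0) * F z)%C (- (z0 * z0 * regular_part z0))%C.
Proof.
  destruct correction_exists as [K HK].
  (* In the derivative of K - Phi / (z - z0) the terms Phi' / (z - z0) cancel and Phi / (z - z0)^2
     remains. *)
  exists (fun z => z0 * z0 * (K z - regular_part z * rec z0 z))%C. split.
  - intros z Hz N. unfold g. rewrite integrand_eq; [|auto|now apply UHP_neq_conj].
    eapply cder_unique_val; [|apply cder_scal, cder_minus; [now apply HK|apply cder_mult]].
    2: now apply cder_regular_part. 2: now apply cder_rec.
    rewrite logder_factor by auto. unfold rec. assert (D := Cminus_eq_contra _ _ N). field. auto.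
  - apply (clim_ext (fun z => z0 * z0 * ((z - z0) * K z - regular_part z))%C).
    + generalize (nb_domain (fun z => UHP z /\ z <> z0) z0). apply filter_imp.
      intros w [_ N]. unfold rec. assert (D := Cminus_eq_contra _ _ N). field. auto.
    + assert (M : forall P, nb everywhere z0 P -> nb (fun z => UHP z /\ z <> z0) z0 P).
      { intros P. apply nb_mono. intros; exact I. }
      assert (E : (z0 * z0 * ((z0 - z0) * K z0 - regular_part z0))%C = (- (z0 * z0 * regular_part z0))%C) by ring.
      rewrite <- E.
      apply (clim_mono _ _ _ _ M).
      apply clim_mult; [apply clim_const|]. apply clim_minus; [apply clim_mult|].
      * apply clim_minus; [apply clim_id|apply clim_const].
      * apply (cder_cont _ _ _ _ (HK z0 hz0)).
      * apply (cder_cont _ _ _ _ (cder_regular_part z0 hz0)).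
Qed.

(** Needed besides the behaviour of the primitive in order that the derivative of 1/f be continuous
    at z0, which local inversion at the pole requires. *)
Lemma integrand_pole : clim (nb (fun z => UHP z /\ z <> z0) z0)
  (fun z => (z - z0) * (z - z0) * g z)%C (z0 * z0 * regular_part z0)%C.
Proof.
  apply (clim_ext (fun z => z0 * z0 * regular_part z)%C).
  - generalize (nb_domain (fun z => UHP z /\ z <> z0) z0). apply filter_imp.
    intros w [Hw N]. unfold g. rewrite integrand_eq; [|auto|now apply UHP_neq_conj].
    unfold rec. assert (D := Cminus_eq_contra _ _ N). field. auto.
  - apply (clim_mono (nb everywhere z0)).
    + intros P. apply nb_mono. intros; exact I.
    + apply clim_mult; [apply clim_const|].
      apply (cder_cont _ _ _ _ (cder_regular_part z0 hz0)).
Qed.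
End Integrand.

(** * The integrand and its primitive near infinity *)

Lemma inv_UHP y : UHP y -> UHP (- / y).
Proof.
  intros Hy. assert (N := UHP_neq_0 _ Hy). assert (P := Cmod_pos _ N).
  unfold UHP in *.
  assert (E : Im (- / y) = Im y / (Cmod y * Cmod y)).
  { generalize (Cmod_sqr y). intros E. rewrite E. destruct y as [u v]. simpl in *. field. nra. }
  rewrite E. apply Rdiv_lt_0_compat; nra.
Qed.

Lemma inv_closed_UHP y : closed_UHP y -> y <> RtoC 0 -> closed_UHP (- / y).
Proof.
  intros Hy N. assert (P := Cmod_pos _ N).
  unfold closed_UHP in *.
  assert (P2 : 0 < Cmod y * Cmod y) by now apply Rmult_lt_0_compat.
  assert (E : Im (- / y) = Im y / (Cmod y * Cmod y)).
  { generalize (Cmod_sqr y). intros E. rewrite E. rewrite E in P2. destruct y as [u v]. simpl in *. field. nra. }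
  rewrite E. apply Rmult_le_pos; auto. left. now apply Rinv_0_lt_compat.
Qed.

Section Infinity.
Variables alpha beta gamma delta t : R.
Hypotheses (ha : 0 < alpha < 1) (hb : 0 < beta < 1) (hg : 0 < gamma < 1)
  (hd : 0 < delta < 1) (hsum : alpha + beta + gamma + delta = 2) (ht : 1 < t).
Variable z0 : C.
Hypotheses (hz0 : UHP z0) (hE : z0_equation alpha beta gamma t z0).

Let g := integrand alpha beta gamma t z0.

Lemma Rpower_le_base (a x y : R) : 0 < a -> 0 < x <= y -> Rpower x a <= Rpower y a.
Proof. intros Ha Hxy. apply Rle_Rpower_l; lra. Qed.

(** The numerator grows like |x|^(2 - delta) and the denominator like |x|^4, so the product with
    |x|^2 is of order |x|^(-delta). *)
Lemma integrand_infinity e : 0 < e -> exists M, 0 < M /\ forall x, closed_UHP x -> M < Cmod x ->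
  Cmod (g x) * (Cmod x * Cmod x) < e.
Proof.
  intros He.
  assert (A := UHP_neq_0 _ hz0). assert (Pz := Cmod_pos _ A).
  set (m := Cmod z0) in *.
  (* With r = |x| large, |1 - x| and |1 - x/t| are at most 2 r, and |1 - x/z0| and its conjugate are
     at least r / (2 m); K collects these constants. *)
  set (K := Rpower 2 beta * Rpower 2 gamma * (2 * m) ^ 4).
  assert (HK : 0 < K).
  { unfold K. apply Rmult_lt_0_compat; [apply Rmult_lt_0_compat; apply exp_pos|].
    apply pow_lt. lra. }
  assert (HeK : 0 < e / K) by (apply Rdiv_lt_0_compat; lra).
  destruct (Rpower_small delta (e / K)) as [d [Hd0 Hd1]]; [lra|auto|].
  set (M := Rmax (Rmax (2 * t) (2 * m)) (/ d)).
  assert (M1 : 2 * t <= M) by (unfold M; eapply Rle_trans; [apply Rmax_l|apply Rmax_l]).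
  assert (M2 : 2 * m <= M) by (unfold M; eapply Rle_trans; [apply Rmax_r|apply Rmax_l]).
  assert (M3 : / d <= M) by apply Rmax_r.
  exists M. split; [lra|]. intros x Hx Hr. set (r := Cmod x) in *.
  assert (Nx : x <> RtoC 0) by (intros E; unfold r in Hr; rewrite E, Cmod_0 in Hr; lra).
  assert (T := RtoC_neq_0 t ltac:(lra)).
  assert (B1 : 0 < Cmod (1 - x) <= 2 * r).
  { split.
    - generalize (Cmod_sub_ge x 1). rewrite Cmod_1, Cmod_minus_sym. fold r. lra.
    - generalize (Cmod_sub_le 1 x). rewrite Cmod_1. fold r. lra. }
  assert (Bt0 : Cmod (x / t) = r / t).
  { rewrite Cmod_div by auto. rewrite (Cmod_nonneg_R t) by lra. reflexivity. }
  assert (Bt1 : 2 <= r / t <= r).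
  { split; apply Rmult_le_reg_r with t; try lra; unfold Rdiv; rewrite Rmult_assoc, Rinv_l by lra; nra. }
  assert (Bt : 0 < Cmod (1 - x / t) <= 2 * r).
  { split.
    - generalize (Cmod_sub_ge (x / t) 1). rewrite Cmod_1, Cmod_minus_sym. lra.
    - generalize (Cmod_sub_le 1 (x / t)). rewrite Cmod_1. lra. }
  assert (lowz : forall w, Cmod w = m -> w <> RtoC 0 -> r / (2 * m) <= Cmod (1 - x / w)).
  { intros w Hw Nw. generalize (Cmod_sub_ge (x / w) 1). rewrite Cmod_1, Cmod_minus_sym, Cmod_div, Hw by auto.
    fold r. assert (2 <= r / m).
    { apply Rmult_le_reg_r with m; try lra; unfold Rdiv; rewrite Rmult_assoc, Rinv_l by lra; lra. }
    replace (r / (2 * m)) with (r / m / 2) by (field; lra). lra. }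
  assert (L1 := lowz z0 eq_refl A).
  assert (L2 := lowz (Cconj z0) (Cmod_conj z0) (Cconj_neq_0 _ A)).
  assert (Q : 0 < r / (2 * m)) by (apply Rdiv_lt_0_compat; lra).
  assert (Nz1 : forall w, r / (2 * m) <= Cmod w -> w <> RtoC 0).
  { intros w Hw E. rewrite E, Cmod_0 in Hw. lra. }
  assert (N1 : (1 - x)%C <> RtoC 0) by (intros E; rewrite E, Cmod_0 in B1; lra).
  assert (Nt : (1 - x / t)%C <> RtoC 0) by (intros E; rewrite E, Cmod_0 in Bt; lra).
  unfold g, integrand.
  rewrite Cmod_div by (apply Cmult_neq_0; apply Cpow_nz; auto).
  rewrite !Cmod_mult, !Cmod_pow, Cmod_Cpower, !Cmod_Cpower_low by auto.
  fold r.
  set (d1 := Cmod (1 - x / z0)) in *. set (d2 := Cmod (1 - x / Cconj z0)) in *.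
  set (q := r / (2 * m)) in *.
  assert (P1 : Rpower (Cmod (1 - x)) beta <= Rpower 2 beta * Rpower r beta).
  { rewrite Rpower_mult_distr by lra. apply Rpower_le_base; lra. }
  assert (P2 : Rpower (Cmod (1 - x / t)) gamma <= Rpower 2 gamma * Rpower r gamma).
  { rewrite Rpower_mult_distr by lra. apply Rpower_le_base; lra. }
  assert (D : q ^ 4 <= d1 ^ 2 * d2 ^ 2).
  { replace (q ^ 4) with (q ^ 2 * q ^ 2) by ring.
    apply Rmult_le_compat; try (apply pow_le; lra); apply pow_incr; lra. }
  assert (Dq : 0 < q ^ 4) by (apply pow_lt; lra).
  assert (Num : Rpower r alpha * Rpower (Cmod (1 - x)) beta * Rpower (Cmod (1 - x / t)) gamma
    <= Rpower r alpha * (Rpower 2 beta * Rpower r beta) * (Rpower 2 gamma * Rpower r gamma)).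
  { apply Rmult_le_compat; try (left; apply exp_pos); auto.
    - left; apply Rmult_lt_0_compat; apply exp_pos.
    - apply Rmult_le_compat_l; auto. left; apply exp_pos. }
  assert (Fin : Rpower r alpha * (Rpower 2 beta * Rpower r beta) * (Rpower 2 gamma * Rpower r gamma)
     / q ^ 4 * (r * r) = K * Rpower (/ r) delta).
  { assert (Rd : Rpower (/ r) delta = Rpower r alpha * Rpower r beta * Rpower r gamma / (r * r)).
    { replace (r * r) with (Rpower r 2).
      - unfold Rdiv. rewrite <- Rpower_Ropp, <- !Rpower_plus.
        replace (alpha + beta + gamma + - (2)) with (- delta) by lra.
        rewrite Rpower_Ropp. unfold Rpower. rewrite ln_Rinv by lra.
        rewrite <- exp_Ropp. f_equal. ring.
      - replace 2 with (1 + 1) by ring. rewrite Rpower_plus, Rpower_1; lra. }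
    rewrite Rd. unfold K, q. field. split; lra. }
  apply Rle_lt_trans with (K * Rpower (/ r) delta).
  - rewrite <- Fin. apply Rmult_le_compat_r; [nra|].
    apply Rmult_le_compat; auto.
    + left. repeat apply Rmult_lt_0_compat; apply exp_pos.
    + left. apply Rinv_0_lt_compat. lra.
    + apply Rinv_le_contravar; lra.
  - apply Rmult_lt_reg_l with (/ K); [now apply Rinv_0_lt_compat|].
    rewrite <- Rmult_assoc, Rinv_l, Rmult_1_l by lra.
    rewrite Rmult_comm. apply Hd1. split.
    + apply Rinv_0_lt_compat; lra.
    + rewrite <- (Rinv_inv d). apply Rinv_lt_contravar; [|lra].
      apply Rmult_lt_0_compat; [now apply Rinv_0_lt_compat|lra].
Qed.

(* Infinity becomes the boundary point 0 in the coordinate y = - 1 / x, in which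
   the integrand [g (- 1 / y) / y ^ 2] tends to 0. *)
Lemma primitive_exists : exists (H : C -> C) (L A : C), A <> RtoC 0 /\ H 0%C = RtoC 0 /\
  (forall p, closed_UHP p -> p <> z0 -> cder closed_UHP H p (g p)) /\
  (forall e, 0 < e -> exists M, forall z, closed_UHP z -> M < Cmod z -> Cmod (H z - L) < e) /\
  clim (nb (fun z => UHP z /\ z <> z0) z0) (fun z => (z - z0) * H z)%C A /\
  clim (nb (fun z => UHP z /\ z <> z0) z0) (fun z => (z - z0) * (z - z0) * g z)%C (- A)%C.
Proof.
  destruct (primitive_UHP alpha beta gamma t ha ht z0 hz0 hE) as [F [HF1 HF2]].
  generalize (integrand_pole alpha beta gamma t ha ht z0 hz0). fold g in HF1 |- *.
  intros HG2.
  assert (Nz0 := UHP_neq_0 _ hz0). assert (Pz0 := Cmod_pos _ Nz0).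
  assert (sub : forall p P, nb closed_UHP p P -> nb UHP p P).
  { intros p P. apply nb_mono. apply UHP_closed. }
  destruct (boundary_extension (fun z => z <> z0) F g) as [H [H1 [H2 H3]]].
  { intros z Hz N. now apply HF1. }
  { intros p _ N. now apply neq_open. }
  { intros p Hp N. apply (clim_mono _ _ _ _ (sub p)).
    now apply (clim_integrand alpha beta gamma t). }
  set (F' := fun y => F (- / y)%C).
  (* The chain rule gives F(-1/y) the derivative g(-1/y) / y^2, and 0 is its limit at y = 0. *)
  set (G' := fun y : C => if Ceq_dec y 0 then RtoC 0 else (g (- / y) * (/ y * / y))%C).
  (* For y in this disc, y <> 0, the point -1/y has modulus above |z0| and so misses the pole. *)
  set (U := fun y : C => Cmod y < / Cmod z0).
  assert (UN : forall y, y <> RtoC 0 -> U y -> (- / y)%C <> z0).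
  { intros y Ny Uy E. unfold U in Uy. rewrite <- E, Cmod_opp, Cmod_inv, Rinv_inv in Uy by auto. lra. }
  destruct (boundary_extension U F' G') as [H' [_ [H2' _]]].
  { intros y Hy Uy. assert (Ny := UHP_neq_0 _ Hy).
    unfold G'. destruct (Ceq_dec y 0) as [E|_]; [contradiction|]. unfold F'.
    apply (cder_comp _ everywhere (fun y => - / y)%C).
    - apply cder_unique_val with (- (- (1) / (y * y)))%C; [field; auto|].
      apply cder_opp, (cder_inv everywhere (fun y => y)); [auto|apply cder_id].
    - apply HF1; [now apply inv_UHP|now apply UN].
    - apply filter_forall; intros; exact I. }
  { intros p _ Up. unfold U in *. exists (/ Cmod z0 - Cmod p). split; [lra|].
    intros w _ Hw. generalize (Cmod_sub_ge w p). lra. }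
  { intros p Hp Up. destruct (Ceq_dec p 0) as [->|Np].
    - unfold G' at 2. destruct (Ceq_dec 0 0) as [_|E]; [|congruence].
      intros e He. destruct (integrand_infinity e He) as [M [HM HI]].
      exists (/ M). split; [now apply Rinv_0_lt_compat|]. intros y Hy Hlt.
      assert (Ny := UHP_neq_0 _ Hy). assert (Py := Cmod_pos _ Ny).
      unfold G'. destruct (Ceq_dec y 0) as [E|_]; [contradiction|].
      replace (y - 0)%C with y in Hlt by ring.
      replace (g (- / y) * (/ y * / y) - 0)%C with (g (- / y) * (/ y * / y))%C by ring.
      rewrite !Cmod_mult.
      assert (E : Cmod (/ y) = Cmod (- / y)) by now rewrite Cmod_opp.
      rewrite E. apply HI; [apply UHP_closed; now apply inv_UHP|].
      rewrite Cmod_opp, Cmod_inv by auto. rewrite <- (Rinv_inv M).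
      apply Rinv_lt_contravar; auto. apply Rmult_lt_0_compat; auto. now apply Rinv_0_lt_compat.
    - unfold G' at 2. destruct (Ceq_dec p 0) as [E|_]; [contradiction|].
      apply (clim_ext (fun y => g (- / y) * (/ y * / y))%C).
      + generalize (neq_open 0 UHP p Np). apply filter_imp. intros y Ny.
        unfold G'. destruct (Ceq_dec y 0) as [E|_]; [contradiction|reflexivity].
      + assert (Ci0 : clim (nb UHP p) (fun y => / y)%C (/ p)%C) by (apply clim_inv; [auto|apply clim_id]).
        apply clim_mult; [|now apply clim_mult].
        apply (clim_comp _ (fun y => - / y)%C g closed_UHP (- / p)%C).
        * now apply clim_opp.
        * generalize (nb_domain UHP p). apply filter_imp. intros y Hy. now apply UHP_closed, inv_UHP.
        * apply (clim_integrand alpha beta gamma t); auto. now apply inv_closed_UHP. }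
  assert (C0 : closed_UHP 0) by (unfold closed_UHP; simpl; lra).
  assert (U0 : U 0) by (unfold U; rewrite Cmod_0; now apply Rinv_0_lt_compat).
  assert (LL := H2' 0 C0 U0).
  exists (fun z => H z - H 0)%C, (H' 0 - H 0)%C, (- (z0 * z0 * regular_part alpha beta gamma t z0 z0))%C.
  split; [|split; [ring|split; [|split; [|split]]]].
  - assert (R := regular_part_neq_0 alpha beta gamma t ha ht z0 hz0 z0 hz0).
    intros E. apply (Cmult_neq_0 _ _ (Cmult_neq_0 _ _ Nz0 Nz0) R).
    rewrite <- (Copp_involutive (_ * _)), E. ring.
  - intros p Hp N. apply cder_unique_val with (g p - 0)%C; [ring|].
    apply cder_minus; [now apply H1|apply cder_const].
  - intros e He. assert (He2 : 0 < e / 2) by lra.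
    destruct (LL _ He2) as [d [Hd HL]].
    exists (Rmax (/ d) (Cmod z0)).
    assert (IN : forall z, UHP z -> Rmax (/ d) (Cmod z0) < Cmod z -> Cmod (F z - H' 0) < e / 2).
    { intros z Hz Hm. assert (Nz := UHP_neq_0 _ Hz).
      assert (Hmd : / d < Cmod z) by (eapply Rle_lt_trans; [apply Rmax_l|exact Hm]).
      assert (E : (- / (- / z))%C = z) by (field; auto).
      generalize (HL (- / z)%C (inv_UHP _ Hz)). unfold F'. rewrite E.
      intros X. apply X. replace (- / z - 0)%C with (- / z)%C by ring.
      rewrite Cmod_opp, Cmod_inv by auto. rewrite <- (Rinv_inv d).
      apply Rinv_lt_contravar; auto. apply Rmult_lt_0_compat; [now apply Rinv_0_lt_compat|].
      now apply Cmod_pos. }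
    intros z Hz Hm.
    assert (Nz : z <> z0).
    { intros ->. generalize (Rmax_r (/ d) (Cmod z0)). lra. }
    replace (H z - H 0 - (H' 0 - H 0))%C with (H z - H' 0)%C by ring.
    apply Rle_lt_trans with (e / 2); [|lra].
    (* The point z may be real: the strict estimate at interior points near z gives a weak one at z,
       hence the margin e / 2. *)
    refine (clim_bound_le (F := nb UHP z) (PF := nb_UHP_proper z Hz) _ _ _ _ (H2 z Hz Nz) _).
    exists (Cmod z - Rmax (/ d) (Cmod z0)). split; [lra|]. intros w Hw Hlt.
    left. apply IN; auto. generalize (Cmod_sub_ge z w). rewrite Cmod_minus_sym. lra.
  - set (D := fun z => UHP z /\ z <> z0).
    apply (clim_ext (fun z => (z - z0) * F z - (z - z0) * H 0)%C).
    + generalize (nb_domain D z0). apply filter_imp. intros w [Hw N]. rewrite (H3 w) by auto. ring.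
    + assert (E : (- (z0 * z0 * regular_part alpha beta gamma t z0 z0) - (z0 - z0) * H 0)%C =
        (- (z0 * z0 * regular_part alpha beta gamma t z0 z0))%C) by ring.
      rewrite <- E. apply clim_minus; [exact HF2|].
      apply clim_mult; [apply clim_minus; [apply clim_id|]|]; apply clim_const.
  - rewrite Copp_involutive. exact HG2.
Qed.
End Infinity.

(** * Path integrals *)

Section PathIntegral.
Variables (D : C -> Prop) (H g : C -> C).
Hypothesis D_closed : forall z, D z -> closed_UHP z.
Hypothesis H_der : forall p, D p -> cder closed_UHP H p (g p).
Hypothesis g_cont : forall p, D p -> clim (nb closed_UHP p) g (g p).

(** The fundamental theorem along each smooth piece, with derivatives relative to the closed
    half-plane, so that a path may run along the real axis. It makes the integral independent of the
    path. *)
Lemma path_int_value a b l : path_int D g a b l -> l = (H b - H a)%C.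
Proof.
  induction 1 as [p v l Hp Hv HD Hl|a b c l m _ IH1 _ IH2].
  - assert (Q : is_RInt (V := C_R_NormedModule) (fun s => g (p s) * v s)%C 0 1 (H (p 1) - H (p 0))%C).
    { assert (DC : forall s, 0 <= s <= 1 -> closed_UHP (p s)) by auto.
      apply (is_RInt_rder (fun s => H (p s))); [lra| |].
      - intros s Hs. apply (rder_comp closed_UHP H p); auto.
        intros e He. destruct (is_derive_path_eps _ _ _ (Hp s) e He) as [d [Hd Hd']].
        exists d; split; auto.
      - intros s Hs. apply clim_mult.
        + apply (clim_comp _ p g closed_UHP (p s)); auto.
          * intros e He.
            assert (Cp : continuous (U := C_UniformSpace) p s).
            { apply (ex_derive_continuous (V := C_R_NormedModule)). eexists. apply Hp. }
            destruct (continuous_clim _ _ Cp e He) as [d [Hd Hd']]. exists d; split; auto.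
          * exists 1; split; [lra|auto].
        + intros e He. destruct (continuous_clim _ _ (Hv s) e He) as [d [Hd Hd']].
          exists d; split; auto. }
    rewrite <- (is_RInt_unique (V := C_R_CompleteNormedModule) _ _ _ _ Hl).
    apply (is_RInt_unique (V := C_R_CompleteNormedModule) _ _ _ _ Q).
  - rewrite IH1, IH2. ring.
Qed.

Lemma path_int_line a b : (forall s : R, 0 <= s <= 1 -> D (a + s * (b - a))%C) ->
  path_int D g a b (H b - H a)%C.
Proof.
  intros HD. set (p := fun s : R => (a + s * (b - a))%C).
  assert (E0 : p 0 = a) by (unfold p; ring). assert (E1 : p 1 = b) by (unfold p; ring).
  rewrite <- E0 at 1. rewrite <- E1 at 1.
  apply path_int_C1 with (v := fun _ => (b - a)%C).
  - intros s. apply is_derive_path. intros e He. exists 1; split; [lra|]. intros s' _.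
    unfold p. replace (a + s' * (b - a) - (a + s * (b - a)) - (b - a) * RtoC (s' - s))%C
      with (RtoC 0) by (rewrite RtoC_minus; ring).
    rewrite Cmod_0. apply Rmult_le_pos; [lra|apply Rabs_pos].
  - intros s. apply continuous_const.
  - exact HD.
  - replace (H b - H a)%C with (H (p 1) - H (p 0))%C by (now rewrite E0, E1).
    apply (is_RInt_line closed_UHP); [lra| | |]; intros s Hs; auto.
Qed.
End PathIntegral.

Lemma Im_line a b (s : R) : Im (a + s * (b - a)) = (1 - s) * Im a + s * Im b.
Proof. destruct a, b; simpl. ring. Qed.

Lemma closed_UHP_segment a b (s : R) : closed_UHP a -> closed_UHP b -> 0 <= s <= 1 ->
  closed_UHP (a + s * (b - a)).
Proof.
  unfold closed_UHP. intros Ha Hb Hs. rewrite Im_line.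
  assert (0 <= (1 - s) * Im a) by (apply Rmult_le_pos; lra).
  assert (0 <= s * Im b) by (apply Rmult_le_pos; lra). lra.
Qed.

(* The line through [z] and [w] meets the real axis at most once. *)
Lemma avoid_point z w : UHP w -> z <> w -> exists b : R, (b = 0 \/ b = 1) /\
  forall s : R, 0 <= s <= 1 -> (b + s * (z - b))%C <> w.
Proof.
  intros Hw N.
  destruct (classic (exists s : R, 0 <= s <= 1 /\ (RtoC 0 + s * (z - RtoC 0))%C = w)) as [[s [Hs E]]|NE].
  - exists 1. split; auto. intros r Hr E'. apply N.
    unfold UHP in Hw. destruct z as [x y], w as [u v].
    apply (f_equal Re) in E as Er. apply (f_equal Im) in E as Ei.
    apply (f_equal Re) in E' as Er'. apply (f_equal Im) in E' as Ei'. simpl in *.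
    assert (Sy : s * y = v) by lra. assert (Ry : r * y = v) by lra.
    assert (y <> 0) by (intros Y; rewrite Y in Sy; lra).
    assert (s = r) by (apply Rmult_eq_reg_r with y; lra). subst r.
    assert (s = 1) by lra. subst s. apply C_ext; simpl; lra.
  - exists 0. split; auto. intros s Hs E. apply NE. eauto.
Qed.

Lemma h_value_unique alpha beta gamma t z0 H : UHP z0 -> H (RtoC 0) = RtoC 0 ->
  (forall p, closed_UHP p -> p <> z0 ->
    cder closed_UHP H p (integrand alpha beta gamma t z0 p)) ->
  (forall p, closed_UHP p -> p <> z0 ->
    clim (nb closed_UHP p) (integrand alpha beta gamma t z0) (integrand alpha beta gamma t z0 p)) ->
  forall z, closed_UHP z -> z <> z0 -> unique (h_value alpha beta gamma t z0 z) (H z).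
Proof.
  intros Hz0 H0 HH Hg z Hz N. unfold h_value.
  set (D := fun x => closed_UHP x /\ x <> z0).
  assert (DC : forall x, D x -> closed_UHP x) by (intros x [? ?]; auto).
  assert (HH' : forall x, D x -> cder closed_UHP H x (integrand alpha beta gamma t z0 x))
    by (intros x [? ?]; auto).
  assert (Hg' : forall x, D x -> clim (nb closed_UHP x) (integrand alpha beta gamma t z0)
    (integrand alpha beta gamma t z0 x)) by (intros x [? ?]; auto).
  split.
  (* The path runs along the real axis from 0 to b and then straight to z. *)
  - destruct (avoid_point z z0 Hz0 N) as [b [Hb Hav]].
    replace (H z) with ((H b - H 0%C) + (H z - H b))%C by (rewrite H0; ring).
    apply path_int_cat with (RtoC b); apply path_int_line; auto.
    + intros s Hs. assert (R : Im (0 + s * (b - 0)) = 0) by (simpl; ring).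
      split; [unfold closed_UHP; lra|]. intros E. rewrite E in R. unfold UHP in Hz0. lra.
    + intros s Hs. split; [|now apply Hav]. apply closed_UHP_segment; auto.
      unfold closed_UHP; simpl; lra.
  - intros l Hl. rewrite (path_int_value D H _ DC HH' Hg' _ _ _ Hl), H0. ring.
Qed.

Lemma hfun_eq alpha beta gamma t z0 z l :
  unique (h_value alpha beta gamma t z0 z) l -> hfun alpha beta gamma t z0 z = l.
Proof.
  intros [H1 H2]. symmetry. apply H2. unfold hfun.
  apply (iota_correct (V := C_R_CompleteNormedModule)). exists l. split; auto.
Qed.

(** * The degree argument *)

(** Near z1 the map differs from its linear part by a map with Lipschitz constant half that of the
    linear part; local injectivity and surjectivity both rest on this. *)
Lemma local_expansion (F F' : C -> C) z1 : F' z1 <> RtoC 0 ->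
  nb everywhere z1 (fun z => cder everywhere F z (F' z)) -> clim (nb everywhere z1) F' (F' z1) ->
  exists d, 0 < d /\ forall a b, Cmod (a - z1) < d -> Cmod (b - z1) < d ->
    Cmod (F b - F a - F' z1 * (b - a)) <= Cmod (F' z1) / 2 * Cmod (b - a).
Proof.
  intros N [d1 [Hd1 H1]] H2. assert (P := Cmod_pos _ N).
  assert (P2 : 0 < Cmod (F' z1) / 2) by lra.
  destruct (H2 _ P2) as [d2 [Hd2 H3]].
  exists (Rmin d1 d2). split; [now apply Rmin_glb_lt|]. intros a b Ha Hb.
  generalize (Rmin_l d1 d2) (Rmin_r d1 d2). intros L1 L2.
  apply (mean_value_ineq F F'); intros s Hs; generalize (Cmod_segment a b z1 _ s Ha Hb Hs); intros L.
  - apply H1; [exact I|lra].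
  - left. apply H3; [exact I|lra].
Qed.

Lemma expansion_inj (F : C -> C) c z1 d : c <> RtoC 0 ->
  (forall a b, Cmod (a - z1) < d -> Cmod (b - z1) < d ->
    Cmod (F b - F a - c * (b - a)) <= Cmod c / 2 * Cmod (b - a)) ->
  forall a b, Cmod (a - z1) < d -> Cmod (b - z1) < d ->
    Cmod c / 2 * Cmod (b - a) <= Cmod (F b - F a).
Proof.
  intros N H a b Ha Hb. specialize (H a b Ha Hb).
  generalize (Cmod_sub_ge (c * (b - a)) (c * (b - a) - (F b - F a))).
  rewrite (Cmod_minus_sym (c * (b - a)) (F b - F a)), Cmod_mult.
  replace (c * (b - a) - (c * (b - a) - (F b - F a)))%C with (F b - F a)%C by ring. lra.
Qed.

Lemma local_inj (F F' : C -> C) z1 : F' z1 <> RtoC 0 ->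
  nb everywhere z1 (fun z => cder everywhere F z (F' z)) -> clim (nb everywhere z1) F' (F' z1) ->
  exists d, 0 < d /\ forall a b, Cmod (a - z1) < d -> Cmod (b - z1) < d -> F a = F b -> a = b.
Proof.
  intros N H1 H2. destruct (local_expansion F F' z1 N H1 H2) as [d [Hd H]].
  exists d; split; auto. intros a b Ha Hb E. assert (P := Cmod_pos _ N).
  apply NNPP. intros Nab. assert (Q : 0 < Cmod (b - a)) by (apply Cmod_minus_pos; congruence).
  generalize (expansion_inj F _ z1 d N H a b Ha Hb). rewrite E.
  replace (F b - F b)%C with (RtoC 0) by ring. rewrite Cmod_0. nra.
Qed.

(* At an interior minimum of |F z - w| over a small square, a step in the
   direction (w - F z) / F' z1 would decrease it unless F z = w. *)
Lemma local_surj (F F' : C -> C) z1 : F' z1 <> RtoC 0 ->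
  nb everywhere z1 (fun z => cder everywhere F z (F' z)) -> clim (nb everywhere z1) F' (F' z1) ->
  forall r, 0 < r -> exists e, 0 < e /\ forall w, Cmod (w - F z1) < e ->
    exists z, Cmod (z - z1) < r /\ F z = w.
Proof.
  intros N H1 H2 r Hr. destruct (local_expansion F F' z1 N H1 H2) as [d0 [Hd0 H0]].
  set (c := F' z1) in *. assert (P := Cmod_pos _ N).
  set (d := Rmin d0 r). assert (Hd : 0 < d) by now apply Rmin_glb_lt.
  assert (Ld0 : d <= d0) by apply Rmin_l. assert (Ldr : d <= r) by apply Rmin_r.
  assert (H : forall a b, Cmod (a - z1) < d -> Cmod (b - z1) < d ->
    Cmod (F b - F a - c * (b - a)) <= Cmod c / 2 * Cmod (b - a)) by (intros; apply H0; lra).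
  clear H0.
  set (s := d / 4).
  assert (Hbox : forall z, Re z1 - s <= Re z <= Re z1 + s -> Im z1 - s <= Im z <= Im z1 + s ->
    Cmod (z - z1) < d).
  { intros z Hx Hy. eapply Rle_lt_trans; [apply Cmod_le_abs|].
    assert (Rabs (Re (z - z1)) <= s) by (apply Rabs_le; destruct z, z1; simpl in *; lra).
    assert (Rabs (Im (z - z1)) <= s) by (apply Rabs_le; destruct z, z1; simpl in *; lra).
    unfold s in *. lra. }
  assert (Hs : 0 < s) by (unfold s; lra).
  (* At a minimum p one has |F p - F z1| <= 2 |w - F z1| < |c| s / 2, so the lower Lipschitz bound
     |c| / 2 puts p at distance less than s from z1, inside the square. *)
  exists (Cmod c * s / 4). split; [nra|]. intros w Hw.
  destruct (min_box (fun z => Cmod (F z - w)) (Re z1 - s) (Re z1 + s) (Im z1 - s) (Im z1 + s))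
    as [p [P1 [P2 P3]]]; try lra.
  { intros p Hx Hy e He.
    assert (Hp := Hbox p Hx Hy).
    set (k := 2 * Cmod c + 1).
    exists (Rmin (d - Cmod (p - z1)) (e / k)). split.
    { apply Rmin_glb_lt; [lra|]. apply Rdiv_lt_0_compat; unfold k; lra. }
    intros z _ Hz.
    generalize (Rmin_l (d - Cmod (p - z1)) (e / k)) (Rmin_r (d - Cmod (p - z1)) (e / k)). intros M1 M2.
    assert (Hz1 : Cmod (z - z1) < d) by (generalize (Cmod_tri z p z1); lra).
    specialize (H p z Hp Hz1).
    assert (B : Cmod (F z - F p) <= k * Cmod (z - p)).
    { replace (F z - F p)%C with ((F z - F p - c * (z - p)) + c * (z - p))%C by ring.
      eapply Rle_trans; [apply Cmod_triangle|]. rewrite Cmod_mult. unfold k.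
      generalize (Cmod_ge_0 (z - p)). nra. }
    assert (k * Cmod (z - p) < e).
    { replace e with (k * (e / k)) by (field; unfold k; lra).
      apply Rmult_lt_compat_l; [unfold k|]; lra. }
    generalize (Cmod_tri (F p) (F z) w). rewrite (Cmod_minus_sym (F p) (F z)). lra. }
  assert (Hp := Hbox p P1 P2).
  exists p. split; [lra|].
  assert (Hz1 : Cmod (F p - w) <= Cmod (F z1 - w)) by (apply P3; lra).
  assert (Z1 : Cmod (z1 - z1) < d).
  { replace (z1 - z1)%C with (RtoC 0) by ring. rewrite Cmod_0; lra. }
  assert (Near : Cmod (p - z1) < s).
  { generalize (expansion_inj F c z1 d N H z1 p Z1 Hp) (Cmod_tri (F p) w (F z1)).
    rewrite (Cmod_minus_sym (F z1) w) in Hz1. intros.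
    apply Rmult_lt_reg_l with (Cmod c / 2); lra. }
  apply NNPP. intros Nw.
  assert (Pw : 0 < Cmod (F p - w)) by now apply Cmod_minus_pos.
  set (v := ((w - F p) / c)%C).
  assert (Mv : Cmod v = Cmod (F p - w) / Cmod c).
  { unfold v. rewrite Cmod_div, Cmod_minus_sym; auto. }
  assert (Pv : 0 < Cmod v) by (rewrite Mv; now apply Rdiv_lt_0_compat).
  (* The step h v keeps z in the square and 1 - h nonnegative. *)
  set (h := Rmin 1 ((s - Cmod (p - z1)) / (2 * Cmod v))).
  assert (Hh : 0 < h) by (apply Rmin_glb_lt; [lra|apply Rdiv_lt_0_compat; lra]).
  assert (Hh1 : h <= 1) by apply Rmin_l.
  assert (Hh2 : h * Cmod v <= (s - Cmod (p - z1)) / 2).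
  { apply Rle_trans with ((s - Cmod (p - z1)) / (2 * Cmod v) * Cmod v).
    - apply Rmult_le_compat_r; [lra|apply Rmin_r].
    - right. field. lra. }
  set (z := (p + h * v)%C).
  assert (Mz : Cmod (z - p) = h * Cmod v).
  { unfold z. replace (p + h * v - p)%C with (h * v)%C by ring.
    rewrite Cmod_mult, Cmod_nonneg_R; lra. }
  assert (Nz : Cmod (z - z1) < s) by (generalize (Cmod_tri z p z1); lra).
  assert (Hz : Cmod (z - z1) < d) by (unfold s in Nz; lra).
  specialize (H p z Hp Hz).
  (* The linear part shrinks F p - w by the factor 1 - h, and the error is at most (h / 2) |F p -
     w|, so the distance to w would decrease. *)
  assert (E : (F z - w)%C = ((F z - F p - c * (z - p)) + (RtoC (1 - h) * (F p - w)))%C).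
  { replace (c * (z - p))%C with (h * (w - F p))%C.
    - rewrite RtoC_minus. ring.
    - unfold z, v. field. exact N. }
  assert (L : Cmod (F p - w) <= Cmod (F z - w)).
  { generalize (re_le_Cmod (z - z1)) (im_le_Cmod (z - z1)). intros R1 R2.
    assert (R3 : Rabs (Re (z - z1)) < s) by lra. assert (R4 : Rabs (Im (z - z1)) < s) by lra.
    apply Rabs_def2 in R3. apply Rabs_def2 in R4.
    apply P3; destruct z, z1; simpl in *; lra. }
  generalize (Cmod_triangle (F z - F p - c * (z - p)) (RtoC (1 - h) * (F p - w))).
  rewrite <- E, Cmod_mult, (Cmod_nonneg_R (1 - h)) by lra.
  rewrite Mz, Mv in H.
  replace (Cmod c / 2 * (h * (Cmod (F p - w) / Cmod c))) with (h / 2 * Cmod (F p - w)) in H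
    by (field; lra).
  nra.
Qed.

(** The closed half-plane is compactified by the condition at infinity. Real points serve as
    centres, but the conclusion concerns the open half-plane only. *)
Lemma gauge_UHP (Q : C -> R -> Prop) :
  (forall z d d', 0 < d' <= d -> Q z d -> Q z d') ->
  (forall p, closed_UHP p -> exists d, 0 < d /\ forall z, UHP z -> Cmod (z - p) < d -> Q z d) ->
  (exists M d, 0 < d /\ forall z, UHP z -> M < Cmod z -> Q z d) ->
  exists d, 0 < d /\ forall z, UHP z -> Q z d.
Proof.
  intros Hm H [M [d [Hd HM]]].
  destruct (gauge_box Q UHP (- M) M 0 M Hm) as [d' [Hd' H']].
  { intros p _ Hp. apply H. unfold closed_UHP. lra. }
  exists (Rmin d d'). split; [now apply Rmin_glb_lt|]. intros z Hz.
  assert (Hmin : 0 < Rmin d d') by now apply Rmin_glb_lt.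
  destruct (Rlt_dec M (Cmod z)) as [L|L].
  - apply (Hm z d); auto. split; [auto|apply Rmin_l].
  - apply (Hm z d'); [split; [auto|apply Rmin_r]|].
    generalize (re_le_Cmod z) (im_le_Cmod z). intros R1 R2.
    assert (R3 : Rabs (Re z) <= M) by lra. assert (R4 : Rabs (Im z) <= M) by lra.
    apply Rabs_le_between in R3. apply Rabs_le_between in R4.
    apply H'; auto. unfold UHP in Hz. lra.
Qed.

Section Degree.
Variables (f f' : C -> C) (z0 A a4 : C) (P : C -> Prop).
Hypothesis z0_UHP : UHP z0.
Hypothesis f_der : forall z, UHP z -> z <> z0 -> cder everywhere f z (f' z).
Hypothesis f'_cont : forall z, UHP z -> z <> z0 -> clim (nb everywhere z) f' (f' z).
Hypothesis f'_neq_0 : forall z, UHP z -> z <> z0 -> f' z <> RtoC 0.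
Hypothesis A_neq_0 : A <> RtoC 0.
Let D z := UHP z /\ z <> z0.
Hypothesis f_pole : clim (nb D z0) (fun z => (z - z0) * f z)%C A.
Hypothesis f'_pole : clim (nb D z0) (fun z => (z - z0) * (z - z0) * f' z)%C (- A)%C.
Hypothesis f_closed : forall p, closed_UHP p -> p <> z0 -> clim (nb UHP p) f (f p).
Hypothesis P_real : forall x : R, P (f x).
Hypothesis f_inf : forall e, 0 < e -> exists M, forall z, UHP z -> M < Cmod z -> Cmod (f z - a4) < e.
Hypothesis P_inf : P a4.

Let pre w z := UHP z /\ z <> z0 /\ f z = w.

Lemma D_open z : UHP z -> z <> z0 -> nb everywhere z D.
Proof.
  intros Hz N. apply filter_and; [now apply UHP_open|now apply neq_open].
Qed.

Lemma f_local_surj z : UHP z -> z <> z0 -> forall r, 0 < r -> exists e, 0 < e /\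
  forall w, Cmod (w - f z) < e -> exists z', Cmod (z' - z) < r /\ pre w z'.
Proof.
  intros Hz N r Hr. destruct (D_open z Hz N) as [d [Hd HD]].
  destruct (local_surj f f' z (f'_neq_0 z Hz N)) with (r := Rmin r d) as [e [He H]].
  - exists d; split; auto. intros w _ Hw. destruct (HD w I Hw). auto.
  - auto.
  - now apply Rmin_glb_lt.
  - exists e; split; auto. intros w Hw. destruct (H w Hw) as [z' [Hz' E]].
    exists z'. generalize (Rmin_l r d) (Rmin_r r d). intros.
    destruct (HD z' I) as [U N']; [lra|]. split; [lra|]. split; [|split]; auto.
Qed.

Lemma f_large_near_pole K : nb D z0 (fun z => K < Cmod (f z)).
Proof.
  assert (PA := Cmod_pos _ A_neq_0).
  generalize (clim_away _ _ A_neq_0 f_pole). intros [d [Hd H]].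
  set (k := Rabs K + 1). assert (Hk : 0 < k) by (unfold k; generalize (Rabs_pos K); lra).
  assert (Hk' : 0 < Cmod A / 2 / k) by (apply Rdiv_lt_0_compat; lra).
  exists (Rmin d (Cmod A / 2 / k)). split; [now apply Rmin_glb_lt|].
  intros z [Hz N] Hlt. generalize (Rmin_l d (Cmod A / 2 / k)) (Rmin_r d (Cmod A / 2 / k)). intros L1 L2.
  assert (Q : Cmod A / 2 < Cmod ((z - z0) * f z)) by (apply H; [split; auto|lra]).
  rewrite Cmod_mult in Q.
  apply Rnot_le_lt. intros L. assert (Cmod (f z) <= k) by (unfold k; generalize (Rle_abs K); lra).
  assert (Cmod (z - z0) * Cmod (f z) <= Cmod A / 2 / k * k).
  { apply Rmult_le_compat; try apply Cmod_ge_0; lra. }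
  replace (Cmod A / 2 / k * k) with (Cmod A / 2) in H1 by (field; lra). lra.
Qed.

Lemma closed_UHP_cases p : closed_UHP p -> UHP p \/ exists x : R, p = RtoC x.
Proof.
  intros Hp. destruct (Rlt_dec 0 (Im p)) as [L|L]; [now left|right].
  exists (Re p). unfold closed_UHP in Hp. apply C_ext; simpl; lra.
Qed.

(* Compactness of the closed half-plane with infinity: [V] may use that f is
   close to w wherever f does not approach w. *)
Lemma gauge_f (w : C) (V : C -> Prop) :
  (forall p, closed_UHP p -> p <> z0 -> f p = w -> nb UHP p V) -> a4 <> w ->
  exists e, 0 < e /\ forall z, UHP z -> z <> z0 -> Cmod (f z - w) < e -> V z.
Proof.
  intros HV Ha4.
  destruct (gauge_UHP (fun z e => z <> z0 -> V z \/ e <= Cmod (f z - w))) as [e [He H]].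
  - intros z d d' Hd X N. destruct (X N); [now left|right; lra].
  - intros p Hp. destruct (Ceq_dec p z0) as [->|N].
    + destruct (f_large_near_pole (Cmod w + 1)) as [d [Hd X]].
      exists (Rmin d 1). split; [apply Rmin_glb_lt; lra|]. intros z Hz Hlt N. right.
      generalize (Rmin_l d 1) (Rmin_r d 1). intros.
      assert (Cmod w + 1 < Cmod (f z)) by (apply X; [split; auto|lra]).
      generalize (Cmod_sub_ge (f z) w). lra.
    + destruct (Ceq_dec (f p) w) as [E|E].
      * destruct (HV p Hp N E) as [d [Hd X]]. exists d; split; auto.
      * set (k := Cmod (f p - w) / 2).
        assert (Hk : 0 < k) by (generalize (Cmod_minus_pos _ _ E); unfold k; lra).
        destruct (f_closed p Hp N k Hk) as [d [Hd X]].
        exists (Rmin d k). split; [now apply Rmin_glb_lt|].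
        intros z Hz Hlt _. right. generalize (Rmin_l d k) (Rmin_r d k). intros.
        assert (Y : Cmod (f z - f p) < k) by (apply X; [exact Hz|lra]).
        generalize (Cmod_tri (f p) (f z) w). rewrite (Cmod_minus_sym (f p) (f z)). unfold k in *. lra.
  - generalize (Cmod_minus_pos _ _ Ha4). intros P4. assert (P42 : 0 < Cmod (a4 - w) / 2) by lra.
    destruct (f_inf _ P42) as [M HM]. exists M, (Cmod (a4 - w) / 2). split; auto.
    intros z Hz Hlt _. right. specialize (HM z Hz Hlt).
    generalize (Cmod_tri a4 (f z) w). rewrite (Cmod_minus_sym a4 (f z)). lra.
  - exists e; split; auto. intros z Hz N Hlt. destruct (H z Hz N); [auto|lra].
Qed.

(** Real points and infinity are sent into P, hence not to w; only interior preimages of w have to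
    be covered by V. *)
Lemma properness (w : C) (V : C -> Prop) : ~ P w -> (forall z, pre w z -> nb everywhere z V) ->
  exists e, 0 < e /\ forall z, UHP z -> z <> z0 -> Cmod (f z - w) < e -> V z.
Proof.
  intros NP H. apply gauge_f.
  - intros p Hp N E. destruct (closed_UHP_cases p Hp) as [U|[x ->]].
    + apply (nb_mono everywhere); [intros; exact I|]. apply H. repeat split; auto.
    + exfalso. apply NP. rewrite <- E. apply P_real.
  - intros E. apply NP. now rewrite <- E.
Qed.

Definition attained (w : C) : Prop := exists z, pre w z.
Definition attained_once (w : C) : Prop := exists z, pre w z /\ forall z', pre w z' -> z' = z.

Definition locally_constant_off (V : C -> Prop) : Prop :=
  forall w, ~ P w -> exists e, 0 < e /\ forall w', Cmod (w' - w) < e -> (V w <-> V w').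

(** Attained values persist because f is open; for a value that is not attained, properness with the
    empty set V excludes all nearby values. *)
Lemma attained_locally_constant : locally_constant_off attained.
Proof.
  intros w NP. destruct (classic (attained w)) as [[z [Hz [N E]]]|NA].
  - destruct (f_local_surj z Hz N 1 Rlt_0_1) as [e [He H]]. exists e; split; auto.
    intros w' Hw'. rewrite E in H. destruct (H w' Hw') as [z' [_ Hz']].
    split; intros _; [now exists z'|exists z; repeat split; auto].
  - destruct (properness w (fun _ => False) NP) as [e [He H]].
    { intros z Hz. exfalso. apply NA. now exists z. }
    exists e; split; auto. intros w' Hw'. split; [tauto|].
    intros [z [Hz [N E]]]. exfalso. apply (H z Hz N). now rewrite E.
Qed.

(** A single preimage persists, and properness confines all preimages of nearby values to a disc on
    which f is injective. Two preimages persist in disjoint discs, and none remains none. *)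
Lemma attained_once_locally_constant : locally_constant_off attained_once.
Proof.
  intros w NP. destruct (classic (attained_once w)) as [AO|NA].
  - destruct AO as [z [[Hz [N E]] Hu]].
    assert (HD := D_open z Hz N).
    destruct (local_inj f f' z (f'_neq_0 z Hz N)) as [d [Hd Hinj]].
    { revert HD. apply filter_imp. intros u [? ?]; auto. }
    { auto. }
    destruct (f_local_surj z Hz N d Hd) as [e1 [He1 Hs]]. rewrite E in Hs.
    destruct (properness w (fun u => Cmod (u - z) < d) NP) as [e2 [He2 Hp]].
    { intros z' Hz'. rewrite (Hu z' Hz'). exists d; split; auto. }
    exists (Rmin e1 e2). split; [now apply Rmin_glb_lt|]. intros w' Hw'.
    generalize (Rmin_l e1 e2) (Rmin_r e1 e2). intros L1 L2.
    split; intros _; [|exists z; split; [repeat split; auto|auto]].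
    destruct (Hs w') as [z' [Hd' Hz']]; [lra|]. exists z'. split; auto.
    intros z'' Hz''. destruct Hz' as [U' [N' E']], Hz'' as [U'' [N'' E'']].
    apply Hinj; auto; [|congruence].
    apply Hp; auto. rewrite E''. lra.
  - destruct (classic (attained w)) as [[z1 H1]|NA'].
    + assert (X : exists z2, pre w z2 /\ z2 <> z1).
      { apply NNPP. intros NX. apply NA. exists z1. split; auto.
        intros z' Hz'. apply NNPP. intros N. apply NX. eauto. }
      destruct X as [z2 [H2 N12]]. generalize (Cmod_minus_pos _ _ N12). intros Pd.
      assert (Pd2 : 0 < Cmod (z2 - z1) / 2) by lra.
      destruct H1 as [U1 [N1 E1]], H2 as [U2 [N2 E2]].
      destruct (f_local_surj z1 U1 N1 _ Pd2) as [e1 [He1 Hs1]].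
      destruct (f_local_surj z2 U2 N2 _ Pd2) as [e2 [He2 Hs2]].
      rewrite E1 in Hs1. rewrite E2 in Hs2.
      exists (Rmin e1 e2). split; [now apply Rmin_glb_lt|]. intros w' Hw'.
      generalize (Rmin_l e1 e2) (Rmin_r e1 e2). intros L1 L2.
      split; [tauto|]. intros [z [_ Hu]]. exfalso.
      destruct (Hs1 w') as [y1 [D1 Y1]]; [lra|]. destruct (Hs2 w') as [y2 [D2 Y2]]; [lra|].
      rewrite (Hu y1 Y1) in D1. rewrite (Hu y2 Y2) in D2.
      generalize (Cmod_tri z2 z z1). rewrite (Cmod_minus_sym z2 z). lra.
    + destruct (attained_locally_constant w NP) as [e [He H]]. exists e; split; auto.
      intros w' Hw'. split; [tauto|]. intros [z [Hz _]]. exfalso. apply NA'.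
      apply (H w' Hw'). now exists z.
Qed.

(** Connectedness of [0, b] by finitely many steps of a uniform length. *)
Lemma constant_along_path (V : C -> Prop) (p : R -> C) (b : R) : locally_constant_off V -> 0 <= b ->
  (forall s, continuous (U := C_UniformSpace) p s) ->
  (forall s, 0 <= s <= b -> ~ P (p s)) -> V (p b) -> V (p 0).
Proof.
  intros HR Hb Hp HP HRb.
  destruct (gauge_interval (fun s d => forall s', 0 <= s' <= b -> Rabs (s' - s) < d ->
    (V (p s) <-> V (p s'))) 0 b) as [d [Hd H]].
  { intros s d d' Hd X s' Hs' L. apply X; auto. lra. }
  { intros s Hs. destruct (HR (p s) (HP s Hs)) as [e [He X]].
    destruct (continuous_clim p s (Hp s) e He) as [d [Hd Y]].
    exists (d / 2). split; [lra|]. intros s' Hs' L s'' Hs'' L'.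
    assert (V (p s) <-> V (p s')) by (apply X, Y; lra).
    assert (V (p s) <-> V (p s'')).
    { apply X, Y. replace (s'' - s) with ((s'' - s') + (s' - s)) by ring.
      eapply Rle_lt_trans; [apply Rabs_triang|]. lra. }
    tauto. }
  (* The steps go backwards from b by half the uniform radius; the maximum with 0 stops them at the
     start of the path. *)
  assert (step : forall n : nat, V (p (Rmax 0 (b - INR n * (d / 2))))).
  { induction n as [|n IH].
    - simpl. rewrite Rmult_0_l, Rminus_0_r, Rmax_right; auto.
    - assert (Pn := pos_INR n).
      assert (0 <= INR n * (d / 2)) by (apply Rmult_le_pos; lra).
      assert (0 <= INR (S n) * (d / 2)) by (apply Rmult_le_pos; [apply pos_INR|lra]).
      apply (H (Rmax 0 (b - INR n * (d / 2)))); auto.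
      + unfold Rmax. destruct Rle_dec; lra.
      + unfold Rmax. destruct Rle_dec; lra.
      + rewrite S_INR in *. unfold Rmax. repeat destruct Rle_dec; apply Rabs_def1; lra. }
  destruct (INR_unbounded (b / (d / 2))) as [n Hn].
  assert (b < INR n * (d / 2)).
  { replace b with (b / (d / 2) * (d / 2)) by (field; lra). apply Rmult_lt_compat_r; lra. }
  specialize (step n). rewrite Rmax_left in step by lra. exact step.
Qed.

(** The map in the chart 1/w near the pole: 1/f with value 0 at z0 has the nonzero derivative 1/A
    there, so local inversion applies to it. *)
Let q z := if Ceq_dec z z0 then RtoC 0 else (/ f z)%C.
Let q' z := if Ceq_dec z z0 then (/ A)%C else (- f' z / (f z * f z))%C.

Lemma q_z0 : q z0 = RtoC 0.
Proof. unfold q. destruct (Ceq_dec z0 z0); congruence. Qed.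

Lemma q'_z0 : q' z0 = (/ A)%C.
Proof. unfold q'. destruct (Ceq_dec z0 z0); congruence. Qed.

Lemma q_neq z : z <> z0 -> q z = (/ f z)%C.
Proof. intros N. unfold q. destruct (Ceq_dec z z0); congruence. Qed.

Lemma q'_neq z : z <> z0 -> q' z = (- f' z / (f z * f z))%C.
Proof. intros N. unfold q'. destruct (Ceq_dec z z0); congruence. Qed.

Lemma nb_puncture (V : C -> Prop) : V z0 -> nb D z0 V -> nb everywhere z0 V.
Proof.
  intros H0 [d [Hd H]]. destruct (UHP_open z0 z0_UHP) as [d' [Hd' H']].
  exists (Rmin d d'). split; [now apply Rmin_glb_lt|]. intros z _ Hz.
  generalize (Rmin_l d d') (Rmin_r d d'). intros.
  destruct (Ceq_dec z z0) as [->|N]; auto. apply H; [split; auto|lra]. apply H'; [exact I|lra].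
Qed.

Lemma f_neq_0_near_pole : nb D z0 (fun z => f z <> RtoC 0).
Proof.
  generalize (f_large_near_pole 0). apply filter_imp. intros z Hz E. rewrite E, Cmod_0 in Hz. lra.
Qed.

Lemma cder_q_z0 : cder everywhere q z0 (/ A).
Proof.
  exists (fun z => if Ceq_dec z z0 then (/ A)%C else (/ ((z - z0) * f z))%C). split.
  - apply nb_puncture.
    + rewrite q_z0. ring.
    + generalize (filter_and _ _ (nb_domain D z0) f_neq_0_near_pole). apply filter_imp.
      intros z [[_ N] Hf]. rewrite q_z0, q_neq by auto. destruct (Ceq_dec z z0); [contradiction|].
      assert (Hz := Cminus_eq_contra _ _ N). field. auto.
  - intros e He. apply nb_puncture.
    + destruct (Ceq_dec z0 z0); [|congruence]. replace (/ A - / A)%C with (RtoC 0) by ring.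
      now rewrite Cmod_0.
    + generalize (filter_and _ _ (nb_domain D z0) (clim_inv _ _ A_neq_0 f_pole e He)).
      apply filter_imp. intros z [[_ N] H]. destruct (Ceq_dec z z0); [contradiction|auto].
Qed.

Lemma cder_q_near : nb everywhere z0 (fun z => cder everywhere q z (q' z)).
Proof.
  apply nb_puncture.
  - rewrite q'_z0. apply cder_q_z0.
  - generalize (filter_and _ _ (nb_domain D z0) f_neq_0_near_pole). apply filter_imp.
    intros z [[Hz N] Hf]. rewrite q'_neq by auto.
    apply cder_ext with (fun z => / f z)%C.
    + now rewrite q_neq.
    + generalize (neq_open z0 everywhere z N). apply filter_imp. intros w Hw. now rewrite q_neq.
    + apply cder_inv; auto.
Qed.

(** Numerator and denominator of - f' / f^2 are multiplied by (z - z0)^2; the two pole hypotheses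
    then give the limit A / A^2. *)
Lemma q'_cont : clim (nb everywhere z0) q' (q' z0).
Proof.
  rewrite q'_z0. intros e He. apply nb_puncture.
  - rewrite q'_z0. replace (/ A - / A)%C with (RtoC 0) by ring. now rewrite Cmod_0.
  - assert (X : clim (nb D z0) (fun z => - ((z - z0) * (z - z0) * f' z) /
      (((z - z0) * f z) * ((z - z0) * f z)))%C (- - A / (A * A))%C).
    { apply clim_div; [now apply Cmult_neq_0|now apply clim_opp|now apply clim_mult]. }
    generalize (filter_and _ _ (filter_and _ _ (nb_domain D z0) f_neq_0_near_pole) (X e He)).
    apply filter_imp. intros z [[[Hz N] Hf] H]. rewrite q'_neq by auto.
    assert (Hzz := Cminus_eq_contra _ _ N).
    replace (- f' z / (f z * f z))%C with (- ((z - z0) * (z - z0) * f' z) /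
      (((z - z0) * f z) * ((z - z0) * f z)))%C by (field; auto).
    replace (/ A)%C with (- - A / (A * A))%C by (field; auto). exact H.
Qed.

Lemma q'_z0_neq_0 : q' z0 <> RtoC 0.
Proof. rewrite q'_z0. now apply Cinv_neq_0. Qed.

(** Away from z0 the map is bounded, so preimages of a large w lie near z0, where [q] takes the
    value 1/w exactly once. *)
Lemma attained_once_large : exists M, forall w, M < Cmod w -> attained_once w.
Proof.
  destruct (local_inj q q' z0 q'_z0_neq_0 cder_q_near q'_cont) as [d [Hd Hinj]].
  assert (HfD : nb everywhere z0 (fun z => UHP z /\ (z <> z0 -> f z <> RtoC 0))).
  { apply nb_puncture; [split; [auto|congruence]|].
    generalize (filter_and _ _ (nb_domain D z0) f_neq_0_near_pole). apply filter_imp.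
    intros z [[? ?] ?]. auto. }
  destruct HfD as [d1 [Hd1 HfD]].
  set (r := Rmin d d1). assert (Hr : 0 < r) by now apply Rmin_glb_lt.
  assert (L1 : r <= d) by apply Rmin_l. assert (L2 : r <= d1) by apply Rmin_r.
  destruct (local_surj q q' z0 q'_z0_neq_0 cder_q_near q'_cont r Hr) as [e [He Hs]].
  rewrite q_z0 in Hs.
  (* The bound is written 1/k so that it weakens as k decreases. *)
  destruct (gauge_UHP (fun z k => z <> z0 -> Cmod (z - z0) < r \/ Cmod (f z) <= / k)) as [k [Hk Hout]].
  { intros z k k' Hk X N. destruct (X N) as [|X']; [now left|right].
    eapply Rle_trans; [exact X'|]. apply Rinv_le_contravar; lra. }
  { intros p Hp. destruct (Ceq_dec p z0) as [->|N]; [exists r; split; auto|].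
    set (m := Cmod (f p) + 1). assert (Pm : 0 < m) by (unfold m; generalize (Cmod_ge_0 (f p)); lra).
    destruct (clim_bounded _ _ (f_closed p Hp N)) as [k [Hk X]].
    assert (Hkm : 0 < Rmin k (/ m)) by (apply Rmin_glb_lt; auto; now apply Rinv_0_lt_compat).
    exists (Rmin k (/ m)). split; auto. intros z Hz Hlt _. right. apply Rle_trans with m.
    - left. apply X; auto. eapply Rlt_le_trans; [exact Hlt|apply Rmin_l].
    - rewrite <- (Rinv_inv m) at 1. apply Rinv_le_contravar; auto. apply Rmin_r. }
  { destruct (f_inf 1 Rlt_0_1) as [M HM].
    assert (Pp : 0 < Cmod a4 + 1) by (generalize (Cmod_ge_0 a4); lra).
    exists M, (/ (Cmod a4 + 1)). split; [now apply Rinv_0_lt_compat|].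
    intros z Hz Hlt _. right. rewrite Rinv_inv. specialize (HM z Hz Hlt).
    generalize (Cmod_sub_ge (f z) a4). lra. }
  exists (Rmax (/ k) (/ e)). intros w Hw.
  assert (W1 : / k < Cmod w) by (eapply Rle_lt_trans; [apply Rmax_l|exact Hw]).
  assert (W2 : / e < Cmod w) by (eapply Rle_lt_trans; [apply Rmax_r|exact Hw]).
  assert (Pe : 0 < / e) by now apply Rinv_0_lt_compat.
  assert (Nw : w <> RtoC 0) by (intros E; rewrite E, Cmod_0 in W2; lra).
  assert (Niw := Cinv_neq_0 _ Nw).
  assert (back : forall z, Cmod (z - z0) < r -> q z = (/ w)%C -> pre w z).
  { intros z Hz E. destruct (HfD z I) as [U Hf]; [lra|].
    assert (N : z <> z0) by (intros ->; rewrite q_z0 in E; congruence).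
    rewrite q_neq in E by auto. repeat split; auto.
    rewrite <- (Cmult_1_r (f z)). rewrite <- (Cinv_l _ Nw), <- E. field. auto. }
  destruct (Hs (/ w)%C) as [z [Hz E]].
  { replace (/ w - 0)%C with (/ w)%C by ring. rewrite Cmod_inv by auto.
    rewrite <- (Rinv_inv e). apply Rinv_lt_contravar; auto. apply Rmult_lt_0_compat; lra. }
  exists z. split; [now apply back|]. intros z' [U' [N' E']].
  destruct (Hout z' U' N') as [L|L]; [|rewrite E' in L; lra].
  apply Hinj; [lra|lra|]. rewrite E, q_neq by auto. now rewrite E'.
Qed.

(** The count is transported from the large values back along the path that leads w to infinity off
    P. *)
Lemma exterior_attained_once w : exterior P (Fin w) -> attained_once w.
Proof.
  intros [p [E [Hp [HP Hinf]]]]. destruct attained_once_large as [M HM].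
  assert (X : exists b, 0 <= b /\ M < Cmod (p b)).
  { destruct (Hinf (fun x => M < x)) as [N HN]; [now exists M|].
    exists (Rmax 0 (N + 1)). split; [apply Rmax_l|]. apply HN.
    generalize (Rmax_r 0 (N + 1)). lra. }
  destruct X as [b [Hb Hlarge]]. rewrite <- E.
  apply (constant_along_path attained_once p b); auto.
  - apply attained_once_locally_constant.
  - intros s Hs. apply HP. lra.
Qed.

(** To be instantiated with the open quadrilateral and the complement of the closed one. Points of
    the polygon lie in neither; [In_toward] moves them into [In] along the segment to c. *)
Variables (In Out : C -> Prop) (c : C) (x0 : R).
Hypothesis In_off : forall w, In w -> ~ P w.
Hypothesis In_convex : forall a b (s : R), In a -> In b -> 0 <= s <= 1 -> In (a + s * (b - a))%C.
Hypothesis Out_exterior : forall w, Out w -> exterior P (Fin w).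
Hypothesis In_toward : forall w (s : R), ~ Out w -> 0 < s <= 1 -> In (w + s * (c - w))%C.
Hypothesis x0_Out : nb UHP x0 (fun z => Out (f z)).
Hypothesis x0_not_Out : ~ Out (f x0).
Hypothesis x0_sides : forall x : R, f x = f x0 -> nb UHP x (fun z => ~ In (f z)).
Hypothesis x0_inf : a4 <> f x0.

Lemma In_all_attained w1 w : In w1 -> attained w1 -> In w -> attained w.
Proof.
  intros H1 A1 H2.
  (* Clamping makes the segment a continuous path defined on all of R. *)
  set (p := fun s : R => (w + clamp 0 1 s * (w1 - w))%C).
  assert (E0 : p 0 = w).
  { unfold p. rewrite clamp_id by lra. ring. }
  assert (E1 : p 1 = w1).
  { unfold p. rewrite clamp_id by lra. ring. }
  rewrite <- E0. apply (constant_along_path attained p 1); [apply attained_locally_constant|lra| | |].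
  - intros s. apply clim_continuous. intros e He.
    set (m := Cmod (w1 - w) + 1). assert (Hm : 0 < m) by (unfold m; generalize (Cmod_ge_0 (w1 - w)); lra).
    exists (e / m). split; [now apply Rdiv_lt_0_compat|]. intros s' Hs'. unfold p.
    replace (w + clamp 0 1 s' * (w1 - w) - (w + clamp 0 1 s * (w1 - w)))%C
      with (RtoC (clamp 0 1 s' - clamp 0 1 s) * (w1 - w))%C by (rewrite RtoC_minus; ring).
    rewrite Cmod_mult, Cmod_R. generalize (clamp_lip 0 1 s s'). intros L.
    apply Rle_lt_trans with (Rabs (s' - s) * m).
    + apply Rmult_le_compat; try apply Rabs_pos; try apply Cmod_ge_0; unfold m; lra.
    + replace e with (e / m * m) by (field; lra). now apply Rmult_lt_compat_r.
  - intros s Hs. apply In_off. apply In_convex; auto. now apply clamp_in; lra.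
  - now rewrite E1.
Qed.

Lemma x0_not_attained : ~ attained (f x0).
Proof.
  intros [z [Hz [N E]]]. assert (P2 : 0 < Im z / 2) by (unfold UHP in Hz; lra).
  destruct (f_local_surj z Hz N (Im z / 2) P2) as [e [He H]]. rewrite E in H.
  assert (C0 : closed_UHP x0) by (unfold closed_UHP; simpl; lra).
  (* Height Im z / 2 separates the two preimages: one lies below it near x0, the other within Im z /
     2 of z. *)
  assert (Hlow : nb UHP x0 (fun u => Im u < Im z / 2 /\ u <> z0)).
  { apply filter_and.
    - exists (Im z / 2). split; auto. intros u _ Hu.
      generalize (im_le_Cmod (u - x0)) (Rle_abs (Im (u - x0))). destruct u; simpl. lra.
    - apply neq_open, not_eq_sym. now apply UHP_neq_R. }
  generalize (filter_and _ _ (nb_domain UHP x0) (filter_and _ _ Hlow (filter_and _ _ x0_Out (f_closed x0 C0 (not_eq_sym (UHP_neq_R _ x0 z0_UHP)) e He)))).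
  intros F. destruct (nb_UHP_proper _ C0) as [ex _].
  destruct (ex _ F) as [u [Hu [[Hu1 Hu2] [Ho Hc]]]].
  destruct (exterior_attained_once _ (Out_exterior _ Ho)) as [y [_ Hy]].
  destruct (H (f u) Hc) as [z' [Hz' Hpre]].
  assert (E1 : u = y) by (apply Hy; repeat split; auto).
  assert (E2 : z' = y) by now apply Hy.
  rewrite E2, <- E1 in Hz'. rewrite Cmod_minus_sym in Hz'.
  generalize (im_le_Cmod (z - u)) (Rle_abs (Im (z - u))). destruct z, u; simpl in *. lra.
Qed.

(* If f took a value off [Out], it would take all values in [In], in particular
   values approaching the boundary point f x0; but such preimages can
   accumulate neither inside nor at the boundary. *)
Lemma values_Out z : UHP z -> z <> z0 -> Out (f z).
Proof.
  intros Hz N. apply NNPP. intros NO.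
  assert (Small : forall w e, 0 < e -> exists s, 0 < s <= 1 /\ Cmod (w + s * (c - w) - w) < e).
  { intros w e He. set (m := Cmod (c - w) + 1).
    assert (Hm : 0 < m) by (unfold m; generalize (Cmod_ge_0 (c - w)); lra).
    assert (Hem : 0 < e / m) by now apply Rdiv_lt_0_compat.
    exists (Rmin 1 (e / m)). split; [split; [apply Rmin_glb_lt; lra|apply Rmin_l]|].
    replace (w + Rmin 1 (e / m) * (c - w) - w)%C with (Rmin 1 (e / m) * (c - w))%C by ring.
    rewrite Cmod_mult, Cmod_nonneg_R by (apply Rmin_glb; lra).
    apply Rle_lt_trans with (e / m * Cmod (c - w)).
    - apply Rmult_le_compat_r; [apply Cmod_ge_0|apply Rmin_r].
    - replace e with (e / m * m) at 2 by (field; lra). apply Rmult_lt_compat_l; [lra|unfold m; lra]. }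
  destruct (f_local_surj z Hz N 1 Rlt_0_1) as [e [He Hs]].
  (* The value f z may lie on the polygon itself; since f is open at z, a nearby value in [In] is
     also attained. *)
  destruct (Small (f z) e He) as [s [Hs1 Hs2]].
  destruct (Hs _ Hs2) as [z1 [_ Hz1]].
  assert (all := fun w => In_all_attained _ w (In_toward _ _ NO Hs1) (ex_intro _ z1 Hz1)).
  destruct (gauge_f (f x0) (fun u => ~ In (f u))) as [e' [He' H]]; auto.
  { intros p Hp Np E. destruct (closed_UHP_cases p Hp) as [U|[x ->]]; [|now apply x0_sides].
    exfalso. apply x0_not_attained. exists p. repeat split; auto. }
  destruct (Small (f x0) e' He') as [r [Hr1 Hr2]].
  assert (Ir := In_toward _ _ x0_not_Out Hr1).
  destruct (all _ Ir) as [u [U1 [U2 U3]]].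
  apply (H u U1 U2); rewrite U3; auto.
Qed.

Theorem degree_one :
  (forall w, attained w <-> exterior P (Fin w)) /\
  (forall z1 z2, UHP z1 -> UHP z2 -> z1 <> z0 -> z2 <> z0 -> f z1 = f z2 -> z1 = z2).
Proof.
  split.
  - intros w. split.
    + intros [z [Hz [N <-]]]. apply Out_exterior. now apply values_Out.
    + intros H. destruct (exterior_attained_once _ H) as [z [Hz _]]. now exists z.
  - intros z1 z2 H1 H2 N1 N2 E.
    destruct (exterior_attained_once _ (Out_exterior _ (values_Out z1 H1 N1))) as [y [_ Hy]].
    transitivity y; [|symmetry]; apply Hy; repeat split; auto.
Qed.
End Degree.

(** * The real axis *)

Definition cis (a : R) : C := Cexp (a * Ci).

Lemma cis_eq a : cis a = (cos a, sin a).
Proof.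
  unfold cis, Cexp.
  assert (E : (a * Ci)%C = (0, a)) by (apply C_ext; simpl; ring).
  rewrite E. simpl. rewrite exp_0. ring.
Qed.

Lemma Cmod_cis a : Cmod (cis a) = 1.
Proof. unfold cis. rewrite Cmod_Cexp. simpl. rewrite <- exp_0. f_equal. ring. Qed.

Lemma cis_plus a b : cis (a + b) = (cis a * cis b)%C.
Proof. unfold cis. rewrite <- Cexp_plus. f_equal. rewrite RtoC_plus. ring. Qed.

Lemma cis_conj a : Cconj (cis a) = cis (- a).
Proof. rewrite !cis_eq. rewrite cos_neg, sin_neg. reflexivity. Qed.

Lemma cis_0 : cis 0 = RtoC 1.
Proof. rewrite cis_eq, cos_0, sin_0. reflexivity. Qed.

Lemma cis_conj_l a : (Cconj (cis a) * cis a)%C = RtoC 1.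
Proof. rewrite cis_conj, <- cis_plus, <- cis_0. f_equal. ring. Qed.

Lemma Clog_pos r : 0 < r -> Clog (RtoC r) = RtoC (ln r).
Proof.
  intros Hr. unfold Clog, Carg. rewrite Cmod_nonneg_R by lra. simpl.
  destruct (Rle_dec 0 0) as [_|N]; [|lra].
  unfold Rdiv. rewrite Rinv_r, acos_1 by lra. reflexivity.
Qed.

Lemma Clog_neg r : r < 0 -> Clog (RtoC r) = (RtoC (ln (- r)) + PI * Ci)%C.
Proof.
  intros Hr. unfold Clog, Carg. rewrite Cmod_R, Rabs_left by lra. simpl.
  destruct (Rle_dec 0 0) as [_|N]; [|lra].
  replace (r / - r) with (-(1)) by (field; lra). rewrite acos_opp, acos_1.
  apply C_ext; simpl; ring.
Qed.

Lemma Cpower_Rpower r (a : R) : 0 < r -> Cpower r a = RtoC (Rpower r a).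
Proof.
  intros Hr. rewrite Cpower_exp by (apply RtoC_neq_0; lra).
  rewrite Clog_pos, <- RtoC_mult, Cexp_R by auto. reflexivity.
Qed.

Lemma Cpower_nonneg r (a : R) : 0 <= r -> Cpower r a = RtoC (Cmod (Cpower r a)).
Proof.
  intros Hr. destruct (Req_dec r 0) as [->|N].
  - now rewrite Cpower_0, Cmod_0.
  - rewrite Cpower_Rpower by lra. rewrite Cmod_nonneg_R; auto. left; apply exp_pos.
Qed.

Lemma Cpower_nonpos r (a : R) : r <= 0 ->
  Cpower r a = (cis (PI * a) * RtoC (Cmod (Cpower r a)))%C.
Proof.
  intros Hr. destruct (Req_dec r 0) as [->|N].
  - rewrite Cpower_0, Cmod_0. ring.
  - assert (N' : RtoC r <> RtoC 0) by now apply RtoC_neq_0.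
    rewrite Cmod_Cpower, Cmod_R, Rabs_left by (auto; lra).
    rewrite Cpower_exp, Clog_neg by (auto; lra). unfold cis, Rpower.
    rewrite <- Cexp_R, <- Cexp_plus. f_equal. rewrite !RtoC_mult. ring.
Qed.

Lemma Cpower_low_real (r a : R) : Cpower_low r a = Cconj (Cpower r a).
Proof. unfold Cpower_low. now rewrite !Cconj_RtoC. Qed.

Lemma Cpower_low_nonneg r (a : R) : 0 <= r -> Cpower_low r a = RtoC (Cmod (Cpower_low r a)).
Proof.
  intros Hr. rewrite Cpower_low_real, Cmod_conj, Cpower_nonneg, Cconj_RtoC by auto.
  rewrite Cmod_nonneg_R; auto. apply Cmod_ge_0.
Qed.

Lemma Cpower_low_nonpos r (a : R) : r <= 0 ->
  Cpower_low r a = (cis (- (PI * a)) * RtoC (Cmod (Cpower_low r a)))%C.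
Proof.
  intros Hr. rewrite Cpower_low_real, Cmod_conj. rewrite (Cpower_nonpos r a Hr) at 1.
  rewrite Cmult_conj, cis_conj, Cconj_RtoC. reflexivity.
Qed.

Lemma closed_UHP_R (x : R) : closed_UHP x.
Proof. unfold closed_UHP; simpl; lra. Qed.

Lemma one_minus_R (x : R) : (1 - x)%C = RtoC (1 - x).
Proof. now rewrite RtoC_minus. Qed.

Lemma one_minus_div_R (t x : R) : t <> 0 -> (1 - x / t)%C = RtoC (1 - x / t).
Proof. intros Ht. now rewrite RtoC_minus, RtoC_div. Qed.

Lemma one_minus_div_nonneg t x : 0 < t -> x <= t -> 0 <= 1 - x / t.
Proof.
  intros Ht H. assert (x / t <= 1); [|lra]. apply Rmult_le_reg_r with t; [lra|].
  unfold Rdiv. rewrite Rmult_assoc, Rinv_l; lra.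
Qed.

Lemma one_minus_div_nonpos t x : 0 < t -> t <= x -> 1 - x / t <= 0.
Proof.
  intros Ht H. assert (1 <= x / t); [|lra]. apply Rmult_le_reg_r with t; [lra|].
  unfold Rdiv. rewrite Rmult_assoc, Rinv_l; lra.
Qed.

Section RealAxis.
Variables alpha beta gamma delta t : R.
Hypotheses (ha : 0 < alpha < 1) (hb : 0 < beta < 1) (hg : 0 < gamma < 1)
  (hd : 0 < delta < 1) (hsum : alpha + beta + gamma + delta = 2) (ht : 1 < t).
Variable z0 : C.
Hypotheses (hz0 : UHP z0).

Let g := integrand alpha beta gamma t z0.

(** For real x the two quadratic factors are conjugate, so the denominator is the positive number |1
    - x/z0|^4. *)
Definition denom (x : R) : R := (Cmod (1 - x / z0) ^ 2) ^ 2.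

Lemma one_minus_neq_0 (x : R) : (1 - x / z0)%C <> RtoC 0.
Proof.
  intros E. apply (UHP_neq_R _ x hz0). assert (N := UHP_neq_0 _ hz0).
  replace z0 with (z0 * (1 - x / z0) + x)%C at 1 by (field; auto). rewrite E. ring.
Qed.

Lemma denom_pos x : 0 < denom x.
Proof. unfold denom. do 2 apply pow_lt. apply Cmod_pos, one_minus_neq_0. Qed.

Lemma denom_eq (x : R) : ((1 - x / z0) ^ 2 * (1 - x / Cconj z0) ^ 2)%C = RtoC (denom x).
Proof.
  assert (N := UHP_neq_0 _ hz0).
  assert (E : (1 - x / Cconj z0)%C = Cconj (1 - x / z0)).
  { rewrite Cminus_conj, Cdiv_conj, !Cconj_RtoC; auto. }
  rewrite E. unfold denom. rewrite RtoC_pow, Cmod2_conj. simpl. ring.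
Qed.

(** An argument is expressed as w = p |w|, which remains meaningful at the branch points, where w =
    0. The intervals can thus be taken closed. *)
Lemma integrand_phase (x : R) p1 p2 p3 :
  Cpower x alpha = (p1 * RtoC (Cmod (Cpower x alpha)))%C ->
  Cpower_low (1 - x) beta = (p2 * RtoC (Cmod (Cpower_low (1 - x) beta)))%C ->
  Cpower_low (1 - x / t) gamma = (p3 * RtoC (Cmod (Cpower_low (1 - x / t) gamma)))%C ->
  g x = (p1 * p2 * p3 * RtoC (Cmod (g x)))%C.
Proof.
  intros E1 E2 E3. unfold g, integrand. rewrite denom_eq.
  assert (Dp := denom_pos x). assert (Dn := RtoC_neq_0 _ (Rgt_not_eq _ _ Dp)).
  rewrite Cmod_div, !Cmod_mult by auto. rewrite (Cmod_nonneg_R (denom x)) by lra.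
  rewrite E1, E2, E3 at 1. rewrite RtoC_div, !RtoC_mult by lra. field. auto.
Qed.

Ltac phase := rewrite ?one_minus_R, ?one_minus_div_R by lra;
  first [rewrite Cmult_1_l; first [apply Cpower_nonneg|apply Cpower_low_nonneg]
        | apply Cpower_nonpos | apply Cpower_low_nonpos];
  try lra; try (apply one_minus_div_nonneg; lra); try (apply one_minus_div_nonpos; lra).

Lemma integrand_neg (x : R) : x <= 0 -> g x = (cis (PI * alpha) * RtoC (Cmod (g x)))%C.
Proof.
  intros Hx. rewrite (integrand_phase x (cis (PI * alpha)) 1 1) at 1; [ring|phase..].
Qed.

Lemma integrand_01 (x : R) : 0 <= x <= 1 -> g x = (cis 0 * RtoC (Cmod (g x)))%C.
Proof.
  intros Hx. rewrite (integrand_phase x 1 1 1) at 1; [rewrite cis_0; ring|phase..].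
Qed.

Lemma integrand_1t (x : R) : 1 <= x <= t -> g x = (cis (- (PI * beta)) * RtoC (Cmod (g x)))%C.
Proof.
  intros Hx. rewrite (integrand_phase x 1 (cis (- (PI * beta))) 1) at 1; [ring|phase..].
Qed.

Lemma integrand_t_inf (x : R) : t <= x ->
  g x = (cis (- (PI * (beta + gamma))) * RtoC (Cmod (g x)))%C.
Proof.
  intros Hx. rewrite (integrand_phase x 1 (cis (- (PI * beta))) (cis (- (PI * gamma)))) at 1; [|phase..].
  replace (- (PI * (beta + gamma))) with (- (PI * beta) + - (PI * gamma)) by ring.
  rewrite cis_plus. ring.
Qed.

Lemma integrand_pos (x : R) : x <> 0 -> x <> 1 -> x <> t -> 0 < Cmod (g x).
Proof.
  intros N0 N1 Nt. apply Cmod_pos. unfold g, integrand. rewrite denom_eq.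
  assert (Dp := denom_pos x). assert (Dn := RtoC_neq_0 _ (Rgt_not_eq _ _ Dp)).
  rewrite one_minus_R, one_minus_div_R by lra.
  assert (M1 : RtoC (1 - x) <> RtoC 0) by (apply RtoC_neq_0; lra).
  assert (Mt : RtoC (1 - x / t) <> RtoC 0).
  { apply RtoC_neq_0. intros E. apply Nt. replace x with (t * (x / t)) by (field; lra).
    replace (x / t) with 1 by lra. ring. }
  repeat apply Cmult_neq_0; try now apply Cpower_low_neq_0.
  - now apply Cpower_neq_0, RtoC_neq_0.
  - now apply Cinv_neq_0.
Qed.

Lemma continuous_Cmod_integrand (x : R) : continuous (fun x : R => Cmod (g x)) x.
Proof.
  assert (N : RtoC x <> z0) by (intros E; symmetry in E; revert E; now apply UHP_neq_R).
  generalize (clim_Cmod _ _ (clim_integrand alpha beta gamma t ha hb hg ht z0 hz0 x (closed_UHP_R x) N)).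
  fold g. intros H. apply continuity_pt_filterlim, continuity_pt_locally. intros e.
  destruct (H e (cond_pos e)) as [d [Hd X]]. exists (mkposreal d Hd). intros y Hy.
  specialize (X (RtoC y) (closed_UHP_R y)). rewrite <- !RtoC_minus, !Cmod_R in X. now apply X.
Qed.

Variable H : C -> C.
Hypothesis H_der : forall p, closed_UHP p -> p <> z0 -> cder closed_UHP H p (g p).

Lemma is_RInt_integrand (a b : R) : a <= b ->
  is_RInt (V := C_R_NormedModule) (fun x : R => g x) a b (H b - H a)%C.
Proof.
  intros Hab.
  assert (E : forall w : C, (0 + w * 1)%C = w) by (intros; ring).
  apply (is_RInt_ext (fun s : R => (g (0 + s * 1) * 1)%C)).
  { intros s _. now rewrite E, Cmult_1_r. }
  rewrite <- (E a) at 1. rewrite <- (E b) at 1.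
  assert (NR : forall s : R, RtoC s <> z0) by (intros s E'; symmetry in E'; revert E'; now apply UHP_neq_R).
  replace (H (0 + b * 1) - H (0 + a * 1))%C with (H b - H a)%C by (now rewrite !E).
  generalize (is_RInt_line closed_UHP H g 0 1 a b). rewrite !E. intros X. apply X; auto.
  - intros s _. rewrite E. apply closed_UHP_R.
  - intros s _. rewrite E. apply H_der; auto. apply closed_UHP_R.
  - intros s _. rewrite E. apply (clim_integrand alpha beta gamma t); auto. apply closed_UHP_R.
Qed.

(** After rotation by the conjugate phase the integrand is real, so the increment of H is the phase
    times a real integral. *)
Lemma is_RInt_Cmod_integrand (a b th : R) : a <= b ->
  (forall x, a <= x <= b -> g x = (cis th * RtoC (Cmod (g x)))%C) ->
  exists r, is_RInt (fun x : R => Cmod (g x)) a b r /\ (H b - H a)%C = (cis th * RtoC r)%C.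
Proof.
  intros Hab Hph.
  generalize (is_RInt_Cscal _ _ _ _ (Cconj (cis th)) (is_RInt_integrand a b Hab)). intros J.
  assert (J' : is_RInt (V := C_R_NormedModule) (fun x => RtoC (Cmod (g x))) a b
    (Cconj (cis th) * (H b - H a))%C).
  { eapply is_RInt_ext; [|exact J]. rewrite Rmin_left, Rmax_right by auto. intros x Hx.
    rewrite (Hph x) at 1 by lra. rewrite Cmult_assoc, cis_conj_l. now rewrite Cmult_1_l. }
  set (v := (Cconj (cis th) * (H b - H a))%C) in *.
  generalize (is_RInt_fct_extend_fst _ _ _ _ J') (is_RInt_fct_extend_snd _ _ _ _ J').
  cbn [fst snd RtoC]. intros J1 J2.
  exists (Re v). split; [exact J1|].
  assert (Im v = 0).
  { generalize (is_RInt_unique _ _ _ _ J2). rewrite RInt_const.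
    unfold scal; simpl; unfold mult; simpl. rewrite Rmult_0_r. intros <-. reflexivity. }
  transitivity (cis th * v)%C.
  - unfold v. rewrite Cmult_assoc, (Cmult_comm (cis th)), cis_conj_l. ring.
  - f_equal. apply C_ext; simpl; auto.
Qed.

Lemma increment (a b th : R) : a < b ->
  (forall x, a <= x <= b -> g x = (cis th * RtoC (Cmod (g x)))%C) ->
  (forall x, a < x < b -> x <> 0 /\ x <> 1 /\ x <> t) ->
  exists r, 0 < r /\ is_RInt (fun x : R => Cmod (g x)) a b r /\ (H b - H a)%C = (cis th * RtoC r)%C.
Proof.
  intros Hab Hph Hx. destruct (is_RInt_Cmod_integrand a b th) as [r [Hr E]]; [lra|auto|].
  exists r. split; [|split; auto]. rewrite <- (is_RInt_unique _ _ _ _ Hr).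
  apply RInt_gt_0; auto.
  - intros x Hx'. destruct (Hx x Hx') as [? [? ?]]. now apply integrand_pos.
  - intros x _. apply continuous_Cmod_integrand.
Qed.

Variable L : C.
Hypothesis H_inf : forall e, 0 < e -> exists M, forall z, closed_UHP z -> M < Cmod z -> Cmod (H z - L) < e.

(** The sign [s] selects the end of the real axis. The rotated increments are real and converge, so
    the rotated limit is real. *)
Lemma increment_limit (x s th : R) : (s = 1 \/ s = -1) ->
  (forall y, 0 < y -> exists r, 0 < r /\ (H (x + s * y)%R - H x)%C = (cis th * RtoC r)%C) ->
  (forall y y', 0 < y < y' -> exists r, 0 < r /\ (H (x + s * y')%R - H (x + s * y)%R)%C = (cis th * RtoC r)%C) ->
  exists r, 0 < r /\ (L - H x)%C = (cis th * RtoC r)%C.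
Proof.
  intros Hs H1 H2.
  (* The increments grow with the distance from x, so m, the one at distance 1, bounds the later
     ones from below and keeps the limit positive. *)
  destruct (H1 1 Rlt_0_1) as [m [Hm Em]].
  set (v := (Cconj (cis th) * (L - H x))%C).
  assert (app : forall e, 0 < e -> exists r, m <= r /\ Cmod (RtoC r - v) < e).
  { intros e He. destruct (H_inf e He) as [M HM].
    set (y := Rabs M + Rabs x + 2).
    assert (Hy : 1 < y) by (unfold y; generalize (Rabs_pos M) (Rabs_pos x); lra).
    destruct (H2 1 y ltac:(lra)) as [r [Hr Er]].
    exists (m + r). split; [lra|].
    replace (RtoC (m + r) - v)%C with (Cconj (cis th) * (H (x + s * y)%R - L))%C.
    - rewrite Cmod_mult, Cmod_conj, Cmod_cis, Rmult_1_l. apply HM; [apply closed_UHP_R|].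
      rewrite Cmod_R. generalize (Rle_abs M) (Rle_abs x) (Rle_abs (- x)).
      rewrite (Rabs_Ropp x). intros.
      generalize (Rle_abs (x + s * y)) (Rle_abs (- (x + s * y))). rewrite Rabs_Ropp.
      destruct Hs as [-> | ->]; unfold y in *; lra.
    - unfold v.
      replace (H (x + s * y)%R - L)%C with ((H (x + s * y)%R - H (x + s * 1)%R) +
        (H (x + s * 1)%R - H x) - (L - H x))%C by ring.
      rewrite Er, Em, RtoC_plus.
      replace (Cconj (cis th) * (cis th * r + cis th * m - (L - H x)))%C with
        (Cconj (cis th) * cis th * (r + m) - Cconj (cis th) * (L - H x))%C by ring.
      rewrite cis_conj_l. ring. }
  exists (Re v). split.
  - destruct (app m Hm) as [r [Hr Hv]].
    destruct (app (m / 2) ltac:(lra)) as [r' [Hr' Hv']].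
    generalize (re_le_Cmod (r' - v)). intros R1. assert (R2 : Rabs (Re (r' - v)) < m / 2) by lra.
    apply Rabs_def2 in R2. destruct v; simpl in *. lra.
  - transitivity (cis th * v)%C.
    + unfold v. rewrite Cmult_assoc, (Cmult_comm (cis th)), cis_conj_l. ring.
    + f_equal. apply C_ext; simpl; auto.
      apply Rminus_diag_uniq. rewrite Rminus_0_r. apply NNPP. intros N.
      assert (Pv : 0 < Rabs (Im v)) by now apply Rabs_pos_lt.
      destruct (app _ Pv) as [r [_ Hv]].
      generalize (im_le_Cmod (r - v)).
      replace (Im (r - v)) with (- Im v) by (destruct v; simpl; ring). rewrite Rabs_Ropp. lra.
Qed.

Lemma limit_right (x : R) : t <= x -> exists r, 0 < r /\ (L - H x)%C = (cis (- (PI * (beta + gamma))) * RtoC r)%C.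
Proof.
  intros Hx. apply (increment_limit x 1); [now left| |].
  - intros y Hy. destruct (increment x (x + 1 * y) (- (PI * (beta + gamma)))) as [r [Hr [_ E]]]; try lra.
    + intros u Hu. apply integrand_t_inf; lra.
    + intros u Hu. lra.
    + eauto.
  - intros y y' Hy. destruct (increment (x + 1 * y) (x + 1 * y') (- (PI * (beta + gamma)))) as [r [Hr [_ E]]]; try lra.
    + intros u Hu. apply integrand_t_inf; lra.
    + intros u Hu. lra.
    + eauto.
Qed.

Lemma limit_left (x : R) : x <= 0 -> exists r, 0 < r /\ (L - H x)%C = (- (cis (PI * alpha) * RtoC r))%C.
Proof.
  intros Hx.
  (* The half-line is traversed towards minus infinity, which reverses the direction. *)
  assert (CP : (cis (PI * alpha + PI))%C = (- cis (PI * alpha))%C).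
  { rewrite cis_plus, (cis_eq PI), cos_PI, sin_PI. destruct (cis (PI * alpha)); apply C_ext; simpl; ring. }
  destruct (increment_limit x (-1) (PI * alpha + PI)) as [r [Hr E]]; [now right| | |].
  - intros y Hy. destruct (increment (x + -1 * y) x (PI * alpha)) as [r [Hr [_ E]]]; try lra.
    + intros u Hu. apply integrand_neg; lra.
    + intros u Hu. lra.
    + exists r. split; auto. rewrite CP.
      replace (H (x + -1 * y)%R - H x)%C with (- (H x - H (x + -1 * y)%R))%C by ring. rewrite E. ring.
  - intros y y' Hy. destruct (increment (x + -1 * y') (x + -1 * y) (PI * alpha)) as [r [Hr [_ E]]]; try lra.
    + intros u Hu. apply integrand_neg; lra.
    + intros u Hu. lra.
    + exists r. split; auto. rewrite CP.
      replace (H (x + -1 * y')%R - H (x + -1 * y)%R)%C with (- (H (x + -1 * y)%R - H (x + -1 * y')%R))%C by ring.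
      rewrite E. ring.
  - exists r. split; auto. rewrite E, CP. ring.
Qed.
End RealAxis.

(** * The quadrilateral *)

(* Signed distance, positive on the left of the unit vector e. *)
Definition side_dist (e a w : C) : R := Im (Cconj e * (w - a)).

Lemma side_dist_affine e a w v (s : R) :
  side_dist e a (w + s * (v - w)) = (1 - s) * side_dist e a w + s * side_dist e a v.
Proof. unfold side_dist. destruct e, a, w, v; simpl. ring. Qed.

Lemma side_dist_base e a b (r : R) : b = (a + e * r)%C -> forall w, side_dist e b w = side_dist e a w.
Proof. intros -> w. unfold side_dist. destruct e, a, w; simpl. ring. Qed.

Lemma side_dist_on e a (r : R) : side_dist e a (a + e * r) = 0.
Proof. unfold side_dist. destruct e, a; simpl. ring. Qed.

(** Positions of vertices relative to side lines become sines of angle differences. *)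
Lemma side_dist_cis th ph a (r : R) : side_dist (cis th) a (a + cis ph * r) = r * sin (ph - th).
Proof. unfold side_dist. rewrite !cis_eq, sin_minus. destruct a; simpl. ring. Qed.

Lemma side_dist_normal th a w (s : R) :
  side_dist (cis th) a (w + s * (- Ci * cis th)) = side_dist (cis th) a w - s.
Proof.
  unfold side_dist. rewrite !cis_eq. destruct a, w; simpl.
  generalize (sin2_cos2 th). unfold Rsqr. intros E.
  match goal with |- ?l = ?r - s => replace l with (r - s * (sin th * sin th + cos th * cos th)) end.
  - rewrite E. ring.
  - ring.
Qed.

Lemma segment_affine a b z : segment a b z -> exists s : R, 0 <= s <= 1 /\ z = (a + s * (b - a))%C.
Proof. intros [s [Hs ->]]. exists s. split; auto. rewrite <- RtoC_minus. rewrite RtoC_minus. ring. Qed.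

(** A point strictly to the right of a supporting line escapes along the right-hand normal, on which
    the signed distance keeps decreasing. *)
Lemma exterior_ray (P : C -> Prop) e a w : (exists th, e = cis th) ->
  (forall v, P v -> 0 <= side_dist e a v) -> side_dist e a w < 0 -> exterior P (Fin w).
Proof.
  intros [th ->] HP Hw. set (n := (- Ci * cis th)%C).
  assert (Mn : Cmod n = 1).
  { unfold n. rewrite Cmod_mult, Cmod_opp, Cmod_Ci, Cmod_cis. ring. }
  exists (fun s => w + s * n)%C. split; [ring|split; [|split]].
  - intros s. apply clim_continuous. intros e He. exists e; split; auto. intros s' Hs'.
    replace (w + s' * n - (w + s * n))%C with (RtoC (s' - s) * n)%C by (rewrite RtoC_minus; ring).
    rewrite Cmod_mult, Mn, Cmod_R. lra.
  - intros s Hs HPs. apply HP in HPs. unfold n in HPs. rewrite side_dist_normal in HPs. lra.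
  - intros Q [M HM]. exists (M + Cmod w). intros s Hs. apply HM.
    generalize (Cmod_sub_ge (s * n) (- w)). rewrite Cmod_opp, Cmod_mult, Mn, Cmod_R, Rmult_1_r.
    replace (s * n - - w)%C with (w + s * n)%C by ring. generalize (Rle_abs s). lra.
Qed.

Section Quadrilateral.
Variables alpha beta gamma delta : R.
Hypotheses (ha : 0 < alpha < 1) (hb : 0 < beta < 1) (hg : 0 < gamma < 1)
  (hd : 0 < delta < 1) (hsum : alpha + beta + gamma + delta = 2).
Variables l2 l3 l4 : R.
Hypotheses (hl2 : 0 < l2) (hl3 : 0 < l3) (hl4 : 0 < l4).

(* The polygon A1 A2 A3 A4 is traversed clockwise and the e_k point backwards
   along its sides, so that its interior is on the left of each of them. *)
Let e1 := cis 0.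
Let e2 := cis (- (PI * beta)).
Let e3 := cis (- (PI * (beta + gamma))).
Let e4 := cis (PI * alpha).
Let A1 := RtoC 1.
Let A2 := RtoC 0.
Let A3 := (- (e2 * l2))%C.
Let A4 := (A3 - e3 * l3)%C.
Hypothesis closed : A4 = (1 + e4 * l4)%C.

Lemma sin_PI_pos a : 0 < a < 1 -> 0 < sin (PI * a).
Proof.
  intros Ha. assert (P := PI_RGT_0). apply sin_gt_0.
  - apply Rmult_lt_0_compat; lra.
  - rewrite <- (Rmult_1_r PI) at 2. apply Rmult_lt_compat_l; lra.
Qed.

Lemma sin_two_PI_minus a b : a = 2 - b -> sin (PI * a) = - sin (PI * b).
Proof.
  intros ->. replace (PI * (2 - b)) with (- (PI * b) + 2 * PI) by ring.
  rewrite sin_2PI_neg || rewrite sin_plus, sin_2PI, cos_2PI, sin_neg; ring.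
Qed.

(** The component of the closing relation orthogonal to [e4] eliminates l4; up to sign, l3 has the
    coefficient sin (PI delta) there. *)
Lemma side_length_3 : l3 = (sin (PI * alpha) + l2 * sin (PI * (alpha + beta))) / sin (PI * delta).
Proof.
  assert (Sd := sin_PI_pos delta hd).
  assert (E : Im (Cconj e4 * (A3 - e3 * l3)) = Im (Cconj e4 * (1 + e4 * l4))) by (now rewrite <- closed).
  unfold A3, e2, e3, e4 in E. rewrite !cis_eq in E. simpl in E.
  assert (S1 : sin (PI * (alpha + beta)) = sin (PI * alpha) * cos (PI * beta) + cos (PI * alpha) * sin (PI * beta)).
  { rewrite <- sin_plus. f_equal. ring. }
  assert (S2 : - sin (PI * delta) = sin (PI * alpha) * cos (PI * (beta + gamma)) + cos (PI * alpha) * sin (PI * (beta + gamma))).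
  { rewrite <- (sin_two_PI_minus (alpha + beta + gamma)) by lra. rewrite <- sin_plus. f_equal. ring. }
  rewrite !cos_neg, !sin_neg in E.
  apply Rmult_eq_reg_r with (sin (PI * delta)); [|lra].
  unfold Rdiv. rewrite Rmult_assoc, Rinv_l, Rmult_1_r by lra.
  replace (sin (PI * delta)) with (- (sin (PI * alpha) * cos (PI * (beta + gamma)) + cos (PI * alpha) * sin (PI * (beta + gamma)))) by lra.
  rewrite S1. lra.
Qed.

(** The component orthogonal to [e3] eliminates l3; up to sign, l4 has the coefficient sin (PI
    delta). *)
Lemma side_length_4 : l4 = (sin (PI * (beta + gamma)) + l2 * sin (PI * gamma)) / sin (PI * delta).
Proof.
  assert (Sd := sin_PI_pos delta hd).
  assert (E : Im (Cconj e3 * (A3 - e3 * l3)) = Im (Cconj e3 * (1 + e4 * l4))) by (now rewrite <- closed).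
  unfold A3, e2, e3, e4 in E. rewrite !cis_eq in E. simpl in E.
  assert (S1 : sin (PI * gamma) = sin (PI * (beta + gamma)) * cos (PI * beta) - cos (PI * (beta + gamma)) * sin (PI * beta)).
  { rewrite <- sin_minus. f_equal. ring. }
  assert (S2 : - sin (PI * delta) = sin (PI * alpha) * cos (PI * (beta + gamma)) + cos (PI * alpha) * sin (PI * (beta + gamma))).
  { rewrite <- (sin_two_PI_minus (alpha + beta + gamma)) by lra. rewrite <- sin_plus. f_equal. ring. }
  rewrite !cos_neg, !sin_neg in E.
  apply Rmult_eq_reg_r with (sin (PI * delta)); [|lra].
  unfold Rdiv. rewrite Rmult_assoc, Rinv_l, Rmult_1_r by lra.
  replace (sin (PI * delta)) with (- (sin (PI * alpha) * cos (PI * (beta + gamma)) + cos (PI * alpha) * sin (PI * (beta + gamma)))) by lra.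
  rewrite S1. lra.
Qed.

Let L1 := side_dist e1 A1.
Let L2 := side_dist e2 A2.
Let L3 := side_dist e3 A3.
Let L4 := side_dist e4 A1.

Lemma L3_A4 w : L3 w = side_dist e3 A4 w.
Proof.
  symmetry. apply (side_dist_base e3 A3 A4 (- l3)). unfold A4. rewrite RtoC_opp. ring.
Qed.

Lemma L4_A4 w : L4 w = side_dist e4 A4 w.
Proof. symmetry. apply (side_dist_base e4 A1 A4 l4). exact closed. Qed.

(** This lemma and the next three express convexity. A vertex adjacent to a side line but off it has
    as distance a side length times the sine of PI times one of the four exponents, which is the
    sine of an interior angle. *)
Lemma vertices_L1 : L1 A1 = 0 /\ L1 A2 = 0 /\ 0 < L1 A3 /\ 0 < L1 A4.
Proof.
  assert (Sb := sin_PI_pos beta hb). assert (Sa := sin_PI_pos alpha ha).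
  unfold L1, side_dist, e1, A1, A2. rewrite cis_0. repeat split.
  - simpl. ring.
  - simpl. ring.
  - unfold A3, e2. rewrite cis_eq, cos_neg, sin_neg. simpl.
    assert (0 < l2 * sin (PI * beta)) by now apply Rmult_lt_0_compat. lra.
  - rewrite closed. unfold e4. rewrite cis_eq. simpl.
    assert (0 < l4 * sin (PI * alpha)) by now apply Rmult_lt_0_compat. lra.
Qed.

Lemma vertices_L2 : 0 < L2 A1 /\ L2 A2 = 0 /\ L2 A3 = 0 /\ 0 < L2 A4.
Proof.
  assert (Sb := sin_PI_pos beta hb). assert (Sg := sin_PI_pos gamma hg).
  repeat split.
  - unfold L2, side_dist, e2, A1, A2. rewrite cis_eq, cos_neg, sin_neg. simpl. lra.
  - unfold L2, side_dist, A2. destruct e2; simpl; ring.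
  - replace A3 with (A2 + e2 * RtoC (- l2))%C by (unfold A3, A2; rewrite RtoC_opp; ring).
    apply side_dist_on.
  - rewrite <- (side_dist_base e2 A2 A3 (- l2)) by (unfold A3, A2; rewrite RtoC_opp; ring).
    replace A4 with (A3 + e3 * RtoC (- l3))%C by (unfold A4; rewrite RtoC_opp; ring).
    unfold e2, e3. rewrite side_dist_cis.
    replace (- (PI * (beta + gamma)) - - (PI * beta)) with (- (PI * gamma)) by ring.
    rewrite sin_neg. assert (0 < l3 * sin (PI * gamma)) by now apply Rmult_lt_0_compat. lra.
Qed.

Lemma vertices_L3 : 0 < L3 A1 /\ 0 < L3 A2 /\ L3 A3 = 0 /\ L3 A4 = 0.
Proof.
  assert (Sd := sin_PI_pos delta hd). assert (Sg := sin_PI_pos gamma hg).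
  repeat split.
  - rewrite L3_A4. replace A1 with (A4 + e4 * RtoC (- l4))%C by (rewrite closed, RtoC_opp; unfold A1; ring).
    unfold e3, e4. rewrite side_dist_cis.
    replace (PI * alpha - - (PI * (beta + gamma))) with (PI * (alpha + beta + gamma)) by ring.
    rewrite (sin_two_PI_minus _ delta) by lra.
    assert (0 < l4 * sin (PI * delta)) by now apply Rmult_lt_0_compat. lra.
  - replace A2 with (A3 + e2 * l2)%C by (unfold A3, A2; ring).
    unfold L3, e3, e2. rewrite side_dist_cis.
    replace (- (PI * beta) - - (PI * (beta + gamma))) with (PI * gamma) by ring.
    now apply Rmult_lt_0_compat.
  - unfold L3, side_dist. destruct e3, A3; simpl; ring.
  - rewrite L3_A4. unfold side_dist. destruct e3, A4; simpl; ring.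
Qed.

Lemma vertices_L4 : L4 A1 = 0 /\ 0 < L4 A2 /\ 0 < L4 A3 /\ L4 A4 = 0.
Proof.
  assert (Sd := sin_PI_pos delta hd). assert (Sa := sin_PI_pos alpha ha).
  repeat split.
  - unfold L4, side_dist. destruct e4, A1; simpl; ring.
  - unfold L4, side_dist, e4, A1, A2. rewrite cis_eq. simpl. lra.
  - rewrite L4_A4. replace A3 with (A4 + e3 * l3)%C by (unfold A4; ring).
    unfold e4, e3. rewrite side_dist_cis.
    replace (- (PI * (beta + gamma)) - PI * alpha) with (- (PI * (alpha + beta + gamma))) by ring.
    rewrite sin_neg, (sin_two_PI_minus _ delta) by lra.
    rewrite Ropp_involutive. now apply Rmult_lt_0_compat.
  - rewrite L4_A4. unfold side_dist. destruct e4, A4; simpl; ring.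
Qed.

Let P := closed_polyline4 A1 A2 A3 A4.

(** Both this and [outside] use strict inequalities, so points of the polygon satisfy neither. *)
Definition inside (w : C) : Prop := 0 < L1 w /\ 0 < L2 w /\ 0 < L3 w /\ 0 < L4 w.
Definition outside (w : C) : Prop := L1 w < 0 \/ L2 w < 0 \/ L3 w < 0 \/ L4 w < 0.

Lemma polyline_side (e a : C) :
  0 <= side_dist e a A1 -> 0 <= side_dist e a A2 -> 0 <= side_dist e a A3 -> 0 <= side_dist e a A4 ->
  forall v, P v -> 0 <= side_dist e a v.
Proof.
  intros H1 H2 H3 H4 v Hv.
  assert (cv : forall x y z, segment x y z -> 0 <= side_dist e a x -> 0 <= side_dist e a y ->
    0 <= side_dist e a z).
  { intros x y z Hz Hx Hy. destruct (segment_affine _ _ _ Hz) as [s [Hs ->]].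
    rewrite side_dist_affine.
    assert (0 <= (1 - s) * side_dist e a x) by (apply Rmult_le_pos; lra).
    assert (0 <= s * side_dist e a y) by (apply Rmult_le_pos; lra). lra. }
  destruct Hv as [Hv|[Hv|[Hv|Hv]]]; eapply cv; eauto.
Qed.

Lemma outside_exterior w : outside w -> exterior P (Fin w).
Proof.
  destruct vertices_L1 as [K11 [K12 [K13 K14]]], vertices_L2 as [K21 [K22 [K23 K24]]],
    vertices_L3 as [K31 [K32 [K33 K34]]], vertices_L4 as [K41 [K42 [K43 K44]]].
  unfold L1, L2, L3, L4 in *.
  intros [H'|[H'|[H'|H']]];
    (eapply exterior_ray; [| |exact H']; [eexists; reflexivity|apply polyline_side; lra]).
Qed.

Lemma inside_off w : inside w -> ~ P w.
Proof.
  destruct vertices_L1 as [K11 [K12 [K13 K14]]], vertices_L2 as [K21 [K22 [K23 K24]]],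
    vertices_L3 as [K31 [K32 [K33 K34]]], vertices_L4 as [K41 [K42 [K43 K44]]].
  unfold L1, L2, L3, L4 in *.
  intros [H1 [H2' [H3' H4']]] [Hv|[Hv|[Hv|Hv]]]; destruct (segment_affine _ _ _ Hv) as [s [Hs ->]];
  unfold L1, L2, L3, L4 in *; rewrite !side_dist_affine in *.
  - rewrite K11, K12 in H1. lra.
  - rewrite K22, K23 in H2'. lra.
  - rewrite K33, K34 in H3'. lra.
  - rewrite K41, K44 in H4'. lra.
Qed.

Lemma pos_comb x y (s : R) : 0 < x -> 0 < y -> 0 <= s <= 1 -> 0 < (1 - s) * x + s * y.
Proof.
  intros Hx Hy Hs. destruct (Req_dec s 0) as [->|N]; [lra|].
  assert (0 < s * y) by (apply Rmult_lt_0_compat; lra).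
  assert (0 <= (1 - s) * x) by (apply Rmult_le_pos; lra). lra.
Qed.

Lemma inside_convex a b (s : R) : inside a -> inside b -> 0 <= s <= 1 -> inside (a + s * (b - a)).
Proof.
  intros [? [? [? ?]]] [? [? [? ?]]] Hs. unfold inside, L1, L2, L3, L4 in *.
  rewrite !side_dist_affine. repeat split; now apply pos_comb.
Qed.

Definition centroid : C := ((A1 + A2 + A3 + A4) * RtoC (/ 4))%C.

Lemma side_dist_centroid e a :
  side_dist e a centroid = (side_dist e a A1 + side_dist e a A2 + side_dist e a A3 + side_dist e a A4) / 4.
Proof. unfold side_dist, centroid. destruct e, a, A1, A2, A3, A4; simpl. field. Qed.

Lemma inside_centroid : inside centroid.
Proof.
  destruct vertices_L1 as [K11 [K12 [K13 K14]]], vertices_L2 as [K21 [K22 [K23 K24]]],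
    vertices_L3 as [K31 [K32 [K33 K34]]], vertices_L4 as [K41 [K42 [K43 K44]]].
  unfold inside, L1, L2, L3, L4 in *. rewrite !side_dist_centroid. repeat split; lra.
Qed.

Lemma inside_toward w (s : R) : ~ outside w -> 0 < s <= 1 -> inside (w + s * (centroid - w)).
Proof.
  intros N Hs. destruct inside_centroid as [? [? [? ?]]].
  assert (G : forall x y, 0 <= x -> 0 < y -> 0 < (1 - s) * x + s * y).
  { intros x y Hx Hy. assert (0 < s * y) by (apply Rmult_lt_0_compat; lra).
    assert (0 <= (1 - s) * x) by (apply Rmult_le_pos; lra). lra. }
  unfold inside, outside, L1, L2, L3, L4 in *. rewrite !side_dist_affine.
  repeat split; apply G; auto; apply Rnot_lt_le; tauto.
Qed.

(** An inner point of the first side is on none of the other side lines; this decides which real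
    points can map to it. *)
Lemma side_1_interior (s : R) : 0 < s < 1 -> L1 s = 0 /\ 0 < L2 s /\ 0 < L3 s /\ 0 < L4 s.
Proof.
  intros Hs. replace (RtoC s) with (A1 + RtoC (1 - s) * (A2 - A1))%C
    by (unfold A1, A2; rewrite RtoC_minus; ring).
  destruct vertices_L1 as [K11 [K12 [K13 K14]]], vertices_L2 as [K21 [K22 [K23 K24]]],
    vertices_L3 as [K31 [K32 [K33 K34]]], vertices_L4 as [K41 [K42 [K43 K44]]].
  unfold L1, L2, L3, L4 in *. rewrite !side_dist_affine.
  rewrite K11, K12, K22, K41. replace (1 - (1 - s)) with s by ring.
  assert (Q1 : forall x, 0 < x -> 0 < s * x) by (intros; apply Rmult_lt_0_compat; lra).
  assert (Q2 : forall x, 0 < x -> 0 < (1 - s) * x) by (intros; apply Rmult_lt_0_compat; lra).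
  repeat split; try ring.
  - generalize (Q1 _ K21). lra.
  - generalize (Q1 _ K31) (Q2 _ K32). lra.
  - generalize (Q2 _ K42). lra.
Qed.

Lemma L1_Im w : L1 w = Im w.
Proof. unfold L1, side_dist, e1, A1. rewrite cis_0. destruct w; simpl. ring. Qed.
End Quadrilateral.

(** * Lauricella functions *)

(** [Cint01] is an improper integral at both ends, hence sees its integrand on (0, 1) only. If that
    extends to a continuous G, continuity of the integral of G in its end points yields the proper
    value. *)
Lemma Cint01_continuous (f G : R -> C) l :
  (forall u, 0 < u < 1 -> f u = G u) ->
  (forall u, continuous (U := C_UniformSpace) G u) ->
  is_RInt (V := C_R_NormedModule) G 0 1 l -> Cint01 f = l.
Proof.
  intros Hf HG Hl.
  assert (ex : forall a b, ex_RInt (V := C_R_NormedModule) G a b).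
  { intros a b. apply (ex_RInt_continuous (V := C_R_CompleteNormedModule)). intros; apply HG. }
  set (K := fun u => RInt (V := C_R_CompleteNormedModule) G 0 u).
  assert (HK : forall a b, is_RInt (V := C_R_NormedModule) G a b (K b - K a)%C).
  { intros a b.
    assert (I1 : is_RInt (V := C_R_NormedModule) G a 0 (opp (K a : C_R_NormedModule))).
    { apply (is_RInt_swap (V := C_R_NormedModule)). apply (RInt_correct (V := C_R_CompleteNormedModule)), ex. }
    assert (I2 : is_RInt (V := C_R_NormedModule) G 0 b (K b)).
    { apply (RInt_correct (V := C_R_CompleteNormedModule)), ex. }
    generalize (is_RInt_Chasles _ _ _ _ _ _ I1 I2). intros J.
    replace (K b - K a)%C with (plus (opp (K a) : C_R_NormedModule) (K b)); auto.
    apply C_ext; unfold plus, opp; simpl; unfold plus, opp; simpl; ring. }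
  assert (K0 : K 0 = RtoC 0) by apply (RInt_point (V := C_R_CompleteNormedModule)).
  assert (K1 : K 1 = l) by (apply (is_RInt_unique (V := C_R_CompleteNormedModule)); auto).
  assert (Kc : forall b, continuous (U := C_UniformSpace) K b).
  { intros b. apply (ex_derive_continuous (V := C_R_NormedModule)). exists (G b).
    apply (is_derive_RInt (V := C_R_NormedModule) G K 0 b); [|apply HG].
    apply filter_forall. intros x. apply (RInt_correct (V := C_R_CompleteNormedModule)), ex. }
  unfold Cint01. apply (is_RInt_gen_unique (V := C_R_CompleteNormedModule)).
  intros Q HQ. apply locally_nb in HQ. destruct HQ as [e [He HQ]].
  assert (He2 : 0 < e / 2) by lra.
  destruct (continuous_clim K 0 (Kc 0) _ He2) as [d0 [Hd0 C0]].
  destruct (continuous_clim K 1 (Kc 1) _ He2) as [d1 [Hd1 C1]].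
  (* The cut at 1 / 2 ensures a < b, so that the integral from a to b uses points of (0, 1) only. *)
  apply (Filter_prod _ _ _ (fun a => 0 < a < 1 / 2 /\ Rabs (a - 0) < d0)
    (fun b => 1 / 2 < b < 1 /\ Rabs (b - 1) < d1)).
  - assert (Hm : 0 < Rmin d0 (1 / 2)) by (apply Rmin_glb_lt; lra).
    exists (mkposreal _ Hm). intros a Ha Hpos. change (Rabs (a - 0) < Rmin d0 (1 / 2)) in Ha.
    generalize (Rmin_l d0 (1 / 2)) (Rmin_r d0 (1 / 2)). intros L1 L2.
    split; [|lra]. apply Rabs_def2 in Ha. lra.
  - assert (Hm : 0 < Rmin d1 (1 / 2)) by (apply Rmin_glb_lt; lra).
    exists (mkposreal _ Hm). intros a Ha Hpos. change (Rabs (a - 1) < Rmin d1 (1 / 2)) in Ha.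
    generalize (Rmin_l d1 (1 / 2)) (Rmin_r d1 (1 / 2)). intros L1 L2.
    split; [|lra]. apply Rabs_def2 in Ha. lra.
  - intros a b [Ha Ca] [Hb Cb]. exists (K b - K a)%C. split.
    + simpl. eapply is_RInt_ext; [|apply HK]. rewrite Rmin_left, Rmax_right by lra.
      intros x Hx. rewrite Hf; auto. lra.
    + apply HQ; [exact I|]. rewrite <- K1.
      replace (K b - K a - K 1)%C with ((K b - K 1) - (K a - K 0))%C by (rewrite K0; ring).
      eapply Rle_lt_trans; [apply Cmod_sub_le|]. specialize (C0 a Ca). specialize (C1 b Cb). lra.
Qed.

Lemma continuous_real_axis (f : C -> C) (p : R -> C) (u : R) (D : C -> Prop) :
  (forall s, D (p s)) -> continuous (U := C_UniformSpace) p u ->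
  clim (nb D (p u)) f (f (p u)) -> continuous (U := C_UniformSpace) (fun s => f (p s)) u.
Proof.
  intros HD Hp Hf. apply clim_continuous. intros e He. destruct (Hf e He) as [d [Hd H]].
  destruct (continuous_clim p u Hp d Hd) as [d' [Hd' H']].
  exists d'; split; auto.
Qed.

Lemma continuous_RtoC_affine (a b u : R) : continuous (U := C_UniformSpace) (fun s : R => RtoC (a + b * s)) u.
Proof.
  apply clim_continuous. intros e He. exists (e / (Rabs b + 1)).
  assert (Hb := Rabs_pos b). split; [apply Rdiv_lt_0_compat; lra|]. intros s Hs.
  rewrite <- RtoC_minus, Cmod_R. replace (a + b * s - (a + b * u)) with (b * (s - u)) by ring.
  rewrite Rabs_mult. apply Rle_lt_trans with ((Rabs b + 1) * Rabs (s - u)).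
  - apply Rmult_le_compat_r; [apply Rabs_pos|lra].
  - replace e with ((Rabs b + 1) * (e / (Rabs b + 1))) by (field; lra).
    apply Rmult_lt_compat_l; lra.
Qed.

Lemma continuous_Cmult_R (f g : R -> C) (u : R) :
  continuous (U := C_UniformSpace) f u -> continuous (U := C_UniformSpace) g u ->
  continuous (U := C_UniformSpace) (fun s => f s * g s)%C u.
Proof.
  intros Hf Hg.
  assert (K : forall k : R -> C, continuous (U := C_UniformSpace) k u ->
    clim (rnb (u - 1) (u + 1) u) k (k u)).
  { intros k Hk e He. destruct (continuous_clim k u Hk e He) as [d [Hd H]]. exists d; auto. }
  apply clim_continuous. intros e He.
  destruct (clim_mult _ _ _ _ (K f Hf) (K g Hg) e He) as [d [Hd H]].
  exists (Rmin d 1). split; [apply Rmin_glb_lt; lra|]. intros s Hs.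
  generalize (Rmin_l d 1) (Rmin_r d 1). intros.
  assert (Hs1 : Rabs (s - u) < 1) by lra. apply Rabs_def2 in Hs1. apply H; lra.
Qed.

Lemma continuous_Cpower_affine (a b c u : R) : 0 < c ->
  continuous (U := C_UniformSpace) (fun s : R => Cpower (a + b * s)%R c) u.
Proof.
  intros Hc. apply (continuous_real_axis (fun w => Cpower w c) (fun s => RtoC (a + b * s)) u closed_UHP).
  - intros; apply closed_UHP_R.
  - apply continuous_RtoC_affine.
  - apply clim_Cpower; auto. apply closed_UHP_R.
Qed.

(** The integrand is positive on (0, 1). This makes the division by the beta function in
    [Lauricella_FD] a genuine one. *)
Lemma Beta_neq_0 (a b : R) : 0 < a -> 0 < b -> Beta (1 + a) (1 + b) <> RtoC 0.
Proof.
  intros Ha Hb. unfold Beta.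
  set (G := fun u : R => (Cpower (0 + 1 * u)%R a * Cpower (1 + -1 * u)%R b)%C).
  assert (HG : forall u, continuous (U := C_UniformSpace) G u).
  { intros u. apply continuous_Cmult_R; now apply continuous_Cpower_affine. }
  assert (ex : ex_RInt (V := C_R_NormedModule) G 0 1).
  { apply (ex_RInt_continuous (V := C_R_CompleteNormedModule)). intros; apply HG. }
  destruct ex as [l Hl].
  rewrite (Cint01_continuous _ G l); auto.
  - assert (J := is_RInt_fct_extend_fst _ _ _ _ Hl).
    intros E. rewrite E in J.
    assert (Hpos : 0 < RInt (fun u => Re (G u)) 0 1).
    { apply RInt_gt_0; [lra| |].
      - intros u Hu. unfold G. rewrite !Cpower_Rpower by lra. simpl.
        rewrite Rmult_0_l, Rminus_0_r. apply Rmult_lt_0_compat; apply exp_pos.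
      - intros u _. apply continuity_pt_filterlim, continuity_pt_locally. intros e.
        destruct (continuous_clim G u (HG u) e (cond_pos e)) as [d [Hd H]].
        exists (mkposreal d Hd). intros y Hy. eapply Rle_lt_trans; [|apply (H y Hy)].
        generalize (re_le_Cmod (G y - G u)). destruct (G y), (G u); simpl; auto. }
    assert (RInt (fun u => Re (G u)) 0 1 = 0) by (apply is_RInt_unique; exact J). lra.
  - intros u Hu. unfold G.
    replace (1 + a - 1)%C with (RtoC a) by ring. replace (1 + b - 1)%C with (RtoC b) by ring.
    rewrite <- RtoC_minus. do 2 f_equal; f_equal; ring.
Qed.

Lemma Beta_Lauricella (a b : R) bs c zs : 0 < a -> 0 < b -> c = (2 + a + b)%C ->
  (Beta (1 + a) (1 + b) * Lauricella_FD (1 + a) bs c zs)%C =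
  Cint01 (fun u => Cpower u a * Cpower (1 - u) b *
    fold_right Cmult 1 (map (fun bz => Cpower (1 - u * snd bz) (- fst bz)) (combine bs zs)))%C.
Proof.
  intros Ha Hb ->. unfold Lauricella_FD.
  replace (2 + a + b - (1 + a))%C with (1 + b)%C by ring.
  replace (1 + a - 1)%C with (RtoC a) by ring. replace (1 + b - 1)%C with (RtoC b) by ring.
  assert (N := Beta_neq_0 a b Ha Hb). field. exact N.
Qed.

(** For an integral exponent the choice of the logarithm does not affect the power, so complex
    arguments cause no branch question. *)
Lemma Cpower_m2 w : w <> RtoC 0 -> Cpower w (- (2)) = (/ (w ^ 2))%C.
Proof.
  intros N. rewrite Cpower_exp by auto.
  replace (- (2) * Clog w)%C with (- (Clog w + Clog w))%C by ring.
  rewrite Cexp_opp, Cexp_plus, Cexp_Clog by auto. simpl. f_equal. ring.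
Qed.

Section Integrals.
Variables alpha beta gamma delta t : R.
Hypotheses (ha : 0 < alpha < 1) (hb : 0 < beta < 1) (hg : 0 < gamma < 1) (ht : 1 < t).
Variable z0 : C.
Hypotheses (hz0 : UHP z0).

Let g := integrand alpha beta gamma t z0.

Lemma continuous_integrand (a b u : R) : continuous (U := C_UniformSpace) (fun s : R => g (a + b * s)%R) u.
Proof.
  apply (continuous_real_axis g (fun s => RtoC (a + b * s)) u closed_UHP).
  - intros; apply closed_UHP_R.
  - apply continuous_RtoC_affine.
  - apply (clim_integrand alpha beta gamma t); auto; [apply closed_UHP_R|].
    intros E. symmetry in E. revert E. now apply UHP_neq_R.
Qed.

Lemma one_minus_conj_neq_0 (x : R) : (1 - x / Cconj z0)%C <> RtoC 0.
Proof.
  assert (N := UHP_neq_0 _ hz0).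
  replace (1 - x / Cconj z0)%C with (Cconj (1 - x / z0)).
  - apply Cconj_neq_0. now apply one_minus_neq_0.
  - rewrite Cminus_conj, Cdiv_conj, !Cconj_RtoC; auto.
Qed.

Lemma h1_formula l : is_RInt (V := C_R_NormedModule) (fun x : R => g x) 0 1 l ->
  l = (Beta (1 + alpha) (1 + beta) *
        Lauricella_FD (1 + alpha) [- gamma; RtoC 2; RtoC 2] (2 + alpha + beta)
          [1 / t; 1 / z0; 1 / Cconj z0])%C.
Proof.
  intros Hl. rewrite Beta_Lauricella by (auto; lra). symmetry.
  apply (Cint01_continuous _ (fun u : R => g (0 + 1 * u)%R)).
  - intros u Hu. rewrite Rplus_0_l, Rmult_1_l.
    cbn [combine map fold_right fst snd].
    assert (N := UHP_neq_0 _ hz0). assert (Nc := Cconj_neq_0 _ N).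
    assert (T := RtoC_neq_0 t ltac:(lra)).
    replace (u * (1 / t))%C with (u / t)%C by (field; auto).
    replace (u * (1 / z0))%C with (u / z0)%C by (field; auto).
    replace (u * (1 / Cconj z0))%C with (u / Cconj z0)%C by (field; auto).
    assert (N1 := one_minus_neq_0 z0 hz0 u). assert (N2 := one_minus_conj_neq_0 u).
    rewrite !Cpower_m2, Copp_involutive by auto.
    unfold g, integrand. rewrite one_minus_R, (one_minus_div_R t u) by lra.
    assert (Ht := one_minus_div_nonneg t u ltac:(lra) ltac:(lra)).
    rewrite !Cpower_low_real.
    rewrite (Cpower_nonneg (1 - u) beta), (Cpower_nonneg (1 - u / t) gamma) by lra.
    rewrite !Cconj_RtoC. simpl.
    assert (M1 := Cminus_eq_contra _ _ (UHP_neq_R _ u hz0)).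
    assert (M2 : (Cconj z0 - u)%C <> RtoC 0).
    { rewrite <- (Cconj_RtoC u), <- Cminus_conj. now apply Cconj_neq_0. }
    field. repeat split; auto.
  - intros u. apply continuous_integrand.
  - eapply is_RInt_ext; [|exact Hl]. intros x _. now rewrite Rplus_0_l, Rmult_1_l.
Qed.

(** On [1, t] the integrand of I is the modulus of that of h: replacing 1 - x by x - 1 removes the
    constant phase. *)
Lemma middle_integrand_eq (x : R) : 1 <= x <= t ->
  (Cpower x alpha * Cpower (x - 1) beta * Cpower (1 - x / t) gamma
     / ((1 - x / z0) ^ 2 * (1 - x / Cconj z0) ^ 2))%C = RtoC (Cmod (g x)).
Proof.
  intros Hx. unfold g, integrand. rewrite (denom_eq z0 hz0).
  assert (Dp := denom_pos z0 hz0 x). assert (Dn := RtoC_neq_0 _ (Rgt_not_eq _ _ Dp)).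
  assert (Ht := one_minus_div_nonneg t x ltac:(lra) ltac:(lra)).
  rewrite Cmod_div, !Cmod_mult, (Cmod_nonneg_R (denom z0 x)) by (auto; lra).
  rewrite one_minus_R, (one_minus_div_R t x) by lra. rewrite <- RtoC_minus.
  rewrite !Cpower_low_real, !Cmod_conj.
  assert (E : Cmod (Cpower (1 - x)%R beta) = Cmod (Cpower (x - 1)%R beta)).
  { destruct (Req_dec x 1) as [->|N]; [do 3 f_equal; ring|].
    rewrite !Cmod_Cpower, !Cmod_R by (apply RtoC_neq_0; lra). f_equal. apply Rabs_minus_sym. }
  rewrite E.
  rewrite (Cpower_nonneg x alpha), (Cpower_nonneg (x - 1) beta), (Cpower_nonneg (1 - x / t) gamma) at 1 by lra.
  now rewrite RtoC_div, !RtoC_mult by lra.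
Qed.

Lemma I_formula (r : R) : is_RInt (fun x : R => Cmod (g x)) 1 t r ->
  Cint (fun x : R => Cpower x alpha * Cpower (x - 1) beta * Cpower (1 - x / t) gamma
     / ((1 - x / z0) ^ 2 * (1 - x / Cconj z0) ^ 2))%C 1 t = RtoC r.
Proof.
  intros Hr. unfold Cint. apply (is_RInt_unique (V := C_R_CompleteNormedModule)).
  apply (is_RInt_ext (fun x : R => RtoC (Cmod (g x)))).
  - rewrite Rmin_left, Rmax_right by lra. intros x Hx. rewrite middle_integrand_eq; auto. lra.
  - apply is_RInt_fct_extend_pair; [exact Hr|]. simpl.
    evar_last; [apply (is_RInt_const (V := R_NormedModule))|].
    unfold scal; simpl; unfold mult; simpl. ring.
Qed.

(** Substitution x = 1 + (t - 1) u, under which 1 - x/z0 = ((z0 - 1) / z0) (1 - u (t - 1) / (z0 -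
    1)), similarly for conj z0, and 1 - x/t = (t - 1)(1 - u) / t. *)
Lemma I_Lauricella (r : R) : is_RInt (fun x : R => Cmod (g x)) 1 t r ->
  RtoC r = (Rpower (t - 1) (1 + beta + gamma) * Cmod z0 ^ 4
      / (Rpower t gamma * Cmod (z0 - 1) ^ 4) *
      (Beta (1 + beta) (1 + gamma) *
       Lauricella_FD (1 + beta) [- alpha; RtoC 2; RtoC 2] (2 + beta + gamma)
         [- (t - 1); (t - 1) / (z0 - 1); (t - 1) / (Cconj z0 - 1)]))%C.
Proof.
  intros Hr. rewrite Beta_Lauricella by (auto; lra).
  set (s := t - 1).
  assert (Hs : 0 < s) by (unfold s; lra). assert (Ns := RtoC_neq_0 s ltac:(lra)).
  assert (N := UHP_neq_0 _ hz0). assert (Nc := Cconj_neq_0 _ N).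
  assert (M := Cminus_eq_contra _ _ (UHP_neq_R _ 1 hz0)).
  assert (Mc : (Cconj z0 - 1)%C <> RtoC 0).
  { replace (Cconj z0 - 1)%C with (Cconj (z0 - 1)).
    - now apply Cconj_neq_0.
    - now rewrite Cminus_conj, Cconj_RtoC. }
  (* The powers of s = t - 1 come from dx, x - 1 and 1 - x/t, the power of t from 1 - x/t, and the
     fourth powers of moduli from the denominator. *)
  set (K := (Rpower s (1 + beta + gamma) * Cmod z0 ^ 4 / (Rpower t gamma * Cmod (z0 - 1) ^ 4))%C).
  assert (Z4 : (RtoC (Cmod z0) ^ 4)%C = ((z0 * Cconj z0) ^ 2)%C).
  { rewrite <- Cmod2_conj, RtoC_pow. simpl. ring. }
  assert (M4 : (RtoC (Cmod (z0 - 1)) ^ 4)%C = (((z0 - 1) * (Cconj z0 - 1)) ^ 2)%C).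
  { replace (Cconj z0 - 1)%C with (Cconj (z0 - 1)).
    - rewrite <- Cmod2_conj, RtoC_pow. simpl. ring.
    - now rewrite Cminus_conj, Cconj_RtoC. }
  assert (Rp : forall x y, RtoC (Rpower x y) <> RtoC 0).
  { intros x y. apply RtoC_neq_0. apply Rgt_not_eq, exp_pos. }
  assert (NK : K <> RtoC 0).
  { unfold K. rewrite Z4, M4.
    unfold Cdiv. repeat apply Cmult_neq_0; auto; try apply Cinv_neq_0; repeat apply Cmult_neq_0; auto;
      apply C1_nz. }
  rewrite (Cint01_continuous _ (fun u : R => / K * (s * RtoC (Cmod (g (1 + s * u)%R))))%C (/ K * r)%C).
  - fold K. field. exact NK.
  - intros u Hu. cbn [combine map fold_right fst snd].
    rewrite <- (middle_integrand_eq (1 + s * u)) by (unfold s in *; nra).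
    assert (N1 := one_minus_neq_0 z0 hz0 (1 + s * u)). assert (N2 := one_minus_conj_neq_0 (1 + s * u)).
    replace (t - 1)%C with (RtoC s) by (unfold s; now rewrite RtoC_minus).
    set (W := (1 - u * (s / (z0 - 1)))%C). set (W' := (1 - u * (s / (Cconj z0 - 1)))%C).
    assert (EW : (1 - (1 + s * u)%R / z0)%C = ((z0 - 1) / z0 * W)%C).
    { unfold W. rewrite RtoC_plus, RtoC_mult. field. auto. }
    assert (EW' : (1 - (1 + s * u)%R / Cconj z0)%C = ((Cconj z0 - 1) / Cconj z0 * W')%C).
    { unfold W'. rewrite RtoC_plus, RtoC_mult. field. auto. }
    assert (NW : W <> RtoC 0) by (intros E; apply N1; rewrite EW, E; ring).
    assert (NW' : W' <> RtoC 0) by (intros E; apply N2; rewrite EW', E; ring).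
    rewrite !Cpower_m2, Copp_involutive by auto. rewrite EW, EW'.
    replace (1 - u * - s)%C with (RtoC (1 + s * u)) by (rewrite RtoC_plus, RtoC_mult; ring).
    replace (RtoC (1 + s * u) - 1)%C with (RtoC (s * u)) by (rewrite RtoC_plus; ring).
    replace (1 - (1 + s * u)%R / t)%C with (RtoC (s * (1 - u) * / t)).
    2: { rewrite (one_minus_div_R t) by lra. f_equal. unfold s. field. lra. }
    rewrite <- RtoC_minus.
    assert (0 < s * u) by (apply Rmult_lt_0_compat; lra).
    assert (0 < s * (1 - u)) by (apply Rmult_lt_0_compat; lra).
    assert (0 < / t) by (apply Rinv_0_lt_compat; lra).
    rewrite !Cpower_Rpower by (try apply Rmult_lt_0_compat; lra).
    rewrite <- !Rpower_mult_distr by (try apply Rmult_lt_0_compat; lra).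
    assert (ET : Rpower (/ t) gamma = / Rpower t gamma).
    { rewrite <- Rpower_Ropp. unfold Rpower. rewrite ln_Rinv by lra. f_equal. ring. }
    rewrite ET. unfold K. rewrite Z4, M4.
    rewrite !Rpower_plus, Rpower_1 by lra.
    rewrite !RtoC_mult, RtoC_inv by (apply Rgt_not_eq, exp_pos).
    simpl. field. repeat split; auto.
  - intros u.
    assert (C1 : forall c : C, continuous (U := C_UniformSpace) (fun _ : R => c) u)
      by (intros; apply continuous_const).
    repeat apply continuous_Cmult_R; auto.
    apply clim_continuous. intros e He.
    destruct (continuous_clim _ u (continuous_integrand 1 s u) e He) as [d [Hd H]].
    exists d; split; auto. intros v Hv. specialize (H v Hv).
    rewrite <- RtoC_minus, Cmod_R. apply Rabs_def1.
    + generalize (Cmod_sub_ge (g (1 + s * v)%R) (g (1 + s * u)%R)). lra.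
    + rewrite Cmod_minus_sym in H.
      generalize (Cmod_sub_ge (g (1 + s * u)%R) (g (1 + s * v)%R)). lra.
  - apply is_RInt_Cscal.
    assert (J : is_RInt (fun u => s * Cmod (g (1 + s * u)%R)) 0 1 r).
    { assert (X : is_RInt (fun x : R => Cmod (g x)) (s * 0 + 1) (s * 1 + 1) r).
      { replace (s * 0 + 1) with 1 by ring. replace (s * 1 + 1) with t by (unfold s; ring). exact Hr. }
      generalize (is_RInt_comp_lin _ _ _ _ _ _ X). apply is_RInt_ext.
      intros u _. unfold scal; simpl; unfold mult; simpl. now rewrite (Rplus_comm (s * u)). }
    apply (is_RInt_ext (fun u => RtoC (s * Cmod (g (1 + s * u)%R)))).
    { intros u _. now rewrite RtoC_mult. }
    apply is_RInt_fct_extend_pair; [exact J|]. simpl.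
    evar_last; [apply (is_RInt_const (V := R_NormedModule))|].
    unfold scal; simpl; unfold mult; simpl. ring.
Qed.
End Integrals.

(** * The conformal map *)

Lemma nb_open (D : C -> Prop) z Q : nb everywhere z D -> nb D z Q -> nb everywhere z Q.
Proof.
  intros [d [Hd H]] [d' [Hd' H']]. exists (Rmin d d'). split; [now apply Rmin_glb_lt|].
  intros w _ Hw. generalize (Rmin_l d d') (Rmin_r d d'). intros.
  apply H'; [apply H; [exact I|lra]|lra].
Qed.

Section Map.
Variables alpha beta gamma delta t : R.
Hypotheses (ha : 0 < alpha < 1) (hb : 0 < beta < 1) (hg : 0 < gamma < 1)
  (hd : 0 < delta < 1) (hsum : alpha + beta + gamma + delta = 2) (ht : 1 < t).
Variable z0 : C.
Hypothesis hz0 : UHP z0.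
Let g := integrand alpha beta gamma t z0.
Variables (H : C -> C) (L A : C) (r1 r2 r3 r4 : R).
Hypotheses (A_neq_0 : A <> RtoC 0) (H_0 : H (RtoC 0) = RtoC 0)
  (H_der : forall p, closed_UHP p -> p <> z0 -> cder closed_UHP H p (g p))
  (H_inf : forall e, 0 < e -> exists M, forall z, closed_UHP z -> M < Cmod z -> Cmod (H z - L) < e)
  (H_pole : clim (nb (fun z => UHP z /\ z <> z0) z0) (fun z => (z - z0) * H z)%C A)
  (g_pole : clim (nb (fun z => UHP z /\ z <> z0) z0) (fun z => (z - z0) * (z - z0) * g z)%C (- A)%C).
Hypotheses (hr1 : 0 < r1) (hr2 : 0 < r2) (hr3 : 0 < r3) (hr4 : 0 < r4).
Let e2 := cis (- (PI * beta)).
Let e3 := cis (- (PI * (beta + gamma))).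
Let e4 := cis (PI * alpha).
Hypotheses (H_1 : H (RtoC 1) = RtoC r1) (H_t : (H t - H (RtoC 1))%C = (e2 * r2)%C)
  (L_t : (L - H t)%C = (e3 * r3)%C) (L_0 : (L - H (RtoC 0))%C = (- (e4 * r4))%C).

Let l2 := r2 / r1.
Let l3 := r3 / r1.
Let l4 := r4 / r1.
Let A3 := (- (e2 * l2))%C.
Let A4 := (A3 - e3 * l3)%C.
(** The map expressed through the primitive H, with r1 = H(1); it agrees with the map of the theorem
    on the closed half-plane off z0, and [a4] is its limit at infinity. *)
Let F z := (1 - H z / r1)%C.
Let F' z := (- (g z / r1))%C.
Let a4 := (1 - L / r1)%C.
Let Poly := closed_polyline4 (RtoC 1) (RtoC 0) A3 A4.

Lemma r1_neq_0 : RtoC r1 <> RtoC 0.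
Proof. apply RtoC_neq_0; lra. Qed.

Lemma l_pos : 0 < l2 /\ 0 < l3 /\ 0 < l4.
Proof. unfold l2, l3, l4. repeat split; now apply Rdiv_lt_0_compat. Qed.

Lemma F_0 : F (RtoC 0) = RtoC 1.
Proof. unfold F. rewrite H_0. assert (N := r1_neq_0). field. exact N. Qed.

Lemma F_1 : F (RtoC 1) = RtoC 0.
Proof. unfold F. rewrite H_1. assert (N := r1_neq_0). field. exact N. Qed.

Lemma RtoC_quot x : RtoC (x / r1) = (x / r1)%C.
Proof. apply RtoC_div. lra. Qed.

Lemma F_t : F t = A3.
Proof.
  assert (N := r1_neq_0). unfold F, A3, l2. rewrite RtoC_quot.
  replace (H t) with (H t - H (RtoC 1) + H (RtoC 1))%C by ring. rewrite H_t, H_1. field. exact N.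
Qed.

Lemma a4_A4 : a4 = A4.
Proof.
  assert (N := r1_neq_0). unfold A4. rewrite <- F_t. unfold a4, F, l3. rewrite RtoC_quot.
  replace L with (L - H t + H t)%C by ring. rewrite L_t. field. exact N.
Qed.

Lemma closing : A4 = (1 + e4 * l4)%C.
Proof.
  assert (N := r1_neq_0). rewrite <- a4_A4. unfold a4, l4. rewrite RtoC_quot.
  replace L with (L - H (RtoC 0) + H (RtoC 0))%C by ring. rewrite L_0, H_0. field. exact N.
Qed.

Lemma ratio_01 x r : 0 < r -> 0 <= x <= r -> 0 <= x / r <= 1.
Proof.
  intros Hr Hx. split.
  - apply Rmult_le_pos; [lra|]. left. now apply Rinv_0_lt_compat.
  - apply Rmult_le_reg_r with r; auto. unfold Rdiv. rewrite Rmult_assoc, Rinv_l; lra.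
Qed.

Lemma cis_mult_inj th x y : (cis th * RtoC x)%C = (cis th * RtoC y)%C -> x = y.
Proof.
  intros E. apply RtoC_inj.
  replace (RtoC x) with (Cconj (cis th) * (cis th * x))%C by (rewrite Cmult_assoc, cis_conj_l; ring).
  rewrite E, Cmult_assoc, cis_conj_l. ring.
Qed.

(** The total length r4 splits at x into two positive parts, and their ratio locates F x on the
    side. The next three lemmas split the other sides in the same way. *)
Lemma F_left (x : R) : x <= 0 -> exists s, 0 <= s <= 1 /\ F x = (1 + e4 * RtoC (s * l4))%C.
Proof.
  intros Hx. assert (N := r1_neq_0). destruct (Req_dec x 0) as [->|Nx].
  - exists 0. split; [lra|]. rewrite F_0, Rmult_0_l. ring.
  - destruct (increment alpha beta gamma t ha hb hg ht z0 hz0 H H_der x 0 (PI * alpha)) as [r [Hr [_ E]]];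
      [lra|intros u Hu; apply integrand_neg; auto; lra|intros u Hu; lra|].
    destruct (limit_left alpha beta gamma t ha hb hg ht z0 hz0 H H_der L H_inf x Hx) as [r' [Hr' E']].
    assert (S : r4 = r + r').
    { apply (cis_mult_inj (PI * alpha)). rewrite RtoC_plus.
      replace (cis (PI * alpha) * r4)%C with (- (L - H (RtoC 0)))%C by (rewrite L_0; unfold e4; ring).
      replace (L - H (RtoC 0))%C with ((L - H x) - (H (RtoC 0) - H x))%C by ring.
      rewrite E, E'. ring. }
    exists (r / r4). split; [apply ratio_01; lra|]. unfold F, l4.
    replace (H x) with (- (H (RtoC 0) - H x))%C by (rewrite H_0; ring). rewrite E. fold e4.
    replace (r / r4 * (r4 / r1)) with (r / r1) by (field; lra). rewrite RtoC_quot. field. exact N.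
Qed.

Lemma F_01 (x : R) : 0 < x < 1 -> exists s, 0 < s < 1 /\ F x = RtoC s.
Proof.
  intros Hx. assert (N := r1_neq_0).
  destruct (increment alpha beta gamma t ha hb hg ht z0 hz0 H H_der 0 x 0) as [r [Hr [_ E]]];
    [lra|intros u Hu; apply integrand_01; auto; lra|intros u Hu; lra|].
  destruct (increment alpha beta gamma t ha hb hg ht z0 hz0 H H_der x 1 0) as [r' [Hr' [_ E']]];
    [lra|intros u Hu; apply integrand_01; auto; lra|intros u Hu; lra|].
  assert (S : r1 = r + r').
  { apply (cis_mult_inj 0). rewrite RtoC_plus, cis_0, Cmult_1_l.
    rewrite <- H_1. replace (H (RtoC 1)) with ((H (RtoC 1) - H x) + (H x - H (RtoC 0)))%C by (rewrite H_0; ring).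
    rewrite E, E', cis_0. ring. }
  exists (r' / r1). split.
  - split; [now apply Rdiv_lt_0_compat|]. apply Rmult_lt_reg_r with r1; auto.
    unfold Rdiv. rewrite Rmult_assoc, Rinv_l; lra.
  - unfold F. replace (H x) with (H x - H (RtoC 0))%C by (rewrite H_0; ring). rewrite E, cis_0.
    rewrite RtoC_quot. replace r' with (r1 - r) by lra. rewrite RtoC_minus. field. exact N.
Qed.

Lemma F_1t (x : R) : 1 <= x <= t -> exists s, 0 <= s <= 1 /\ F x = (- (e2 * RtoC (s * l2)))%C.
Proof.
  intros Hx. assert (N := r1_neq_0).
  destruct (is_RInt_Cmod_integrand alpha beta gamma t ha hb hg ht z0 hz0 H H_der 1 x (- (PI * beta))) as [r [Hr E]];
    [lra|intros u Hu; apply integrand_1t; auto; lra|].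
  destruct (is_RInt_Cmod_integrand alpha beta gamma t ha hb hg ht z0 hz0 H H_der x t (- (PI * beta))) as [r' [Hr' E']];
    [lra|intros u Hu; apply integrand_1t; auto; lra|].
  assert (P : 0 <= r) by (apply (is_RInt_ge_0 (fun x : R => Cmod (g x)) 1 x r); [lra|exact Hr|intros; apply Cmod_ge_0]).
  assert (P' : 0 <= r') by (apply (is_RInt_ge_0 (fun x : R => Cmod (g x)) x t r'); [lra|exact Hr'|intros; apply Cmod_ge_0]).
  assert (S : r2 = r + r').
  { apply (cis_mult_inj (- (PI * beta))). fold e2. rewrite <- H_t, RtoC_plus.
    replace (H t - H (RtoC 1))%C with ((H t - H x) + (H x - H (RtoC 1)))%C by ring.
    rewrite E, E'. unfold e2. ring. }
  exists (r / r2). split; [apply ratio_01; lra|]. unfold F, l2.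
  replace (H x) with ((H x - H (RtoC 1)) + H (RtoC 1))%C by ring. rewrite E, H_1. fold e2.
  replace (r / r2 * (r2 / r1)) with (r / r1) by (field; lra). rewrite RtoC_quot. field. exact N.
Qed.

Lemma F_right (x : R) : t <= x -> exists s, 0 <= s <= 1 /\ F x = (A3 - e3 * RtoC (s * l3))%C.
Proof.
  intros Hx. assert (N := r1_neq_0).
  destruct (is_RInt_Cmod_integrand alpha beta gamma t ha hb hg ht z0 hz0 H H_der t x (- (PI * (beta + gamma)))) as [r [Hr E]];
    [lra|intros u Hu; apply integrand_t_inf; auto; lra|].
  assert (P : 0 <= r) by (apply (is_RInt_ge_0 (fun x : R => Cmod (g x)) t x r); [lra|exact Hr|intros; apply Cmod_ge_0]).
  destruct (limit_right alpha beta gamma t ha hb hg ht z0 hz0 H H_der L H_inf x Hx) as [r' [Hr' E']].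
  assert (S : r3 = r + r').
  { apply (cis_mult_inj (- (PI * (beta + gamma)))). fold e3. rewrite <- L_t, RtoC_plus.
    replace (L - H t)%C with ((L - H x) + (H x - H t))%C by ring.
    rewrite E, E'. unfold e3. ring. }
  exists (r / r3). split; [apply ratio_01; lra|]. rewrite <- F_t. unfold F, l3.
  replace (H x) with ((H x - H t) + H t)%C by ring. rewrite E. fold e3.
  replace (r / r3 * (r3 / r1)) with (r / r1) by (field; lra). rewrite RtoC_quot. field. exact N.
Qed.

Lemma F_real_on_polyline (x : R) : Poly (F x).
Proof.
  destruct (Rle_dec x 0) as [L1|L1].
  { right; right; right. destruct (F_left x L1) as [s [Hs ->]].
    exists (1 - s). split; [lra|]. rewrite closing, !RtoC_minus, RtoC_mult. ring. }
  destruct (Rlt_dec x 1) as [L2|L2].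
  { left. destruct (F_01 x) as [s [Hs ->]]; [lra|]. exists (1 - s). split; [lra|].
    rewrite !RtoC_minus. ring. }
  destruct (Rle_dec x t) as [L3|L3].
  { right; left. destruct (F_1t x) as [s [Hs ->]]; [lra|]. exists s. split; [lra|].
    unfold A3. rewrite RtoC_mult. ring. }
  right; right; left. destruct (F_right x) as [s [Hs ->]]; [lra|]. exists s. split; [lra|].
  unfold A4. rewrite RtoC_mult. ring.
Qed.

Lemma a4_on_polyline : Poly a4.
Proof.
  right; right; left. exists 1. split; [lra|]. rewrite a4_A4. ring.
Qed.

Lemma cder_F_closed p : closed_UHP p -> p <> z0 -> cder closed_UHP F p (F' p).
Proof.
  intros Hp N. unfold F, F'. apply cder_unique_val with (0 - / r1 * g p)%C; [unfold Cdiv; ring|].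
  apply cder_minus; [apply cder_const|].
  apply cder_ext with (fun z => / r1 * H z)%C; [unfold Cdiv; ring|apply filter_forall; intros; unfold Cdiv; ring|].
  apply cder_scal. now apply H_der.
Qed.

Lemma cder_F z : UHP z -> z <> z0 -> cder everywhere F z (F' z).
Proof.
  intros Hz N. apply (cder_UHP closed_UHP); auto; [apply UHP_closed|].
  apply cder_F_closed; auto. now apply UHP_closed.
Qed.

Lemma clim_F_boundary p : closed_UHP p -> p <> z0 -> clim (nb UHP p) F (F p).
Proof.
  intros Hp N. apply (clim_mono (nb closed_UHP p)).
  - intros Q. apply nb_mono, UHP_closed.
  - apply (cder_cont _ _ _ _ (cder_F_closed p Hp N)).
Qed.

Lemma R_neq_z0 (x : R) : RtoC x <> z0.
Proof. intros E. symmetry in E. revert E. now apply UHP_neq_R. Qed.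

Lemma clim_F'_closed p : closed_UHP p -> p <> z0 -> clim (nb closed_UHP p) F' (F' p).
Proof.
  intros Hp N. apply clim_opp. apply clim_mult; [|apply clim_const].
  now apply (clim_integrand alpha beta gamma t).
Qed.

Lemma clim_F' z : UHP z -> z <> z0 -> clim (nb everywhere z) F' (F' z).
Proof.
  intros Hz N. apply (clim_mono (nb closed_UHP z)).
  - intros Q. apply nb_open. generalize (UHP_open z Hz). apply filter_imp, UHP_closed.
  - apply clim_F'_closed; auto. now apply UHP_closed.
Qed.

Lemma F'_neq_0 z : UHP z -> z <> z0 -> F' z <> RtoC 0.
Proof.
  intros Hz N E. apply (integrand_neq_0 alpha beta gamma t ha ht z0 hz0 z Hz N). fold g.
  assert (N1 := r1_neq_0). replace (g z) with (- (F' z * r1))%C by (unfold F'; field; auto).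
  rewrite E. ring.
Qed.

Lemma F_inf e : 0 < e -> exists M, forall z, UHP z -> M < Cmod z -> Cmod (F z - a4) < e.
Proof.
  intros He. assert (He' : 0 < e * r1) by now apply Rmult_lt_0_compat.
  destruct (H_inf _ He') as [M HM]. exists M. intros z Hz Hlt.
  specialize (HM z (UHP_closed z Hz) Hlt). assert (N := r1_neq_0).
  replace (F z - a4)%C with (- (H z - L) / r1)%C by (unfold F, a4; field; auto).
  rewrite Cmod_div, Cmod_opp, (Cmod_nonneg_R r1) by (auto; lra).
  apply Rmult_lt_reg_r with r1; auto. unfold Rdiv. rewrite Rmult_assoc, Rinv_l; lra.
Qed.

Let D z := UHP z /\ z <> z0.
Let AF := (- (A / r1))%C.

Lemma AF_neq_0 : AF <> RtoC 0.
Proof.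
  intros E. apply A_neq_0. assert (N := r1_neq_0).
  replace A with (- (AF * r1))%C by (unfold AF; field; auto). rewrite E. ring.
Qed.

Lemma F_pole : clim (nb D z0) (fun z => (z - z0) * F z)%C AF.
Proof.
  assert (N := r1_neq_0).
  apply (clim_ext (fun z => (z - z0) - (z - z0) * H z * / r1)%C).
  - apply filter_forall. intros z. unfold F. field. auto.
  - assert (E : ((z0 - z0) - A * / r1)%C = AF) by (unfold AF, Cdiv; ring). rewrite <- E.
    apply clim_minus; [apply clim_minus; [apply clim_id|apply clim_const]|].
    apply clim_mult; [exact H_pole|apply clim_const].
Qed.

Lemma F'_pole : clim (nb D z0) (fun z => (z - z0) * (z - z0) * F' z)%C (- AF)%C.
Proof.
  assert (N := r1_neq_0).
  apply (clim_ext (fun z => - ((z - z0) * (z - z0) * g z) * / r1)%C).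
  - apply filter_forall. intros z. unfold F'. field. auto.
  - assert (E : (- - A * / r1)%C = (- AF)%C) by (unfold AF, Cdiv; ring). rewrite <- E.
    apply clim_mult; [now apply clim_opp|apply clim_const].
Qed.

(* On (0, 1) the derivative is negative, so f moves down when entering the
   upper half-plane. *)
Lemma F_below (x : R) : 0 < x < 1 -> nb UHP x (fun z => Im (F z) < 0).
Proof.
  intros Hx. set (k := Cmod (g x) / r1).
  assert (Hk : 0 < k).
  { apply Rdiv_lt_0_compat; auto. apply integrand_pos; auto; lra. }
  assert (Fx : F' x = RtoC (- k)).
  { unfold F', k. rewrite RtoC_opp, RtoC_quot. unfold g.
    rewrite (integrand_01 alpha beta gamma t) at 1 by (auto; lra). rewrite cis_0. now rewrite Cmult_1_l. }
  assert (Hk2 : 0 < k / 2) by lra.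
  destruct (clim_F'_closed x (closed_UHP_R x) (R_neq_z0 x) _ Hk2) as [d [Hd HF]].
  destruct (neq_open z0 closed_UHP x (R_neq_z0 x)) as [d1 [Hd1 HN]].
  (* The bounds x and 1 - x keep the foot of the perpendicular from z inside (0, 1). *)
  set (m := Rmin (Rmin d d1) (Rmin x (1 - x))).
  assert (M1 : m <= d) by (unfold m; eapply Rle_trans; [apply Rmin_l|apply Rmin_l]).
  assert (M2 : m <= d1) by (unfold m; eapply Rle_trans; [apply Rmin_l|apply Rmin_r]).
  assert (M3 : m <= x) by (unfold m; eapply Rle_trans; [apply Rmin_r|apply Rmin_l]).
  assert (M4 : m <= 1 - x) by (unfold m; eapply Rle_trans; [apply Rmin_r|apply Rmin_r]).
  exists m. split; [repeat apply Rmin_glb_lt; lra|]. intros z Hz Hlt.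
  set (u := Re z). set (y := Im z). assert (Hy : 0 < y) by exact Hz.
  assert (Hu : 0 < u < 1).
  { generalize (re_le_Cmod (z - x)). intros R1. assert (R2 : Rabs (Re (z - x)) < m) by lra.
    apply Rabs_def2 in R2. unfold u. destruct z; simpl in *. lra. }
  destruct (F_01 u Hu) as [s [_ Es]].
  assert (Hky : 0 < k * y / 4) by (assert (0 < k * y) by (now apply Rmult_lt_0_compat); lra).
  generalize (clim_shift u F _ (closed_UHP_R u) (clim_F_boundary u (closed_UHP_R u) (R_neq_z0 u)) _ Hky).
  intros [h [Hh Hsh]].
  (* At height eta the imaginary part is below k y / 4. From there up to z it drops by at least (k /
     2)(y - eta) >= k y / 4, so it ends below 0. *)
  set (eta := Rmin (h / 2) (y / 2)).
  assert (He : 0 < eta) by (apply Rmin_glb_lt; lra).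
  assert (He1 : eta <= h / 2) by apply Rmin_l. assert (He2 : eta <= y / 2) by apply Rmin_r.
  set (a := (u + Ci * RtoC eta)%C).
  assert (Ea : a = (u, eta)) by (unfold a; apply C_ext; simpl; ring).
  assert (Ez : z = (u, y)) by (unfold u, y; destruct z; reflexivity).
  assert (Eb : (z - a)%C = (0, y - eta)) by (rewrite Ea, Ez; apply C_ext; simpl; ring).
  assert (Hseg : forall r : R, 0 <= r <= 1 -> UHP (a + r * (z - a)) /\ Cmod (a + r * (z - a) - x) < m).
  { intros r Hr. split; [apply UHP_segment; auto; rewrite Ea; exact He|].
    apply Cmod_segment; auto.
    apply Rle_lt_trans with (Cmod (z - x)); auto.
    apply Rsqr_incr_0_var; [|apply Cmod_ge_0]. unfold Rsqr. rewrite !Cmod_sqr, Ea, Ez. simpl. nra. }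
  assert (MV : Cmod (F z - F a - F' x * (z - a)) <= k / 2 * Cmod (z - a)).
  { apply (mean_value_ineq F F'); intros r Hr; destruct (Hseg r Hr) as [S1 S2].
    - apply cder_F; auto. apply HN; [now apply UHP_closed|lra].
    - left. apply HF; [now apply UHP_closed|lra]. }
  assert (Cb : Cmod (z - a) = y - eta).
  { replace (z - a)%C with (Ci * RtoC (y - eta))%C.
    - rewrite Cmod_mult, Cmod_Ci, Cmod_nonneg_R; lra.
    - rewrite Eb. apply C_ext; simpl; ring. }
  assert (Ia : Im (F a) < k * y / 4).
  { assert (X : Cmod (F a - F u) < k * y / 4) by (apply Hsh; lra).
    rewrite Es in X. generalize (im_le_Cmod (F a - s)) (Rle_abs (Im (F a - s))).
    destruct (F a); simpl. lra. }
  generalize (im_le_Cmod (F z - F a - F' x * (z - a))) (Rle_abs (Im (F z - F a - F' x * (z - a)))).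
  rewrite Cb in MV. rewrite Fx, Eb in MV |- *.
  assert (IE : Im (F z - F a - RtoC (- k) * (0, y - eta)) = Im (F z) - Im (F a) + k * (y - eta)).
  { destruct (F z), (F a); simpl. ring. }
  rewrite IE. assert (k * (y / 2) <= k * (y - eta)) by (apply Rmult_le_compat_l; lra). lra.
Qed.

Let In := inside alpha beta gamma l2.
Let Out := outside alpha beta gamma l2.
Let x0 := 1 / 2.

Lemma Im_neg_Out w : Im w < 0 -> Out w.
Proof. intros Hw. left. now rewrite L1_Im. Qed.

Lemma side_interior (s : R) : 0 < s < 1 ->
  0 < side_dist e2 (RtoC 0) s /\ 0 < side_dist e3 A3 s /\ 0 < side_dist e4 (RtoC 1) s.
Proof.
  destruct l_pos as [P2 [P3 P4]]. intros Hs.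
  destruct (side_1_interior alpha beta gamma delta ha hb hg hd hsum l2 l3 l4 P2 P3 P4 closing s Hs)
    as [_ [? [? ?]]]. auto.
Qed.

(** On each of the other three intervals F lies on another side line, where one of the distances of
    [side_interior] vanishes. *)
Lemma same_side (x : R) (s : R) : 0 < s < 1 -> F x = RtoC s -> 0 < x < 1.
Proof.
  intros Hs E. destruct (side_interior s Hs) as [S2 [S3 S4]].
  destruct (Rle_dec x 0) as [L1|L1].
  { destruct (F_left x L1) as [r [Hr Er]]. rewrite E in Er. rewrite Er, side_dist_on in S4. lra. }
  destruct (Rlt_dec x 1) as [L2|L2]; [lra|exfalso].
  destruct (Rle_dec x t) as [L3|L3].
  { destruct (F_1t x) as [r [Hr Er]]; [lra|]. rewrite E in Er. rewrite Er in S2.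
    replace (- (e2 * RtoC (r * l2)))%C with (RtoC 0 + e2 * RtoC (- (r * l2)))%C in S2 by (rewrite RtoC_opp; ring).
    rewrite side_dist_on in S2. lra. }
  destruct (F_right x) as [r [Hr Er]]; [lra|]. rewrite E in Er. rewrite Er in S3.
  replace (A3 - e3 * RtoC (r * l3))%C with (A3 + e3 * RtoC (- (r * l3)))%C in S3 by (rewrite RtoC_opp; ring).
  rewrite side_dist_on in S3. lra.
Qed.

Lemma F_degree_one : (forall w, attained F z0 w <-> exterior Poly (Fin w)) /\
  (forall z1 z2, UHP z1 -> UHP z2 -> z1 <> z0 -> z2 <> z0 -> F z1 = F z2 -> z1 = z2).
Proof.
  destruct l_pos as [P2 [P3 P4]].
  assert (Hx0 : 0 < x0 < 1) by (unfold x0; lra).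
  destruct (F_01 x0 Hx0) as [s [Hs Es]].
  destruct (side_interior s Hs) as [S2 [S3 S4]].
  apply (degree_one F F' z0 AF a4 Poly hz0 cder_F clim_F' F'_neq_0 AF_neq_0 F_pole F'_pole
    clim_F_boundary F_real_on_polyline F_inf a4_on_polyline In Out (centroid beta gamma l2 l3) x0).
  - now apply (inside_off alpha beta gamma delta ha hb hg hd hsum l2 l3 l4 P2 P3 P4 closing).
  - intros. now apply inside_convex.
  - now apply (outside_exterior alpha beta gamma delta ha hb hg hd hsum l2 l3 l4 P2 P3 P4 closing).
  - now apply (inside_toward alpha beta gamma delta ha hb hg hd hsum l2 l3 l4 P2 P3 P4 closing).
  - generalize (F_below x0 Hx0). apply filter_imp. intros z. apply Im_neg_Out.
  - rewrite Es. unfold Out, outside. rewrite L1_Im. fold e2 e3 e4. fold A3. simpl. lra.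
  - intros x Ex. rewrite Es in Ex. generalize (F_below x (same_side x s Hs Ex)).
    apply filter_imp. intros z Hz [Hin _]. rewrite L1_Im in Hin. lra.
  - rewrite Es, a4_A4, closing. intros E. rewrite <- E, side_dist_on in S4. lra.
Qed.

(** * The map into the sphere and its boundary values *)

Variable f : C -> C.
Hypothesis f_F : forall z, closed_UHP z -> z <> z0 -> f z = F z.
Let phi z := if Ceq_dec z z0 then Inf else Fin (f z).

Lemma near_f_F p : closed_UHP p -> p <> z0 -> nb UHP p (fun z => F z = f z).
Proof.
  intros Hp N. generalize (filter_and _ _ (nb_domain UHP p) (neq_open z0 UHP p N)).
  apply filter_imp. intros z [Hz Nz]. symmetry. apply f_F; auto. now apply UHP_closed.
Qed.

Lemma phi_neq z : z <> z0 -> phi z = Fin (f z).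
Proof. intros N. unfold phi. destruct (Ceq_dec z z0); [contradiction|reflexivity]. Qed.

Lemma phi_z0 : phi z0 = Inf.
Proof. unfold phi. destruct (Ceq_dec z0 z0); [reflexivity|congruence]. Qed.

Lemma sphere_map_holomorphic z : UHP z -> holomorphic_at phi z.
Proof.
  intros Hz. unfold holomorphic_at. destruct (Ceq_dec z z0) as [->|N].
  - rewrite phi_z0. split.
    + apply locally_nb. apply nb_puncture; auto; [rewrite phi_z0; discriminate|].
      generalize (filter_and _ _ (nb_domain D z0) (f_large_near_pole F z0 AF AF_neq_0 F_pole 0)).
      apply filter_imp. intros w [[Hw Nw] Hl]. rewrite phi_neq by auto. intros E. injection E as E.
      rewrite f_F in E by (auto; now apply UHP_closed). rewrite E, Cmod_0 in Hl. lra.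
    + exists (/ AF)%C. apply cder_is_derive.
      apply cder_ext with (fun z => if Ceq_dec z z0 then RtoC 0 else (/ F z)%C).
      * rewrite phi_z0. simpl. destruct (Ceq_dec z0 z0); [reflexivity|congruence].
      * apply nb_puncture; auto.
        { rewrite phi_z0. simpl. destruct (Ceq_dec z0 z0); [reflexivity|congruence]. }
        generalize (nb_domain D z0). apply filter_imp. intros w [Hw Nw].
        rewrite phi_neq by auto. simpl. destruct (Ceq_dec w z0); [contradiction|].
        rewrite f_F; auto. now apply UHP_closed.
      * apply cder_q_z0; auto; [apply AF_neq_0|apply F_pole].
  - rewrite phi_neq by auto. split.
    + apply locally_nb. generalize (neq_open z0 everywhere z N). apply filter_imp.
      intros w Nw. rewrite phi_neq by auto. discriminate.
    + exists (F' z). apply cder_is_derive. apply cder_ext with F.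
      * rewrite phi_neq by auto. simpl. rewrite f_F; auto. now apply UHP_closed.
      * generalize (filter_and _ _ (UHP_open z Hz) (neq_open z0 everywhere z N)). apply filter_imp.
        intros w [Hw Nw]. rewrite phi_neq by auto. simpl. rewrite f_F; auto. now apply UHP_closed.
      * now apply cder_F.
Qed.

Lemma sphere_map_conformal : conformal_onto UHP phi (exterior Poly).
Proof.
  split; [exact sphere_map_holomorphic|split].
  - intros z1 z2 H1 H2 E. destruct (Ceq_dec z1 z0) as [E1|N1], (Ceq_dec z2 z0) as [E2|N2].
    + congruence.
    + rewrite E1, phi_z0, phi_neq in E by auto. discriminate.
    + rewrite E2, phi_z0, phi_neq in E by auto. discriminate.
    + rewrite !phi_neq in E by auto. injection E as E.
      rewrite !f_F in E by (auto; now apply UHP_closed). now apply (proj2 F_degree_one).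
  - intros [w|].
    + rewrite <- (proj1 F_degree_one). split.
      * intros [z [Hz [N E]]]. exists z. split; auto. rewrite phi_neq, f_F, E; auto. now apply UHP_closed.
      * intros [z [Hz E]]. destruct (Ceq_dec z z0) as [->|N]; [rewrite phi_z0 in E; discriminate|].
        rewrite phi_neq in E by auto. injection E as E. exists z. split; [|split]; auto.
        rewrite <- E. symmetry. apply f_F; auto. now apply UHP_closed.
    + split; [|intros; exact I]. intros _. exists z0. split; auto. apply phi_z0.
Qed.

Lemma boundary_value_R (x : R) a : F x = a -> boundary_value f (locally (T := C_UniformSpace) (RtoC x)) a.
Proof.
  intros <-. intros Q HQ.
  assert (CF : clim (nb UHP x) f (F x)).
  { apply (clim_ext F); [apply near_f_F|apply clim_F_boundary]; try apply closed_UHP_R; apply R_neq_z0. }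
  apply (within_nb UHP x (fun z => Q (f z))).
  exact (proj1 (clim_filterlim (nb UHP x) f (F x)) CF Q HQ).
Qed.

Lemma boundary_value_inf : boundary_value f Cnear_infinity A4.
Proof.
  intros Q HQ. apply locally_nb in HQ. destruct HQ as [e [He HQ]].
  destruct (F_inf e He) as [M HM]. exists (Rmax M (Cmod z0)). intros z Hz Uz.
  assert (M1 : M < Cmod z) by (eapply Rle_lt_trans; [apply Rmax_l|exact Hz]).
  assert (M2 : Cmod z0 < Cmod z) by (eapply Rle_lt_trans; [apply Rmax_r|exact Hz]).
  apply HQ; [exact I|]. rewrite f_F; [|now apply UHP_closed|intros ->; lra].
  rewrite <- a4_A4. now apply HM.
Qed.
End Map.

(** * Side lengths and conclusion *)

Open Scope C_scope.

Theorem theorem3p20 (alpha beta gamma delta t : R)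
  (halpha : (0 < alpha < 1)%R) (hbeta : (0 < beta < 1)%R)
  (hgamma : (0 < gamma < 1)%R) (hdelta : (0 < delta < 1)%R)
  (hsum : (alpha + beta + gamma + delta = 2)%R) (ht : (1 < t)%R) :
  exists z0 : C,
  unique (fun z => UHP z /\ z0_equation alpha beta gamma t z) z0 /\
  let h := hfun alpha beta gamma t z0 in
  let I := Cint (fun x : R =>
             Cpower x alpha * Cpower (x - 1) beta * Cpower (1 - x / t) gamma
             / ((1 - x / z0) ^ 2 * (1 - x / Cconj z0) ^ 2)) 1 t in
  let l1 := RtoC 1 in
  let l2 := I / h 1 in
  let l3 := (sin (PI * alpha) + l2 * sin (PI * (alpha + beta)))
            / sin (PI * delta) in
  let l4 := (sin (PI * (beta + gamma)) + l2 * sin (PI * gamma))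
            / sin (PI * delta) in
  let A1 := RtoC 1 in
  let A2 := RtoC 0 in
  let A3 := - l2 * Cexp (- (PI * beta * Ci)) in
  let A4 := A3 - l3 * Cexp (- (PI * (beta + gamma) * Ci)) in
  (forall z : C, closed_UHP z -> z <> z0 ->
     unique (h_value alpha beta gamma t z0 z) (h z)) /\
  conformal_onto UHP (fmap alpha beta gamma t z0)
    (exterior (closed_polyline4 A1 A2 A3 A4)) /\
  boundary_value (fval alpha beta gamma t z0)
    (locally (T := C_UniformSpace) (RtoC 0)) A1 /\
  boundary_value (fval alpha beta gamma t z0)
    (locally (T := C_UniformSpace) (RtoC 1)) A2 /\
  boundary_value (fval alpha beta gamma t z0)
    (locally (T := C_UniformSpace) (RtoC t)) A3 /\
  boundary_value (fval alpha beta gamma t z0) Cnear_infinity A4 /\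
  A4 = 1 + l4 * Cexp (PI * alpha * Ci) /\
  h 1 = Beta (1 + alpha) (1 + beta) *
        Lauricella_FD (1 + alpha) [- gamma; RtoC 2; RtoC 2] (2 + alpha + beta)
          [1 / t; 1 / z0; 1 / Cconj z0] /\
  I = Rpower (t - 1) (1 + beta + gamma) * Cmod z0 ^ 4
      / (Rpower t gamma * Cmod (z0 - 1) ^ 4) *
      (Beta (1 + beta) (1 + gamma) *
       Lauricella_FD (1 + beta) [- alpha; RtoC 2; RtoC 2] (2 + beta + gamma)
         [- (t - 1); (t - 1) / (z0 - 1); (t - 1) / (Cconj z0 - 1)]) /\
  RtoC (Cmod (A2 - A1)) = l1 /\
  RtoC (Cmod (A3 - A2)) = l2 /\
  RtoC (Cmod (A4 - A3)) = l3 /\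
  RtoC (Cmod (A1 - A4)) = l4.
Proof.
  destruct (z0_exists alpha beta gamma delta t halpha hbeta hgamma hdelta hsum ht) as [z0 [hz0 hE]].
  exists z0. split.
  { split; [now split|]. intros w [Hw Ew].
    now apply (z0_unique alpha beta gamma delta t). }
  destruct (primitive_exists alpha beta gamma delta t halpha hbeta hgamma hdelta hsum ht z0 hz0 hE)
    as [H [L [A [HA [H0 [Hder [Hinf [Hpole gpole]]]]]]]].
  assert (N0 := R_neq_z0 z0 hz0).
  (* r1 to r4 are the lengths of the images under H of the intervals (0, 1), (1, t), (t, infinity)
     and (-infinity, 0); division by r1 = h(1) normalises the first side to 1. *)
  destruct (increment alpha beta gamma t halpha hbeta hgamma ht z0 hz0 H Hder 0 1 0) as [r1 [Hr1 [I1 E1]]];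
    [lra|intros u Hu; apply integrand_01; auto; lra|intros u Hu; lra|].
  destruct (increment alpha beta gamma t halpha hbeta hgamma ht z0 hz0 H Hder 1 t (- (PI * beta))) as [r2 [Hr2 [I2 E2]]];
    [lra|intros u Hu; apply integrand_1t; auto; lra|intros u Hu; lra|].
  destruct (limit_right alpha beta gamma t halpha hbeta hgamma ht z0 hz0 H Hder L Hinf t) as [r3 [Hr3 E3]]; [lra|].
  destruct (limit_left alpha beta gamma t halpha hbeta hgamma ht z0 hz0 H Hder L Hinf 0) as [r4 [Hr4 E4]]; [lra|].
  assert (H1 : H (RtoC 1) = RtoC r1).
  { replace (H (RtoC 1)) with (H (RtoC 1) - H (RtoC 0)) by (rewrite H0; ring). rewrite E1, cis_0. ring. }
  assert (hval : forall z, closed_UHP z -> z <> z0 -> unique (h_value alpha beta gamma t z0 z) (H z)).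
  { apply h_value_unique; auto. intros p Hp Np. now apply clim_integrand. }
  assert (hfe : forall z, closed_UHP z -> z <> z0 -> hfun alpha beta gamma t z0 z = H z).
  { intros z Hz Nz. apply hfun_eq. now apply hval. }
  assert (h1 : hfun alpha beta gamma t z0 (RtoC 1) = RtoC r1).
  { rewrite hfe; auto. apply closed_UHP_R. }
  intros h I l1 l2 l3 l4 A1 A2 A3 A4.
  assert (EI : I = RtoC r2) by (apply I_formula; auto).
  assert (R1 := RtoC_neq_0 r1 (Rgt_not_eq _ _ Hr1)).
  (* The limit L at infinity is reached from both ends of the real axis; equating the two
     expressions closes the quadrilateral. *)
  assert (cl := closing alpha beta gamma t H L r1 r2 r3 r4 H0 Hr1 H1 E2 E3 E4).
  destruct (l_pos r1 r2 r3 r4 Hr1 Hr2 Hr3 Hr4) as [P2 [P3 P4]].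
  set (m2 := (r2 / r1)%R) in *. set (m3 := (r3 / r1)%R) in *. set (m4 := (r4 / r1)%R) in *.
  assert (Sd := RtoC_neq_0 _ (Rgt_not_eq _ _ (sin_PI_pos delta hdelta))).
  assert (El2 : l2 = RtoC m2).
  { unfold l2, h, m2. rewrite h1, EI, RtoC_div; auto. lra. }
  (* The statement defines l3 and l4 by sine formulas; the closing relation identifies them with the
     length ratios r3 / r1 and r4 / r1. *)
  assert (El3 : l3 = RtoC m3).
  { unfold l3. rewrite El2.
    rewrite (side_length_3 alpha beta gamma delta hdelta hsum m2 m3 m4 cl).
    rewrite RtoC_div, RtoC_plus, RtoC_mult; auto. intros E; apply Sd; now rewrite E. }
  assert (El4 : l4 = RtoC m4).
  { unfold l4. rewrite El2.
    rewrite (side_length_4 alpha beta gamma delta hdelta hsum m2 m3 m4 cl).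
    rewrite RtoC_div, RtoC_plus, RtoC_mult; auto. intros E; apply Sd; now rewrite E. }
  assert (Ec2 : Cexp (- (PI * beta * Ci)) = cis (- (PI * beta))).
  { unfold cis. f_equal. rewrite RtoC_opp, RtoC_mult. ring. }
  assert (Ec3 : Cexp (- (PI * (beta + gamma) * Ci)) = cis (- (PI * (beta + gamma)))).
  { unfold cis. f_equal. rewrite RtoC_opp, RtoC_mult, RtoC_plus. ring. }
  assert (Ec4 : Cexp (PI * alpha * Ci) = cis (PI * alpha)).
  { unfold cis. f_equal. rewrite RtoC_mult. ring. }
  assert (EA3 : A3 = - (cis (- (PI * beta)) * m2)).
  { unfold A3. rewrite El2, Ec2. ring. }
  assert (EA4 : A4 = - (cis (- (PI * beta)) * m2) - cis (- (PI * (beta + gamma))) * m3).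
  { unfold A4. rewrite EA3, El3, Ec3. ring. }
  assert (fF : forall z, closed_UHP z -> z <> z0 -> fval alpha beta gamma t z0 z = 1 - H z / r1).
  { intros z Hz Nz. unfold fval. rewrite h1, hfe; auto. }
  assert (BV := boundary_value_R alpha beta gamma t z0 hz0 H r1 Hder
    (fval alpha beta gamma t z0) fF).
  split; [|split; [|split; [|split; [|split; [|split; [|split; [|split; [|split; [|split; [|split; [|split]]]]]]]]]]].
  - intros z Hz Nz. unfold h. rewrite hfe by auto. now apply hval.
  - rewrite EA3, EA4.
    now apply (sphere_map_conformal alpha beta gamma delta t halpha hbeta hgamma hdelta hsum ht z0 hz0
      H L A r1 r2 r3 r4).
  - apply BV. apply F_0; auto.
  - apply BV. apply F_1; auto.
  - apply BV. rewrite EA3. apply F_t; auto.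
  - rewrite EA4. now apply (boundary_value_inf beta gamma t z0 H L r1 r2 r3).
  - rewrite EA4, El4, Ec4, cl. ring.
  - unfold h. rewrite hfe; [|apply closed_UHP_R|auto].
    apply h1_formula; auto.
    replace (H 1) with (H 1 - H 0) by (rewrite H0; ring).
    apply is_RInt_integrand; auto. lra.
  - rewrite EI. apply I_Lauricella; auto.
  - unfold A1, A2, l1. replace (0 - 1) with (- (1)) by ring. now rewrite Cmod_opp, Cmod_1.
  - rewrite El2, EA3. unfold A2. f_equal.
    replace (- (cis (- (PI * beta)) * m2) - 0) with (- (cis (- (PI * beta)) * m2)) by ring.
    rewrite Cmod_opp, Cmod_mult, Cmod_cis, Cmod_nonneg_R; lra.
  - rewrite El3, EA4, EA3. f_equal.
    match goal with |- Cmod ?x = _ => replace x with (- (cis (- (PI * (beta + gamma))) * m3)) by ring end.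
    rewrite Cmod_opp, Cmod_mult, Cmod_cis, Cmod_nonneg_R; lra.
  - rewrite El4, EA4, cl. unfold A1. f_equal.
    match goal with |- Cmod ?x = _ => replace x with (- (cis (PI * alpha) * m4)) by ring end.
    rewrite Cmod_opp, Cmod_mult, Cmod_cis, Cmod_nonneg_R; lra.
Qed.
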